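(* Let $p$ be a prime with $p\equiv -1\pmod 3$. For $k\in\mathbb{Z}\setminus\{0\}$ put $$\chi_k=\frac{2k\pi i}{\log p},\qquad \chi_{k/2}=\frac{k\pi i}{\log p},\qquad c_k=\frac{(1-2^{1+\chi_k}+3^{\chi_k})\,\zeta(\chi_k)}{\chi_k(1+\chi_k)\log p},$$ $$d_{k,j}=\frac{\zeta(\chi_{k/2},j/3)+(-1)^k\zeta(\chi_{k/2},-j/3)}{2\chi_{k/2}(1+\chi_{k/2})\log p}\quad\text{for } j\in\{1,-1\},$$ $$d_{k,0}=d_{k,1}+d_{k,-1}=\begin{cases}\dfrac{(3^{\chi_{k/2}}-1)\,\zeta(\chi_{k/2})}{\chi_{k/2}(1+\chi_{k/2})\log p},&\text{if $k$ is even},\\[2ex] 0,&\text{if $k$ is odd}.\end{cases}$$ Then for every positive integer $N$ the following exact formula holds: $$v_p(T(N))=N\log_p\frac{2}{\sqrt3}+N\,\Phi(\log_p N)+\Psi(N)+\frac{p+1}{6(p-1)},$$ where: (i) the function $\Phi(x)=\sum_{k\in\mathbb{Z}\setminus\{0\}}c_k e^{2k\pi i x}$ is $1$-periodic and continuous on $\mathbb{R}$; (ii) the function $$\Psi(N)=\Bigl(N+\frac13\Bigr)\psi_{1}\Bigl(\log_p\Bigl(N+\frac13\Bigr)\Bigr)+\Bigl(N-\frac13\Bigr)\psi_{-1}\Bigl(\log_p\Bigl(N-\frac13\Bigr)\Bigr)-N\,\psi_0(\log_p N)$$ is expressed in terms of the continuous $2$-periodic functions $\psi_j(x)=\sum_{k\in\mathbb{Z}\setminus\{0\}}d_{k,j}e^{k\pi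 i x}$, $j\in\{-1,0,1\}$, and satisfies $\Psi(N)=O(N^{1/2}\log N)$ as $N\to\infty$.
   Context: For a positive integer $N$, $T(N)=\prod_{j=0}^{N-1}\frac{(3j+1)!}{(N+j)!}$ (the number of $N\times N$ alternating sign matrices, a positive integer). For a positive integer $m$, $v_p(m)$ is the $p$-adic valuation, i.e. the largest $k$ such that $p^k$ divides $m$. $\log$ is the natural logarithm, $\log_p x=\log x/\log p$, and $a^{z}=e^{z\log a}$ for real $a>0$. The prime $p$ is fixed and implied constants in $O$-terms may depend on $p$. The Hurwitz zeta function is used with arbitrary real second argument: for $\alpha\in\mathbb{R}$, $\zeta(s,\alpha)=\sum_{n\in\mathbb{Z},\,n>-\alpha}(n+\alpha)^{-s}$ for $\operatorname{Re}s>1$, extended to all other $s\neq1$ by analytic continuation. For $0<\alpha\le1$ this is the usual Hurwitz zeta function; it is $1$-periodic in $\alpha$ (so $\zeta(s,-1/3)=\zeta(s,2/3)$), and for $\alpha\in\mathbb{Z}$ it equals the Riemann zeta function $\zeta(s)$. *)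

(* Defs.v *)
From Stdlib Require Import Reals ZArith ClassicalEpsilon.
From mathcomp Require Import ssreflect ssrfun ssrbool eqtype ssrnat seq div.
From mathcomp Require Import choice fintype bigop prime.
From Coquelicot Require Import Coquelicot.

Set Implicit Arguments.
Unset Strict Implicit.
Unset Printing Implicit Defensive.

Open Scope R_scope.

(* The denominator divides the numerator (the quotient counts the N x N
   alternating sign matrices), so the Euclidean quotient is the exact one. *)
Definition T (N : nat) : nat :=
  ((\prod_(j < N) (3 * j + 1)`!) %/ (\prod_(j < N) (N + j)`!))%N.

Definition Ci : C := (0, 1).

Definition Cexp (z : C) : C :=
  (exp (Re z) * cos (Im z), exp (Re z) * sin (Im z)).

(* a ^ z = e ^ (z log a), meaningful for a > 0 only *)
Definition Rcpow (a : R) (z : C) : C := Cexp (z * RtoC (ln a))%C.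

Definition logb (p : nat) (x : R) : R := ln x / ln (INR p).

Definition analytic_at (f : C -> C) (z0 : C) : Prop :=
  exists a : nat -> C,
    locally z0 (fun z : C =>
      @is_pseries C_AbsRing C_NormedModule a (z - z0)%C (f z)).

(* Since [up (- alpha)] is the least integer n > - alpha, the series runs over
   all n in Z with n > - alpha.  The domain C \ {1} being connected, f is
   determined outside s = 1. *)
Definition is_hurwitz_zeta (alpha : R) (f : C -> C) : Prop :=
  (forall s : C, 1 < Re s ->
     @is_series C_AbsRing C_NormedModule
       (fun m : nat => Rcpow (IZR (up (- alpha) + Z.of_nat m) + alpha) (- s)%C)
       (f s)) /\
  (forall s : C, s <> RtoC 1 -> analytic_at f s).

(* The continuation exists and is unique on C \ {1}; the arbitrary value that
   [epsilon] leaves at the pole s = 1 is never used. *)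
Definition hurwitz_zeta (s : C) (alpha : R) : C :=
  epsilon (inhabits (fun _ : C => RtoC 0)) (is_hurwitz_zeta alpha) s.

Definition riemann_zeta (s : C) : C := hurwitz_zeta s 1.

(* Sums over Z \ {0}, meant for absolutely summable families: the term of
   index n of the series groups the indices n + 1 and - (n + 1). *)
Definition nzpair (V : Type) (add : V -> V -> V) (a : Z -> V) (n : nat) : V :=
  add (a (Z.of_nat n.+1)) (a (- Z.of_nat n.+1)%Z).

Definition abs_summable_nz (a : Z -> C) : Prop :=
  ex_series (nzpair Rplus (fun k => Cmod (a k))).

Definition sum_nz (a : Z -> C) : C :=
  (Series (fun n => Re (nzpair Cplus a n)),
   Series (fun n => Im (nzpair Cplus a n))).

Definition chi (p : nat) (k : Z) : C :=
  (RtoC (2 * IZR k * PI / ln (INR p)) * Ci)%C.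

Definition chi_half (p : nat) (k : Z) : C :=
  (RtoC (IZR k * PI / ln (INR p)) * Ci)%C.

Definition sgnpow (k : Z) : C := if Z.even k then RtoC 1 else RtoC (-1).

Definition c_coef (p : nat) (k : Z) : C :=
  ((1 - Rcpow 2 (1 + chi p k) + Rcpow 3 (chi p k)) * riemann_zeta (chi p k)
   / (chi p k * (1 + chi p k) * RtoC (ln (INR p))))%C.

Definition d_coef_pm (p : nat) (k j : Z) : C :=
  ((hurwitz_zeta (chi_half p k) (IZR j / 3)
    + sgnpow k * hurwitz_zeta (chi_half p k) (- IZR j / 3))
   / (RtoC 2 * chi_half p k * (1 + chi_half p k) * RtoC (ln (INR p))))%C.

(* intended for j in {-1, 0, 1} *)
Definition d_coef (p : nat) (k j : Z) : C :=
  if Z.eqb j 0 then (d_coef_pm p k 1 + d_coef_pm p k (-1))%C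
  else d_coef_pm p k j.

Definition Phi_term (p : nat) (x : R) (k : Z) : C :=
  (c_coef p k * Cexp (RtoC (2 * IZR k * PI * x) * Ci))%C.

Definition Phi (p : nat) (x : R) : C := sum_nz (Phi_term p x).

Definition psi_term (p : nat) (j : Z) (x : R) (k : Z) : C :=
  (d_coef p k j * Cexp (RtoC (IZR k * PI * x) * Ci))%C.

Definition psi (p : nat) (j : Z) (x : R) : C := sum_nz (psi_term p j x).

Definition Psi (p N : nat) : C :=
  (RtoC (INR N + 1 / 3) * psi p 1 (logb p (INR N + 1 / 3))
   + RtoC (INR N - 1 / 3) * psi p (-1) (logb p (INR N - 1 / 3))
   - RtoC (INR N) * psi p 0 (logb p (INR N)))%C.

(* Main.v *)
(* By Legendre's formula, v_p (T N) is the sum over l >= 1 of p ^ l times a combination of the functions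
   [ramp al x = sum_n max (x - (n + al)) 0], al in {1, 1/3, 2/3}, evaluated at (multiples of N, N + 1/3, N - 1/3) / p ^ l;
   the values 1/3 and 2/3 alternate with the parity of l because p = 2 modulo 3, whence the base p ^ 2 for the psi_j.
   Each ramp is a quadratic plus a periodic function, so that such a sum is
   x * prof (log_b x) plus elementary terms, minus the Takagi-type function sum_m b ^ - m saw (b ^ m x), which is
   explicit at the points in question; here [prof] is 1-periodic and Hoelder of exponent 3/4.  By Bernstein's theorem
   its Fourier series converges absolutely.  The coefficients are Laplace integrals of [saw al (exp v)], which
   Euler-Maclaurin summation identifies with values zeta (chi, al) / (chi (chi + 1) log b), the analytic continuation
   of zeta being obtained by repeated integration by parts.  The scaling identities of [prof] under u -> u / 2 and
   under translation by log_b 3 give d_(k,0) and psi_0, and Hoelder continuity bounds Psi. *)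

Require Import Defs.
From Stdlib Require Import Reals ZArith ClassicalEpsilon Lra Lia Psatz.
From mathcomp Require Import ssreflect ssrfun ssrbool eqtype ssrnat seq div.
From mathcomp Require Import choice fintype bigop prime binomial zify.
From Coquelicot Require Import Coquelicot.

(** The formula is exact because [saw al] is a polynomial near 0: once a level is so high that no
    ramp has started, the functional equation of the Takagi-type series closes without error, and
    this is what defines the periodic profile. The leftover value of that series is explicit because
    multiplication by the base fixes the relevant classes modulo 1: integers for base p, and the
    classes of 1/3 and 2/3 for base p^2. The Hoelder exponent has to stay below 1, since all terms
    b^(-m) saw(b^m x) share one Lipschitz constant and only a smaller exponent gives a summable
    geometric ratio; it has to exceed 1/2 for Bernstein's theorem. The value 3/4 is expressible with
    two square roots, and it makes the effect of a shift of N by 1/3 smaller than the square root of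
    N. Since [hurwitz_zeta] is a value chosen by [epsilon], both the existence and the uniqueness of
    the continuation enter. All arguments that occur are purely imaginary and nonzero, so that
    uniqueness is needed only along horizontal lines that miss the pole. *)

Open Scope R_scope.

(** * The periodic parabola *)

(* The modulus of continuity [d ^ (3/4)]; Bernstein's theorem needs an exponent above 1/2. *)
Definition pow34 (d : R) : R := sqrt (d * sqrt d).

Lemma pow34_ge0 d : 0 <= pow34 d.
Proof. exact: sqrt_pos. Qed.

Lemma pow34_mult a b : 0 <= a -> 0 <= b -> pow34 (a * b) = pow34 a * pow34 b.
Proof.
move=> ha hb; rewrite /pow34 (sqrt_mult a b) //.
have ->: a * b * (sqrt a * sqrt b) = (a * sqrt a) * (b * sqrt b) by ring.
by rewrite sqrt_mult //; apply: Rmult_le_pos => //; apply: sqrt_pos.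
Qed.

Lemma pow34_pow a n : 0 <= a -> pow34 (a ^ n) = pow34 a ^ n.
Proof.
move=> ha; elim: n => [|n IH] /=.
  by rewrite /pow34 sqrt_1 Rmult_1_r sqrt_1.
by rewrite pow34_mult //; [rewrite IH | apply: pow_le].
Qed.

Lemma pow34_le a b : 0 <= a -> a <= b -> pow34 a <= pow34 b.
Proof.
move=> ha hab; apply: sqrt_le_1_alt; apply: Rmult_le_compat => //.
  exact: sqrt_pos.
exact: sqrt_le_1_alt.
Qed.

Lemma pow34_1 : pow34 1 = 1.
Proof. by rewrite /pow34 sqrt_1 Rmult_1_r sqrt_1. Qed.

Lemma pow34_ge_id d : 0 <= d <= 1 -> d <= pow34 d.
Proof.
move=> [h0 h1]; have hs := sqrt_sqrt d h0; have hp := sqrt_pos d.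
have h2 : sqrt d <= 1 by rewrite -sqrt_1; apply: sqrt_le_1_alt.
rewrite -{1}(sqrt_square d) //; apply: sqrt_le_1_alt.
by apply: Rmult_le_compat_l => //; nra.
Qed.

Lemma pow34_ge1 d : 1 <= d -> 1 <= pow34 d.
Proof. by move=> h; rewrite -pow34_1; apply: pow34_le => //; lra. Qed.

Lemma pow34_le_sqrt d : 0 <= d <= 1 -> pow34 d <= sqrt d.
Proof.
move=> [h0 h1]; apply: sqrt_le_1_alt; have hp := sqrt_pos d.
have h2 : sqrt d <= 1 by rewrite -sqrt_1; apply: sqrt_le_1_alt.
nra.
Qed.

Lemma pow34_lt_id b : 1 < b -> pow34 b < b.
Proof.
move=> hb; rewrite -{2}(sqrt_square b); last by lra.
apply: sqrt_lt_1_alt; have hb0 : 0 <= b by lra.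
have hs := sqrt_sqrt b hb0; have hp := sqrt_pos b.
have h1 : 1 < sqrt b by rewrite -sqrt_1; apply: sqrt_lt_1_alt; lra.
by split; [apply: Rmult_le_pos; lra | apply: Rmult_lt_compat_l; nra].
Qed.

Lemma pow34_sq d : 0 <= d -> pow34 d * pow34 d = d * sqrt d.
Proof. by move=> h; apply: sqrt_sqrt; apply: Rmult_le_pos => //; apply: sqrt_pos. Qed.

(** This is 1/12 minus half the second periodic Bernoulli function, the kernel of the
    Euler-Maclaurin formula of order two. *)
Definition bump (t : R) : R := frac_part t * (1 - frac_part t) / 2.

Lemma frac_partE (n : Z) f : 0 <= f < 1 -> frac_part (IZR n + f) = f.
Proof.
move=> h; rewrite /frac_part -(Int_part_spec (IZR n + f) n); lra.
Qed.

Lemma frac_part_decomp t : t = IZR (Int_part t) + frac_part t.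
Proof. rewrite /frac_part; ring. Qed.

Lemma frac_part_bound t : 0 <= frac_part t < 1.
Proof. have := base_fp t; lra. Qed.

Lemma frac_partD_Z t (n : Z) : frac_part (t + IZR n) = frac_part t.
Proof.
rewrite {1}(frac_part_decomp t).
have ->: IZR (Int_part t) + frac_part t + IZR n = IZR (Int_part t + n) + frac_part t.
  by rewrite plus_IZR; ring.
exact: frac_partE (frac_part_bound t).
Qed.

Lemma bumpD_Z t (n : Z) : bump (t + IZR n) = bump t.
Proof. by rewrite /bump frac_partD_Z. Qed.

Lemma bump_ge0 t : 0 <= bump t.
Proof.
rewrite /bump; have [h0 h1] := frac_part_bound t.
have h2 : 0 <= 1 - frac_part t by lra.
have := Rmult_le_pos _ _ h0 h2; lra.
Qed.

Lemma bump_le t : bump t <= 1 / 8.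
Proof. rewrite /bump; have := Rle_0_sqr (frac_part t - 1 / 2); rewrite /Rsqr; lra. Qed.

Lemma bump_unit t : 0 <= t <= 1 -> bump t = t * (1 - t) / 2.
Proof.
move=> [h0 h1]; case: (Rle_lt_or_eq_dec _ _ h1) => [h|->].
  by rewrite /bump -{1 2}(Rplus_0_l t) frac_partE //; lra.
by rewrite -(Rplus_0_l 1) (bumpD_Z 0 1) /bump -(Rplus_0_r 0) frac_partE; lra.
Qed.

Lemma bump_shift_unit (n : Z) t : IZR n <= t <= IZR n + 1 ->
  bump t = (t - IZR n) * (1 - (t - IZR n)) / 2.
Proof.
move=> h; rewrite -(bump_unit (t - IZR n)); last lra.
by rewrite -(bumpD_Z (t - IZR n) n); congr bump; ring.
Qed.

Lemma bump_opp t : bump (- t) = bump t.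
Proof.
have := frac_part_bound t; have := frac_part_decomp t; rewrite {2}/bump.
move: (frac_part t) => f ht hf.
rewrite (bump_shift_unit (- Int_part t - 1)) minus_IZR opp_IZR; last lra.
by move: ht; move: (IZR (Int_part t)) => m ->; field.
Qed.

(* [bump] is the upper envelope of the parabolas vanishing at consecutive integers. *)
Lemma bump_envelope (n : Z) t : (t - IZR n) * (1 - (t - IZR n)) / 2 <= bump t.
Proof.
case: (Rle_dec 0 (t - IZR n)) => h0; last by have := bump_ge0 t; nra.
case: (Rle_dec (t - IZR n) 1) => h1; last by have := bump_ge0 t; nra.
by rewrite (bump_shift_unit n); lra.
Qed.

(** The parabola of the unit interval containing [x] agrees with [bump] at [x] and lies below it at
    [y], and its slope is at most 1/2 on that interval. When [y] is outside the interval,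
    [bump y >= 0] is enough. *)
Lemma bump_lip_aux x y : bump x - bump y <= Rabs (x - y) / 2.
Proof.
have ha := frac_part_bound x; have hx := frac_part_decomp x.
have hy := bump_envelope (Int_part x) y; have hy0 := bump_ge0 y.
rewrite {1}/bump; set a := frac_part x in ha hx *.
have -> : x - y = a - (y - IZR (Int_part x)) by lra.
set c := y - IZR (Int_part x) in hy *.
rewrite /Rabs; case: Rcase_abs => hd; case: (Rle_dec 0 c) => h0; case: (Rle_dec c 1) => h1; nra.
Qed.

Lemma bump_lip x y : Rabs (bump x - bump y) <= Rabs (x - y) / 2.
Proof.
have h1 := bump_lip_aux x y; have h2 := bump_lip_aux y x.
rewrite (Rabs_minus_sym y x) in h2; apply: Rabs_le; lra.
Qed.

(** At distances above 1 boundedness takes over from the Lipschitz bound, so that the estimate is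
    global. *)
Lemma bump_pow34 x y : Rabs (bump x - bump y) <= pow34 (Rabs (x - y)).
Proof.
have h := bump_lip x y; have hp := Rabs_pos (x - y).
case: (Rle_dec (Rabs (x - y)) 1) => h1.
  by have := pow34_ge_id _ (conj hp h1); lra.
have h2 := pow34_ge1 (Rabs (x - y)).
have := bump_ge0 x; have := bump_ge0 y; have := bump_le x; have := bump_le y.
move=> *; apply: Rabs_le; lra.
Qed.

Lemma lipschitz_continuous (f : R -> R) k x :
  (forall y, Rabs (f y - f x) <= k * Rabs (y - x)) -> continuous f x.
Proof.
move=> hf; apply/filterlim_locally => eps.
have hk : 0 < Rabs k + 1 by have := Rabs_pos k; lra.
have hd : 0 < eps / (Rabs k + 1) by apply: Rdiv_lt_0_compat => //; apply: cond_pos.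
exists (mkposreal _ hd) => y; rewrite /ball /= /AbsRing_ball /abs /minus /plus /opp /= => hy.
apply: Rle_lt_trans (hf y) _.
apply: Rle_lt_trans (_ : (Rabs k + 1) * Rabs (y - x) < _).
  by apply: Rmult_le_compat_r; [apply: Rabs_pos | have := Rle_abs k; lra].
have := Rmult_lt_compat_l _ _ _ hk hy.
by have ->: (Rabs k + 1) * (eps / (Rabs k + 1)) = eps by field; lra.
Qed.

Lemma bump_continuous x : continuous bump x.
Proof.
by apply: (lipschitz_continuous _ (1/2)) => y; have := bump_lip y x; lra.
Qed.

(** * Continuity and integration of real functions *)

Section RealIntegrals.

Implicit Types f g : R -> R.

Lemma cts_plus f g : (forall x, continuous f x) -> (forall x, continuous g x) ->
  forall x, continuous (fun y => f y + g y) x.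
Proof. by move=> hf hg x; exact: (continuous_plus f g x (hf x) (hg x)). Qed.

Lemma cts_minus f g : (forall x, continuous f x) -> (forall x, continuous g x) ->
  forall x, continuous (fun y => f y - g y) x.
Proof. by move=> hf hg x; exact: (continuous_minus f g x (hf x) (hg x)). Qed.

Lemma cts_mult f g : (forall x, continuous f x) -> (forall x, continuous g x) ->
  forall x, continuous (fun y => f y * g y) x.
Proof. by move=> hf hg x; exact: (continuous_mult f g x (hf x) (hg x)). Qed.

Lemma cts_const (c : R) : forall x : R, continuous (fun _ : R => c) x.
Proof. by move=> x; apply: continuous_const. Qed.

Lemma cts_id : forall x : R, continuous (fun y : R => y) x.
Proof. by move=> x; apply: continuous_id. Qed.

Lemma cts_comp f g : (forall x, continuous f x) -> (forall x, continuous g x) ->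
  forall x, continuous (fun y => g (f y)) x.
Proof. by move=> hf hg x; apply: continuous_comp. Qed.

Lemma cts_derivable g g' : (forall x, is_derive g x (g' x)) -> forall x, continuous g x.
Proof. by move=> h x; apply: ex_derive_continuous; exists (g' x). Qed.

Lemma cts_cos : forall x, continuous cos x.
Proof. by apply: (cts_derivable _ (fun x => - sin x)) => x; apply/is_derive_Reals/derivable_pt_lim_cos. Qed.

Lemma cts_sin : forall x, continuous sin x.
Proof. by apply: (cts_derivable _ cos) => x; apply/is_derive_Reals/derivable_pt_lim_sin. Qed.

Lemma cts_exp : forall x, continuous exp x.
Proof. by apply: (cts_derivable _ exp) => x; apply/is_derive_Reals/derivable_pt_lim_exp. Qed.

Lemma cts_ex_RInt f a b : (forall x, continuous f x) -> ex_RInt f a b.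
Proof. by move=> hf; apply: (@ex_RInt_continuous R_CompleteNormedModule) => z _. Qed.

Lemma cts_is_RInt f a b : (forall x, continuous f x) -> is_RInt f a b (RInt f a b).
Proof. by move=> hf; apply: (@RInt_correct R_CompleteNormedModule); apply: cts_ex_RInt. Qed.

Lemma RIntD f g a b : (forall x, continuous f x) -> (forall x, continuous g x) ->
  RInt (fun x => f x + g x) a b = RInt f a b + RInt g a b.
Proof. by move=> hf hg; apply: (@RInt_plus R_CompleteNormedModule); apply: cts_ex_RInt. Qed.

Lemma RIntB f g a b : (forall x, continuous f x) -> (forall x, continuous g x) ->
  RInt (fun x => f x - g x) a b = RInt f a b - RInt g a b.
Proof. by move=> hf hg; apply: (@RInt_minus R_CompleteNormedModule); apply: cts_ex_RInt. Qed.

Lemma RIntZ f c a b : (forall x, continuous f x) ->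
  RInt (fun x => c * f x) a b = c * RInt f a b.
Proof. by move=> hf; apply: (@RInt_scal R_CompleteNormedModule); apply: cts_ex_RInt. Qed.

Lemma RInt_eq f g a b : (forall x, f x = g x) -> RInt f a b = RInt g a b.
Proof. by move=> h; apply: RInt_ext => x _. Qed.

Lemma RInt_abs_le f a b M : a <= b -> (forall x, continuous f x) ->
  (forall x, a <= x <= b -> Rabs (f x) <= M) -> Rabs (RInt f a b) <= (b - a) * M.
Proof.
move=> hab hf hM; apply: (@norm_RInt_le_const R_NormedModule f) => //.
exact: cts_is_RInt.
Qed.

Lemma RInt_mono f g a b : a <= b -> (forall x, continuous f x) -> (forall x, continuous g x) ->
  (forall x, a <= x <= b -> f x <= g x) -> RInt f a b <= RInt g a b.
Proof.
move=> hab hf hg h; apply: RInt_le => //; try exact: cts_ex_RInt.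
by move=> x hx; apply: h; lra.
Qed.

End RealIntegrals.

Ltac cts := repeat first
  [ assumption | exact: cts_cos | exact: cts_sin | exact: cts_exp
  | match goal with |- forall x, continuous (fun _ => ?c) x => exact: (cts_const c) end
  | exact: cts_id
  | match goal with
    | |- forall x, continuous (fun y => _ + _) x => apply: cts_plus
    | |- forall x, continuous (fun y => _ - _) x => apply: cts_minus
    | |- forall x, continuous (Rplus ?c) x => exact: (cts_plus _ _ (cts_const c) cts_id)
    | |- forall x, continuous (Rminus ?c) x => exact: (cts_minus _ _ (cts_const c) cts_id)
    | |- forall x, continuous (Rmult ?c) x => exact: (cts_mult _ _ (cts_const c) cts_id)
    | |- forall x, continuous (fun y => _ * _) x => apply: cts_mult
    | |- forall x, continuous (fun y => cos _) x => apply: (cts_comp _ cos)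
    | |- forall x, continuous (fun y => sin _) x => apply: (cts_comp _ sin)
    | |- forall x, continuous (fun y => exp _) x => apply: (cts_comp _ exp)
    | hf : (forall x, continuous ?f x) |- forall x, continuous (fun y => ?f _) x => apply: (cts_comp _ f)
    end ].

(** The target is a general module because the lemma serves real as well as complex integrands. *)
Lemma RInt_periodic (V : CompleteNormedModule R_AbsRing) (f : R -> V) a :
  (forall x, continuous f x) -> (forall x, f (x + 1) = f x) ->
  RInt f a (a + 1) = RInt f 0 1.
Proof.
move=> hf hp.
have hex c d : ex_RInt f c d by apply: ex_RInt_continuous => z _.
have h1 : RInt f 1 (a + 1) = RInt f 0 a.
  have := RInt_comp_lin f 1 1 0 a.
  have ->: 1 * 0 + 1 = 1 by ring.
  have ->: 1 * a + 1 = a + 1 by ring.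
  move=> /(_ (hex _ _)) <-; apply: RInt_ext => x _.
  by rewrite scal_one Rmult_1_l hp.
rewrite -(RInt_Chasles f a 0 (a + 1)) // -(RInt_Chasles f 0 1 (a + 1)) // h1.
rewrite -(opp_RInt_swap f 0 a) // plus_comm -plus_assoc plus_opp_r.
by rewrite plus_zero_r.
Qed.

(* Equalities between values of [RInt] are typed in the carrier of a structure, which hides [R] from [ring] and [field]. *)
Ltac toR := match goal with |- @eq _ ?a ?b => change (@eq R a b) end.

(** * Real Fourier coefficients *)

Lemma cos_shift_Z x (k : Z) : cos (x + 2 * PI * IZR k) = cos x.
Proof.
case: (Z_le_dec 0 k) => hk.
  rewrite -(Z2Nat.id k) // -INR_IZR_INZ -(cos_period x (Z.to_nat k)).
  congr cos; ring.
rewrite -(cos_period (x + 2 * PI * IZR k) (Z.to_nat (- k))).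
rewrite INR_IZR_INZ Z2Nat.id ?opp_IZR; last lia.
congr cos; ring.
Qed.

Lemma sin_shift_Z x (k : Z) : sin (x + 2 * PI * IZR k) = sin x.
Proof.
by rewrite -!cos_shift -(cos_shift_Z (PI / 2 - x) (- k)) opp_IZR; congr cos; ring.
Qed.

Definition tcos (k : Z) (u : R) : R := cos (2 * PI * IZR k * u).
Definition tsin (k : Z) (u : R) : R := sin (2 * PI * IZR k * u).

Lemma cts_tcos k : forall u, continuous (tcos k) u.
Proof. rewrite /tcos; cts. Qed.

Lemma cts_tsin k : forall u, continuous (tsin k) u.
Proof. rewrite /tsin; cts. Qed.

Ltac ctst := repeat first [ exact: cts_tcos | exact: cts_tsin | progress cts ].

Lemma tcos_periodic k u : tcos k (u + 1) = tcos k u.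
Proof. by rewrite /tcos -(cos_shift_Z (2 * PI * IZR k * u) k); congr cos; ring. Qed.

Lemma tsin_periodic k u : tsin k (u + 1) = tsin k u.
Proof. by rewrite /tsin -(sin_shift_Z (2 * PI * IZR k * u) k); congr sin; ring. Qed.

Lemma two_pi_k_neq0 (k : Z) : k <> 0%Z -> 2 * PI * IZR k <> 0.
Proof.
move=> hk; have := PI_neq0; have := not_0_IZR _ hk => h1 h2.
by apply: Rmult_integral_contrapositive_currified => //; lra.
Qed.

Lemma RInt_tcos (k : Z) : k <> 0%Z -> RInt (tcos k) 0 1 = 0.
Proof.
move=> hk; have hn := two_pi_k_neq0 _ hk.
apply: is_RInt_unique.
have := is_RInt_derive (fun u => / (2 * PI * IZR k) * tsin k u) (tcos k) 0 1 _ _.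
have e : sin (2 * PI * IZR k) = 0 by rewrite -(Rplus_0_l (2 * PI * IZR k)) sin_shift_Z sin_0.
rewrite /tsin Rmult_0_r sin_0 Rmult_0_r Rmult_1_r e Rmult_0_r.
rewrite /minus plus_opp_r; apply.
  by move=> x _; rewrite /tcos; auto_derive => //; field; move: hn; split=> h; apply: hn; rewrite h; ring.
by move=> x _; apply: cts_tcos.
Qed.

Lemma RInt_tcos0 : RInt (tcos 0) 0 1 = 1.
Proof.
rewrite (RInt_eq _ (fun _ => 1)); last by move=> x; rewrite /tcos Rmult_0_r Rmult_0_l cos_0.
by rewrite RInt_const /scal /= /mult /=; ring.
Qed.

Lemma RInt_tsin (k : Z) : RInt (tsin k) 0 1 = 0.
Proof.
case: (Z.eq_dec k 0) => [->|hk].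
  rewrite (RInt_eq _ (fun _ => 0)); last by move=> x; rewrite /tsin Rmult_0_r Rmult_0_l sin_0.
  by rewrite RInt_const /scal /= /mult /=; ring.
have hn := two_pi_k_neq0 _ hk.
apply: is_RInt_unique.
have := is_RInt_derive (fun u => - / (2 * PI * IZR k) * tcos k u) (tsin k) 0 1 _ _.
have e : cos (2 * PI * IZR k) = 1 by rewrite -(Rplus_0_l (2 * PI * IZR k)) cos_shift_Z cos_0.
rewrite /tcos Rmult_0_r cos_0 !Rmult_1_r e Rmult_1_r.
rewrite /minus plus_opp_r; apply.
  by move=> x _; rewrite /tsin; auto_derive => //; field; move: hn; split=> h; apply: hn; rewrite h; ring.
by move=> x _; apply: cts_tsin.
Qed.

Lemma tcos_tcos j k u : tcos j u * tcos k u = 1 / 2 * tcos (j + k) u + 1 / 2 * tcos (j - k) u.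
Proof.
rewrite /tcos plus_IZR minus_IZR.
have ->: 2 * PI * (IZR j + IZR k) * u = 2 * PI * IZR j * u + 2 * PI * IZR k * u by ring.
have ->: 2 * PI * (IZR j - IZR k) * u = 2 * PI * IZR j * u - 2 * PI * IZR k * u by ring.
rewrite cos_plus cos_minus; field.
Qed.

Lemma tsin_tsin j k u : tsin j u * tsin k u = 1 / 2 * tcos (j - k) u - 1 / 2 * tcos (j + k) u.
Proof.
rewrite /tcos /tsin plus_IZR minus_IZR.
have ->: 2 * PI * (IZR j + IZR k) * u = 2 * PI * IZR j * u + 2 * PI * IZR k * u by ring.
have ->: 2 * PI * (IZR j - IZR k) * u = 2 * PI * IZR j * u - 2 * PI * IZR k * u by ring.
rewrite cos_plus cos_minus; field.
Qed.

Lemma tcos_tsin j k u : tcos j u * tsin k u = 1 / 2 * tsin (j + k) u - 1 / 2 * tsin (j - k) u.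
Proof.
rewrite /tcos /tsin plus_IZR minus_IZR.
have ->: 2 * PI * (IZR j + IZR k) * u = 2 * PI * IZR j * u + 2 * PI * IZR k * u by ring.
have ->: 2 * PI * (IZR j - IZR k) * u = 2 * PI * IZR j * u - 2 * PI * IZR k * u by ring.
rewrite sin_plus sin_minus; field.
Qed.

Definition fcos (f : R -> R) (k : Z) : R := RInt (fun u => f u * tcos k u) 0 1.
Definition fsin (f : R -> R) (k : Z) : R := RInt (fun u => f u * tsin k u) 0 1.

Lemma fcos_tcos j k : (0 < j)%Z -> (0 < k)%Z -> fcos (tcos j) k = if Z.eqb j k then 1 / 2 else 0.
Proof.
move=> hj hk; rewrite /fcos (RInt_eq _ _ _ _ (tcos_tcos j k)).
rewrite RIntD ?RIntZ; ctst.
rewrite (RInt_tcos (j + k)); last lia.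
case: Z.eqb_spec => [->|h]; first by rewrite Z.sub_diag RInt_tcos0; lra.
rewrite RInt_tcos; lia || lra.
Qed.

Lemma fsin_tsin j k : (0 < j)%Z -> (0 < k)%Z -> fsin (tsin j) k = if Z.eqb j k then 1 / 2 else 0.
Proof.
move=> hj hk; rewrite /fsin (RInt_eq _ _ _ _ (tsin_tsin j k)).
rewrite RIntB ?RIntZ; ctst.
rewrite (RInt_tcos (j + k)); last lia.
case: Z.eqb_spec => [->|h]; first by rewrite Z.sub_diag RInt_tcos0; lra.
rewrite RInt_tcos; lia || lra.
Qed.

Lemma fsin_tcos j k : fsin (tcos j) k = 0.
Proof.
rewrite /fsin (RInt_eq _ _ _ _ (tcos_tsin j k)).
by rewrite RIntB ?RIntZ; ctst; rewrite !RInt_tsin; lra.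
Qed.

Lemma fcos_tsin j k : fcos (tsin j) k = 0.
Proof.
rewrite -(fsin_tcos k j) /fcos /fsin; apply: RInt_eq => x; ring.
Qed.

(** * Finite sums, with the empty sum allowed *)

Fixpoint psum (u : nat -> R) (n : nat) : R :=
  match n with O => 0 | S m => psum u m + u m end.

Lemma psum_sum_n u n : sum_n u n = psum u (S n).
Proof.
elim: n => [|n IH]; first by rewrite sum_O /= Rplus_0_l.
by rewrite sum_Sn IH.
Qed.

Lemma psum_add u m n : psum u (m + n)%coq_nat = psum u m + psum (fun i => u (m + i)%coq_nat) n.
Proof.
elim: n => [|n IH]; first by rewrite Nat.add_0_r /= Rplus_0_r.
by rewrite Nat.add_succ_r /= IH Rplus_assoc.
Qed.

Lemma psum_le u v n : (forall i, (i < n)%coq_nat -> u i <= v i) -> psum u n <= psum v n.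
Proof.
elim: n => [|n IH] h /=; first exact: Rle_refl.
by apply: Rplus_le_compat; [apply: IH => i hi; apply: h; lia | apply: h; lia].
Qed.

Lemma psum_eq u v n : (forall i, (i < n)%coq_nat -> u i = v i) -> psum u n = psum v n.
Proof.
elim: n => [|n IH] h //=.
by congr (_ + _); [apply: IH => i hi; apply: h; lia | apply: h; lia].
Qed.

Lemma psum_const c n : psum (fun _ => c) n = INR n * c.
Proof. by elim: n => [|n IH]; [rewrite /=; ring | rewrite S_INR /= IH; ring]. Qed.

Lemma psum_lin c d u v n : psum (fun i => c * u i + d * v i) n = c * psum u n + d * psum v n.
Proof. by elim: n => [|n IH] /=; [ring | rewrite IH; ring]. Qed.

Lemma psum_scal c u n : psum (fun i => c * u i) n = c * psum u n.
Proof. by elim: n => [|n IH] /=; [ring | rewrite IH; ring]. Qed.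

Lemma psum_ge0 u n : (forall i, 0 <= u i) -> 0 <= psum u n.
Proof. by move=> h; elim: n => [|n IH] /=; [lra | have := h n; lra]. Qed.

Lemma psum_mono u m n : (forall i, 0 <= u i) -> (m <= n)%coq_nat -> psum u m <= psum u n.
Proof.
move=> h hmn; have -> : n = (m + (n - m)%coq_nat)%coq_nat by lia.
rewrite psum_add -{1}(Rplus_0_r (psum u m)); apply: Rplus_le_compat_l.
by apply: psum_ge0.
Qed.

Lemma psum_geom r n : r <> 1 -> psum (fun i => r ^ i) n = (1 - r ^ n) / (1 - r).
Proof.
move=> hr; elim: n => [|n IH] /=; first by field; lra.
rewrite IH; field; lra.
Qed.

Lemma psum_geom_le r n : 0 <= r < 1 -> psum (fun i => r ^ i) n <= / (1 - r).
Proof.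
move=> hr; rewrite psum_geom; last lra.
have h := pow_le r n (proj1 hr).
have hi : 0 < / (1 - r) by apply: Rinv_0_lt_compat; lra.
rewrite /Rdiv; nra.
Qed.

Lemma ex_series_bounded u M : (forall i, 0 <= u i) -> (forall n, psum u n <= M) -> ex_series u.
Proof.
move=> h0 hM.
have [l hl] : ex_finite_lim_seq (sum_n u).
  apply: (ex_finite_lim_seq_incr _ M) => n; rewrite !psum_sum_n //.
  by move: (h0 (S n)) => /=; lra.
by exists l.
Qed.

(** The indexing of positive frequencies is that of [nzpair], so that real Fourier series and sums
    over nonzero integers compare term by term. *)
Definition zk (i : nat) : Z := Z.of_nat (S i).

Definition fnorm2 (f : R -> R) (k : Z) : R := fcos f k * fcos f k + fsin f k * fsin f k.

(** One Gram-Schmidt step: [tcos k] and [tsin k] have square norm 1/2 over a period, whence the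
    factors 2, and orthogonality leaves the other positive frequencies untouched. *)
Lemma fourier_project (f : R -> R) k : (0 < k)%Z -> (forall x, continuous f x) ->
  let g := fun u : R => f u - 2 * fcos f k * tcos k u - 2 * fsin f k * tsin k u in
  [/\ forall x, continuous g x,
      RInt (fun u => g u * g u) 0 1 = RInt (fun u => f u * f u) 0 1 - 2 * fnorm2 f k &
      forall j, (0 < j)%Z -> j <> k -> fcos g j = fcos f j /\ fsin g j = fsin f j].
Proof.
move=> hk hf; set a := fcos f k; set b := fsin f k => g.
have hg : forall x, continuous g x by rewrite /g; ctst.
split=> //.
- rewrite (RInt_eq _ (fun u => f u * f u + (- 4 * a) * (f u * tcos k u)
    + (- 4 * b) * (f u * tsin k u) + (4 * a * a) * (tcos k u * tcos k u)
    + (4 * b * b) * (tsin k u * tsin k u) + (8 * a * b) * (tcos k u * tsin k u))); last first.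
    by move=> u; rewrite /g; ring.
  rewrite !RIntD ?RIntZ; ctst.
  rewrite -/(fcos f k) -/(fsin f k) -/(fcos (tcos k) k) -/(fsin (tsin k) k) -/(fsin (tcos k) k).
  rewrite fcos_tcos // fsin_tsin // fsin_tcos Z.eqb_refl /fnorm2 -/a -/b; toR; field.
- move=> j hj hjk; split; rewrite /fcos /fsin.
  + rewrite (RInt_eq _ (fun u => f u * tcos j u + (- 2 * a) * (tcos k u * tcos j u)
      + (- 2 * b) * (tsin k u * tcos j u))); last by move=> u; rewrite /g; ring.
    rewrite !RIntD ?RIntZ; ctst.
    rewrite -/(fcos (tcos k) j) -/(fcos (tsin k) j) fcos_tcos // fcos_tsin.
    by case: Z.eqb_spec => [h|_]; [case: hjk | lra].
  + rewrite (RInt_eq _ (fun u => f u * tsin j u + (- 2 * a) * (tcos k u * tsin j u)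
      + (- 2 * b) * (tsin k u * tsin j u))); last by move=> u; rewrite /g; ring.
    rewrite !RIntD ?RIntZ; ctst.
    rewrite -/(fsin (tcos k) j) -/(fsin (tsin k) j) fsin_tcos // fsin_tsin //.
    by case: Z.eqb_spec => [h|_]; [case: hjk | lra].
Qed.

(** Bessel's inequality: what remains after removing n harmonics has a nonnegative square integral.
    The induction must record that the higher coefficients are still those of [f], since the next
    step removes one of them. *)
Lemma bessel (f : R -> R) n : (forall x, continuous f x) ->
  2 * psum (fun i => fnorm2 f (zk i)) n <= RInt (fun u => f u * f u) 0 1.
Proof.
move=> hf.
have [g [hg hn _]] : exists g, [/\ forall x, continuous g x,
    RInt (fun u => g u * g u) 0 1 = RInt (fun u => f u * f u) 0 1 - 2 * psum (fun i => fnorm2 f (zk i)) n &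
    forall j, (Z.of_nat n < j)%Z -> fcos g j = fcos f j /\ fsin g j = fsin f j].
  elim: n => [|n [g [hg hn hj]]]; first by exists f; split=> //=; lra.
  have hk : (0 < zk n)%Z by rewrite /zk; lia.
  have [h1 h2 h3] := fourier_project g (zk n) hk hg.
  eexists; split; [exact: h1 | rewrite h2 hn /= /fnorm2 | move=> j hjn].
    have [-> ->] := hj (zk n) ltac:(rewrite /zk; lia); ring.
  have [-> ->] := h3 j ltac:(lia) ltac:(rewrite /zk; lia).
  by apply: hj; lia.
have : 0 <= RInt (fun u => g u * g u) 0 1.
  apply: (RInt_ge_0 (fun u => g u * g u)); [lra | apply: cts_ex_RInt; cts |].
  by move=> x _; exact: Rle_0_sqr.
lra.
Qed.

(** * Bernstein's theorem *)

Lemma RInt_shift_periodic (f : R -> R) h : (forall x, continuous f x) ->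
  (forall x, f (x + 1) = f x) -> RInt (fun u => f (u + h)) 0 1 = RInt f 0 1.
Proof.
move=> hf hp; rewrite -(RInt_periodic _ f h hf hp).
have := RInt_comp_lin f 1 h 0 1 (cts_ex_RInt _ _ _ hf).
have ->: 1 * 0 + h = h by ring.
have ->: 1 * 1 + h = h + 1 by ring.
by move=> <-; apply: RInt_eq => u; rewrite scal_one Rmult_1_l.
Qed.

Lemma tcos_sub k u h : tcos k (u - h) = tcos k u * tcos k h + tsin k u * tsin k h.
Proof. by rewrite /tcos /tsin -cos_minus; congr cos; ring. Qed.

Lemma tsin_sub k u h : tsin k (u - h) = tsin k u * tcos k h - tcos k u * tsin k h.
Proof. by rewrite /tcos /tsin -sin_minus; congr sin; ring. Qed.

Lemma pow2_pos m : (0 < Nat.pow 2 m)%coq_nat.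
Proof. by have := Nat.pow_nonzero 2 m ltac:(lia); lia. Qed.

Section PeriodicFourier.

Variable f : R -> R.
Hypothesis f_cts : forall x, continuous f x.
Hypothesis f_per : forall x, f (x + 1) = f x.

Lemma fcos_shift h k : fcos (fun u => f (u + h)) k = tcos k h * fcos f k + tsin k h * fsin f k.
Proof.
rewrite /fcos -(RInt_eq (fun u => (fun w => f w * tcos k (w - h)) (u + h))); last first.
  by move=> u /=; congr (_ * tcos _ _); ring.
rewrite (RInt_shift_periodic (fun w => f w * tcos k (w - h))); last first.
- move=> x; rewrite f_per; congr (_ * _); rewrite -(tcos_periodic _ (x - h)); congr tcos; ring.
- have h1 : forall w, continuous (fun w => tcos k (w - h)) w by apply: (cts_comp _ (tcos k)); ctst.
  by cts.
rewrite (RInt_eq _ (fun u => tcos k h * (f u * tcos k u) + tsin k h * (f u * tsin k u))); last first.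
  by move=> u; rewrite tcos_sub; ring.
by rewrite RIntD ?RIntZ; ctst.
Qed.

Lemma fsin_shift h k : fsin (fun u => f (u + h)) k = tcos k h * fsin f k - tsin k h * fcos f k.
Proof.
rewrite /fsin -(RInt_eq (fun u => (fun w => f w * tsin k (w - h)) (u + h))); last first.
  by move=> u /=; congr (_ * tsin _ _); ring.
rewrite (RInt_shift_periodic (fun w => f w * tsin k (w - h))); last first.
- move=> x; rewrite f_per; congr (_ * _); rewrite -(tsin_periodic _ (x - h)); congr tsin; ring.
- have h1 : forall w, continuous (fun w => tsin k (w - h)) w by apply: (cts_comp _ (tsin k)); ctst.
  by cts.
rewrite (RInt_eq _ (fun u => tcos k h * (f u * tsin k u) - tsin k h * (f u * tcos k u))); last first.
  by move=> u; rewrite tsin_sub; ring.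
by rewrite RIntB ?RIntZ; ctst.
Qed.

Lemma cts_shift h : forall u, continuous (fun u => f (u + h)) u.
Proof. by apply: (cts_comp _ f); cts. Qed.

(** The symmetric difference of step h multiplies the k-th complex harmonic by 2 i sin (2 pi k
    h). *)
Lemma fnorm2_diff h k :
  fnorm2 (fun u => f (u + h) - f (u + - h)) k = 4 * (tsin k h * tsin k h) * fnorm2 f k.
Proof.
have hc := cts_shift h; have hc' := cts_shift (- h).
have e1 : fcos (fun u => f (u + h) - f (u + - h)) k = 2 * tsin k h * fsin f k.
  rewrite /fcos (RInt_eq _ (fun u => f (u + h) * tcos k u - f (u + - h) * tcos k u)); last by move=> u; ring.
  rewrite RIntB; ctst.
  have := fcos_shift h k; have := fcos_shift (- h) k; rewrite /fcos => -> ->.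
  have ->: tsin k (- h) = - tsin k h by rewrite /tsin -sin_neg; congr sin; ring.
  have ->: tcos k (- h) = tcos k h by rewrite /tcos -(cos_neg (_ * h)); congr cos; ring.
  ring.
have e2 : fsin (fun u => f (u + h) - f (u + - h)) k = - 2 * tsin k h * fcos f k.
  rewrite /fsin (RInt_eq _ (fun u => f (u + h) * tsin k u - f (u + - h) * tsin k u)); last by move=> u; ring.
  rewrite RIntB; ctst.
  have := fsin_shift h k; have := fsin_shift (- h) k; rewrite /fsin => -> ->.
  have ->: tsin k (- h) = - tsin k h by rewrite /tsin -sin_neg; congr sin; ring.
  have ->: tcos k (- h) = tcos k h by rewrite /tcos -(cos_neg (_ * h)); congr cos; ring.
  ring.
by rewrite /fnorm2 e1 e2; ring.
Qed.

Variable K : R.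
Hypothesis f_holder : forall x y, Rabs (f x - f y) <= K * pow34 (Rabs (x - y)).

(** Bessel's inequality for the symmetric difference, whose size is controlled by the Hoelder bound
    at distance [2 * h]. The 8 is the 2 of Bessel times the 4 of [fnorm2_diff]. *)
Lemma fourier_diff_bound h n : 0 <= h ->
  8 * psum (fun i => tsin (zk i) h * tsin (zk i) h * fnorm2 f (zk i)) n
    <= (K * pow34 (2 * h)) * (K * pow34 (2 * h)).
Proof.
move=> hh; set g := fun u => f (u + h) - f (u + - h).
have hc := cts_shift h; have hc' := cts_shift (- h).
have hg : forall u, continuous g u by rewrite /g; cts.
have := bessel g n hg.
rewrite (psum_eq _ (fun i => 4 * (tsin (zk i) h * tsin (zk i) h * fnorm2 f (zk i)))); last first.
  by move=> i _; rewrite fnorm2_diff; ring.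
rewrite psum_scal => hb.
apply: Rle_trans (_ : RInt (fun u => g u * g u) 0 1 <= _); first by lra.
have hM u : Rabs (g u * g u) <= (K * pow34 (2 * h)) * (K * pow34 (2 * h)).
  have := f_holder (u + h) (u + - h).
  have ->: u + h - (u + - h) = 2 * h by ring.
  rewrite (Rabs_pos_eq (2 * h)); last lra.
  rewrite -/(g u) Rabs_mult => hgu.
  by apply: Rmult_le_compat => //; apply: Rabs_pos.
have := RInt_abs_le (fun u => g u * g u) 0 1 _ Rle_0_1 _ (fun u _ => hM u).
move=> /(_ ltac:(cts)); have := Rle_abs (RInt (fun u => g u * g u) 0 1); lra.
Qed.

(** The frequencies k of the block satisfy 2^m <= k < 2^(m+1), the predecessor making up for the
    successor in [zk]. With h = 2^(-m-3) the angle 2 pi k h lies between pi/4 and pi/2. *)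
Lemma tsin_sq_dyadic m i : (i < Nat.pow 2 m)%coq_nat ->
  1 / 2 <= tsin (zk (Nat.pred (Nat.pow 2 m) + i)%coq_nat) ((1 / 2) ^ (m + 3)%coq_nat)
           * tsin (zk (Nat.pred (Nat.pow 2 m) + i)%coq_nat) ((1 / 2) ^ (m + 3)%coq_nat).
Proof.
move=> hi.
have hsq x : sin x * sin x = (1 - cos (2 * x)) / 2 by rewrite cos_2a_sin; field.
rewrite /tsin hsq.
have hk : IZR (zk (Nat.pred (Nat.pow 2 m) + i)%coq_nat) = 2 ^ m + INR i.
  rewrite /zk -INR_IZR_INZ.
  have -> : S (Nat.pred (Nat.pow 2 m) + i)%coq_nat = (Nat.pow 2 m + i)%coq_nat by have := pow2_pos m; lia.
  by rewrite plus_INR pow_INR.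
have hp : 0 < 2 ^ m by apply: pow_lt; lra.
have hi0 := pos_INR i; have hi1 : INR i < 2 ^ m by have := lt_INR _ _ hi; rewrite pow_INR.
have hh : (1 / 2) ^ (m + 3)%coq_nat * 2 ^ m = 1 / 8.
  by rewrite pow_add Rmult_comm -Rmult_assoc -Rpow_mult_distr; rewrite (_ : 2 * (1 / 2) = 1); [rewrite pow1; field | field].
have hhp : 0 < (1 / 2) ^ (m + 3)%coq_nat by apply: pow_lt; lra.
have := PI_RGT_0; rewrite hk; move: hh hhp hi0 hi1 hp.
move: ((1 / 2) ^ (m + 3)%coq_nat) (2 ^ m) (INR i) => t b r ht ht0 hr0 hr1 hb0 hpi.
have h1 : 1 / 8 <= (b + r) * t by nra.
have h2 : (b + r) * t <= 1 / 4 by nra.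
suff : cos (2 * (2 * PI * (b + r) * t)) <= 0 by lra.
have ->: 2 * (2 * PI * (b + r) * t) = 4 * PI * ((b + r) * t) by ring.
by apply: cos_le_0; nra.
Qed.

Lemma dyadic_block_bound m :
  psum (fun i => fnorm2 f (zk (Nat.pred (Nat.pow 2 m) + i)%coq_nat)) (Nat.pow 2 m)%coq_nat
    <= K * K * (pow34 (1 / 2) ^ (m + 2)%coq_nat * pow34 (1 / 2) ^ (m + 2)%coq_nat).
Proof.
have hh : 0 <= (1 / 2) ^ (m + 3)%coq_nat by apply: pow_le; lra.
have := fourier_diff_bound _ (Nat.pred (Nat.pow 2 m) + Nat.pow 2 m)%coq_nat hh.
have -> : 2 * (1 / 2) ^ (m + 3)%coq_nat = (1 / 2) ^ (m + 2)%coq_nat.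
  by rewrite !pow_add /=; field.
rewrite pow34_pow; last lra.
rewrite psum_add.
set s1 := psum _ (Nat.pred (Nat.pow 2 m))%coq_nat; set s2 := psum _ (Nat.pow 2 m)%coq_nat => h.
have hn j : 0 <= fnorm2 f j by rewrite /fnorm2; apply: Rplus_le_le_0_compat; exact: Rle_0_sqr.
have h1 : 0 <= s1.
  by apply: psum_ge0 => i; apply: Rmult_le_pos => //; exact: Rle_0_sqr.
have h2 : psum (fun i => 1 / 2 * fnorm2 f (zk (Nat.pred (Nat.pow 2 m) + i)%coq_nat)) (Nat.pow 2 m)%coq_nat <= s2.
  by apply: psum_le => i hi; apply: Rmult_le_compat_r => //; apply: tsin_sq_dyadic.
rewrite psum_scal in h2.
have : 0 <= psum (fun i => fnorm2 f (zk (Nat.pred (Nat.pow 2 m) + i)%coq_nat)) (Nat.pow 2 m)%coq_nat by apply: psum_ge0.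
nra.
Qed.

(** Bernstein's theorem. A block of 2^m frequencies has energy of order 2^(-3m/2), hence absolute
    sum of order r^m with r = 2^(-1/4), and the blocks add up to a geometric series. *)
Lemma fourier_abs_bound : exists M, forall n,
  psum (fun i => Rabs (fcos f (zk i)) + Rabs (fsin f (zk i))) n <= M.
Proof.
set e := fun i => Rabs (fcos f (zk i)) + Rabs (fsin f (zk i)).
have he i : 0 <= e i by apply: Rplus_le_le_0_compat; apply: Rabs_pos.
set r := sqrt (sqrt (1 / 2)).
have hr2 : r * r = sqrt (1 / 2) by apply: sqrt_sqrt; apply: sqrt_pos.
have hs : sqrt (1 / 2) * sqrt (1 / 2) = 1 / 2 by apply: sqrt_sqrt; lra.
have hs0 := sqrt_pos (1 / 2).
have hr0 : 0 < r by do 2 apply: sqrt_lt_R0; lra.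
have hs1 : sqrt (1 / 2) < 1 by apply: Rnot_le_lt => h; nra.
have hr1 : r < 1 by apply: Rnot_le_lt => h; nra.
have hth : 2 * (pow34 (1 / 2) * pow34 (1 / 2)) = r * r.
  by rewrite pow34_sq ?hr2; lra.
set c := 1 / 2 + K * K / 4.
have hc : 0 <= c by rewrite /c; have := Rle_0_sqr K; rewrite /Rsqr; lra.
have hblock m : psum (fun i => e (Nat.pred (Nat.pow 2 m) + i)%coq_nat) (Nat.pow 2 m)%coq_nat <= c * r ^ m.
  (* The Cauchy-Schwarz inequality on the block is replaced by x <= la/4 + x^2/la. This weight
     balances the two sides: 2^m times [la] and the block energy divided by [la] are both of order
     r^m. *)
  set la := (1 / 2) ^ m * r ^ m.
  have h2m : 2 ^ m * (1 / 2) ^ m = 1 by rewrite -Rpow_mult_distr; rewrite (_ : 2 * (1 / 2) = 1); [rewrite pow1 | field].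
  have hrm : 0 < r ^ m by apply: pow_lt.
  have hla : 0 < la by apply: Rmult_lt_0_compat => //; apply: pow_lt; lra.
  have hi i : e i <= la / 2 + / la * fnorm2 f (zk i).
    rewrite /e /fnorm2; move: (fcos f (zk i)) (fsin f (zk i)) => x y.
    have ->: x * x + y * y = Rabs x * Rabs x + Rabs y * Rabs y.
      by rewrite -!Rabs_mult !Rabs_pos_eq //; exact: Rle_0_sqr.
    move: (Rabs x) (Rabs y) => X Y.
    apply: (Rmult_le_reg_l la) => //.
    have ->: la * (la / 2 + / la * (X * X + Y * Y)) = la * la / 2 + X * X + Y * Y by field; lra.
    have := Rle_0_sqr (la / 2 - X); have := Rle_0_sqr (la / 2 - Y); rewrite /Rsqr; lra.
  have hb := dyadic_block_bound m.
  apply: Rle_trans (_ : la / 2 * 2 ^ m + / la * psum (fun i => fnorm2 f (zk (Nat.pred (Nat.pow 2 m) + i)%coq_nat)) (Nat.pow 2 m)%coq_nat <= _).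
    rewrite -psum_scal.
    have -> : la / 2 * 2 ^ m = psum (fun _ => la / 2) (Nat.pow 2 m)%coq_nat by rewrite psum_const pow_INR Rmult_comm.
    rewrite -[X in X + _]Rmult_1_l -[X in _ + X]Rmult_1_l -psum_lin.
    by apply: psum_le => i _; have := hi (Nat.pred (Nat.pow 2 m) + i)%coq_nat; lra.
  have -> : la / 2 * 2 ^ m = 1 / 2 * r ^ m.
    transitivity (2 ^ m * (1 / 2) ^ m * (1 / 2 * r ^ m)); last by rewrite h2m; ring.
    by rewrite /la; move: ((1 / 2) ^ m) => t; field.
  suff : / la * psum (fun i => fnorm2 f (zk (Nat.pred (Nat.pow 2 m) + i)%coq_nat)) (Nat.pow 2 m)%coq_nat <= K * K / 4 * r ^ m.
    by rewrite /c; lra.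
  apply: (Rmult_le_reg_l la) => //; rewrite -Rmult_assoc Rinv_r ?Rmult_1_l; last lra.
  apply: Rle_trans hb _.
  have -> : pow34 (1 / 2) ^ (m + 2)%coq_nat * pow34 (1 / 2) ^ (m + 2)%coq_nat = (r * r / 2) ^ m * (r * r / 2 * (r * r / 2)).
    rewrite -hth -Rpow_mult_distr pow_add; move: (pow34 (1 / 2)) => q.
    by rewrite (_ : 2 * (q * q) / 2 = q * q); [rewrite /=; ring | field].
  have -> : (r * r / 2) ^ m = la * r ^ m.
    by rewrite /la Rmult_assoc -!Rpow_mult_distr; congr (_ ^ _); field.
  have hlr : 0 <= la * r ^ m by apply: Rmult_le_pos; lra.
  have hKK := Rle_0_sqr K; rewrite /Rsqr in hKK.
  have hq : r * r / 2 * (r * r / 2) = 1 / 8 by rewrite hr2; lra.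
  rewrite hq; have := Rmult_le_pos _ _ hKK hlr; lra.
have hdy M : psum e (Nat.pred (Nat.pow 2 M))%coq_nat <= c * psum (fun i => r ^ i) M.
  elim: M => [|M IH]; first by rewrite /=; lra.
  have -> : (Nat.pred (Nat.pow 2 (S M)))%coq_nat = (Nat.pred (Nat.pow 2 M) + Nat.pow 2 M)%coq_nat.
    by have := pow2_pos M; rewrite Nat.pow_succ_r'; lia.
  by rewrite psum_add /=; have := hblock M; lra.
exists (c * / (1 - r)) => n.
apply: Rle_trans (psum_mono e n (Nat.pred (Nat.pow 2 n))%coq_nat he _) _.
  by have := Nat.pow_gt_lin_r 2 n ltac:(lia); lia.
apply: Rle_trans (hdy n) _; apply: Rmult_le_compat_l => //.
by apply: psum_geom_le; lra.
Qed.

End PeriodicFourier.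

(** * Series with a summable majorant and uniform limits *)

Lemma is_series_bounded_terms (u : nat -> R) (e : nat -> R) :
  (forall i, Rabs (u i) <= e i) -> ex_series e -> is_series u (Series u).
Proof.
move=> hu he; apply: Series_correct.
exact: (ex_series_le (K := R_AbsRing) (V := R_CompleteNormedModule) u e hu he).
Qed.

Lemma psum_diff_le (u e : nat -> R) m n : (forall i, Rabs (u i) <= e i) -> (m <= n)%coq_nat ->
  Rabs (psum u n - psum u m) <= psum e n - psum e m.
Proof.
move=> hu hmn; have -> : n = (m + (n - m)%coq_nat)%coq_nat by lia.
move: (n - m)%coq_nat => k; rewrite !psum_add.
have -> : psum u m + psum (fun i => u (m + i)%coq_nat) k - psum u m = psum (fun i => u (m + i)%coq_nat) k by ring.
have -> : psum e m + psum (fun i => e (m + i)%coq_nat) k - psum e m = psum (fun i => e (m + i)%coq_nat) k by ring.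
elim: k => [|k IH] /=; first by rewrite Rabs_R0; lra.
by apply: Rle_trans (Rabs_triang _ _) _; apply: Rplus_le_compat.
Qed.

Lemma is_series_psum (u : nat -> R) l : is_series u l <-> is_lim_seq (psum u) l.
Proof.
split=> h.
  by apply/is_lim_seq_incr_1; apply: (is_lim_seq_ext (sum_n u)) => // n; rewrite psum_sum_n.
move/is_lim_seq_incr_1: h => h.
suff : is_lim_seq (sum_n u) l by [].
by apply: (is_lim_seq_ext (fun n => psum u (S n))) h => n; rewrite psum_sum_n.
Qed.

Lemma weierstrass_tail (T : Type) (F : nat -> T -> R) (e : nat -> R) :
  (forall i u, Rabs (F i u) <= e i) -> ex_series e ->
  forall eps, 0 < eps -> exists n0, forall n, (n0 <= n)%coq_nat -> forall u,
    Rabs (Series (fun i => F i u) - psum (fun i => F i u) n) <= eps.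
Proof.
move=> hF [l hl] eps heps.
have hs u : is_series (fun i => F i u) (Series (fun i => F i u)).
  by apply: (is_series_bounded_terms _ e) => //; exists l.
(* The parameter type may be empty, so nonnegativity of the majorant is available only in the
   presence of a point. *)
have he0 i (u : T) : 0 <= e i by exact: Rle_trans (Rabs_pos _) (hF i u).
move/is_series_psum/is_lim_seq_spec: (hl) => /(_ (mkposreal _ heps)) [n0 /= hn0].
exists n0 => n hn u.
have hle : psum e n <= l.
  apply: (is_lim_seq_incr_compare (psum e) l); first exact/is_series_psum.
  by move=> k /=; have := he0 k u; lra.
have hlim : is_lim_seq (fun m => Rabs (psum (fun i => F i u) m - psum (fun i => F i u) n))
    (Rabs (Series (fun i => F i u) - psum (fun i => F i u) n)).
  apply: (is_lim_seq_abs _ (Finite _)); apply: is_lim_seq_minus'; last exact: is_lim_seq_const.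
  exact/is_series_psum.
apply: (is_lim_seq_le_loc _ (fun _ => eps) (Finite _) (Finite _) _ hlim (is_lim_seq_const _)).
exists n => m hm; apply: Rle_trans (psum_diff_le _ e n m (fun i => hF i u) _) _; first lia.
have := hn0 n hn; have hm' : psum e m <= l.
  apply: (is_lim_seq_incr_compare (psum e) l); first exact/is_series_psum.
  by move=> k /=; have := he0 k u; lra.
by move=> /Rabs_def2; lra.
Qed.

Lemma uniform_limit_cts (P : nat -> R -> R) (S : R -> R) :
  (forall n x, continuous (P n) x) ->
  (forall eps, 0 < eps -> exists n, forall u, Rabs (S u - P n u) <= eps) ->
  forall x, continuous S x.
Proof.
move=> hP hS x; apply/filterlim_locally => eps.
have h4 : 0 < eps / 4 by have := cond_pos eps; lra.
have [n hn] := hS _ h4.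
have /filterlim_locally /(_ (mkposreal _ h4)) [d hd] := hP n x.
exists d => y /hd; rewrite /ball /= /AbsRing_ball /abs /minus /plus /opp /= => hy.
have := hn x; have := hn y; move: hy; have := cond_pos eps.
move=> h0 /Rabs_def2 h1 /Rabs_le_between h2 /Rabs_le_between h3.
apply: Rabs_def1; lra.
Qed.

Lemma cts_psum (F : nat -> R -> R) n : (forall i x, continuous (F i) x) ->
  forall x, continuous (fun u => psum (fun i => F i u) n) x.
Proof.
by move=> hF; elim: n => [|n IH] /=; [cts | apply: cts_plus].
Qed.

Lemma RInt_psum (F : nat -> R -> R) n a b : (forall i x, continuous (F i) x) ->
  RInt (fun u => psum (fun i => F i u) n) a b = psum (fun i => RInt (F i) a b) n.
Proof.
move=> hF; elim: n => [|n IH] /=.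
  by rewrite RInt_const /scal /= /mult /=; toR; ring.
by rewrite RIntD ?IH //; exact: cts_psum.
Qed.

Lemma RInt_uniform_limit (P : nat -> R -> R) (S : R -> R) a b l : a <= b ->
  (forall n x, continuous (P n) x) -> (forall x, continuous S x) ->
  (forall eps, 0 < eps -> exists n0, forall n, (n0 <= n)%coq_nat ->
     forall u, a <= u <= b -> Rabs (S u - P n u) <= eps) ->
  is_lim_seq (fun n => RInt (P n) a b) (Finite l) -> RInt S a b = l.
Proof.
move=> hab hP hS hu hl.
have : is_lim_seq (fun n => RInt (P n) a b) (Finite (RInt S a b)).
  apply/is_lim_seq_spec => eps.
  have he : 0 < eps / (b - a + 1) by apply: Rdiv_lt_0_compat; [apply: cond_pos | lra].
  have [n0 hn0] := hu _ he; exists n0 => n hn.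
  rewrite Rabs_minus_sym -RIntB //.
  apply: Rle_lt_trans (RInt_abs_le _ a b _ hab _ (hn0 n hn)) _; first by cts; apply: hP.
  have hb : 0 < b - a + 1 by lra.
  apply: (Rmult_lt_reg_l (b - a + 1)) => //.
  rewrite (_ : (b - a + 1) * ((b - a) * (eps / (b - a + 1))) = (b - a) * eps); last by field; lra.
  have := cond_pos eps; nra.
by move=> /is_lim_seq_unique; rewrite (is_lim_seq_unique _ _ hl) => -[].
Qed.

(** * Fourier inversion *)

Lemma cts_pow (f : R -> R) n : (forall x, continuous f x) -> forall x, continuous (fun u => f u ^ n) x.
Proof. by move=> hf; elim: n => [|n IH] /=; cts. Qed.

(* A trigonometric polynomial concentrated near [x0] when raised to a high power. *)
Definition peak (x0 u : R) : R := (1 + tcos 1 (u - x0)) / 2.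

Lemma cts_peak x0 : forall u, continuous (peak x0) u.
Proof.
have h : forall u, continuous (fun u => tcos 1 (u - x0)) u by apply: (cts_comp _ (tcos 1)); ctst.
by rewrite /peak /Rdiv; cts.
Qed.

(** Multiplication by [peak x0] only mixes the frequencies k - 1, k and k + 1, so that the vanishing
    of all coefficients is preserved from one power to the next. *)
Lemma RInt_peak_pow (h : R -> R) x0 n : (forall x, continuous h x) ->
  (forall k, fcos h k = 0 /\ fsin h k = 0) ->
  forall k, fcos (fun u => h u * peak x0 u ^ n) k = 0 /\ fsin (fun u => h u * peak x0 u ^ n) k = 0.
Proof.
move=> hh h0; elim: n => [|n IH] k.
  by have [h1 h2] := h0 k; split; [rewrite -h1 | rewrite -h2]; apply: RInt_eq => u /=; ring.
have hp := cts_pow _ n (cts_peak x0).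
set g := fun u => h u * peak x0 u ^ n.
have hg : forall u, continuous g u by rewrite /g; cts.
have hG j : RInt (fun u => g u * tcos j u) 0 1 = 0 by have [] := IH j.
have hS j : RInt (fun u => g u * tsin j u) 0 1 = 0 by have [] := IH j.
split; rewrite /fcos /fsin.
- rewrite (RInt_eq _ (fun u => 1 / 2 * (g u * tcos k u)
     + tcos 1 x0 / 4 * (g u * tcos (k + 1) u) + tcos 1 x0 / 4 * (g u * tcos (k - 1) u)
     + tsin 1 x0 / 4 * (g u * tsin (k + 1) u) + - (tsin 1 x0 / 4) * (g u * tsin (k - 1) u))).
    by rewrite !RIntD ?RIntZ; ctst; rewrite !hG !hS; toR; ring.
  move=> u; rewrite /g -tech_pow_Rmult {1}/peak tcos_sub.
  have := tcos_tcos k 1 u; have := tcos_tsin k 1 u; move: (peak x0 u ^ n) => q h1 h2.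
  rewrite (_ : h u * ((1 + (tcos 1 u * tcos 1 x0 + tsin 1 u * tsin 1 x0)) / 2 * q) * tcos k u =
    h u * q / 2 * (tcos k u + tcos 1 x0 * (tcos k u * tcos 1 u) + tsin 1 x0 * (tcos k u * tsin 1 u))).
    by rewrite h1 h2; field.
  by field.
- rewrite (RInt_eq _ (fun u => 1 / 2 * (g u * tsin k u)
     + tcos 1 x0 / 4 * (g u * tsin (1 + k) u) + - (tcos 1 x0 / 4) * (g u * tsin (1 - k) u)
     + tsin 1 x0 / 4 * (g u * tcos (1 - k) u) + - (tsin 1 x0 / 4) * (g u * tcos (1 + k) u))).
    by rewrite !RIntD ?RIntZ; ctst; rewrite !hG !hS; toR; ring.
  move=> u; rewrite /g -tech_pow_Rmult {1}/peak tcos_sub.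
  have := tsin_tsin 1 k u; have := tcos_tsin 1 k u; move: (peak x0 u ^ n) => q h1 h2.
  rewrite (_ : h u * ((1 + (tcos 1 u * tcos 1 x0 + tsin 1 u * tsin 1 x0)) / 2 * q) * tsin k u =
    h u * q / 2 * (tsin k u + tcos 1 x0 * (tcos 1 u * tsin k u) + tsin 1 x0 * (tsin 1 u * tsin k u))).
    by rewrite h1 h2; field.
  by field.
Qed.

Lemma RInt_ge_const (f : R -> R) a b c : a <= b -> (forall x, continuous f x) ->
  (forall x, a <= x <= b -> c <= f x) -> (b - a) * c <= RInt f a b.
Proof.
move=> hab hf hc.
have <- : RInt (fun _ => c) a b = (b - a) * c by rewrite RInt_const.
by apply: RInt_mono => //; cts.
Qed.

Lemma RInt_split (f : R -> R) a b c : (forall x, continuous f x) ->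
  RInt f a c = RInt f a b + RInt f b c.
Proof.
by move=> hf; rewrite -(@RInt_Chasles R_CompleteNormedModule f a b c) //; apply: cts_ex_RInt.
Qed.

Lemma cts_bounded (h : R -> R) : (forall x, continuous h x) -> (forall x, h (x + 1) = h x) ->
  exists M, 0 < M /\ forall x, Rabs (h x) <= M.
Proof.
move=> hc hp.
have hZ (n : nat) x : h (x + INR n) = h x.
  elim: n x => [|n IH] x; first by rewrite Rplus_0_r.
  by rewrite S_INR -Rplus_assoc hp IH.
have hfrac x : h x = h (frac_part x).
  rewrite {1}(frac_part_decomp x); case: (Z_le_dec 0 (Int_part x)) => hx.
    by rewrite Rplus_comm -(Z2Nat.id (Int_part x)) // -INR_IZR_INZ hZ.
  rewrite -(hZ (Z.to_nat (- Int_part x))) INR_IZR_INZ Z2Nat.id ?opp_IZR; last lia.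
  congr h; ring.
have [M hM] : exists M, forall x, 0 <= x <= 1 -> Rabs (h x) <= M.
  have hcp x : continuity_pt (fun x => Rabs (h x)) x.
    apply/continuity_pt_filterlim; apply: (continuous_comp h Rabs) => //.
    exact: continuous_Rabs.
  have [xm [hxm _]] := continuity_ab_maj (fun x => Rabs (h x)) 0 1 Rle_0_1 (fun c _ => hcp c).
  by exists (Rabs (h xm)).
exists (M + 1); split.
  by have := hM 0 ltac:(lra); have := Rabs_pos (h 0); lra.
move=> x; rewrite hfrac; have := hM (frac_part x).
by have := frac_part_bound x; lra.
Qed.

(** If [h x0] were positive, the integral of [h] times a high power of [peak x0] would be dominated
    by the neighbourhood of [x0] and hence positive, whereas it is 0 by [RInt_peak_pow]. *)
Lemma fourier_unique_le (h : R -> R) x0 : (forall x, continuous h x) -> (forall x, h (x + 1) = h x) ->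
  (forall k, fcos h k = 0 /\ fsin h k = 0) -> h x0 <= 0.
Proof.
move=> hc hp h0; apply: Rnot_lt_le => hpos.
have [M [hM0 hM]] := cts_bounded _ hc hp.
set e := h x0 / 2; have he : 0 < e by rewrite /e; lra.
have [d1 hd1] : exists d : posreal, forall u, Rabs (u - x0) < d -> e <= h u.
  have /filterlim_locally /(_ (mkposreal _ he)) [d hd] := hc x0.
  exists d => u hu; have := hd u hu; rewrite /ball /= /AbsRing_ball /abs /minus /plus /opp /=.
  by move=> /Rabs_def2; rewrite /e; lra.
(* The bound 1/4 makes cos (2 pi d) positive and keeps the window inside the period centred at
   [x0]. *)
have [d [hd0 hd4 hd]] : exists d, [/\ 0 < d, d < 1 / 4 & d < d1].
  exists (Rmin (1 / 8) (d1 / 2)); have := cond_pos d1; rewrite /Rmin; case: Rle_dec; split; lra.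
have hpi := PI_RGT_0.
have hcosdec a b : 0 <= a -> a <= b -> b <= 1 / 2 -> cos (2 * PI * b) <= cos (2 * PI * a).
  move=> ha hab hb; have hm x y : x <= y -> 2 * PI * x <= 2 * PI * y.
    by move=> hxy; apply: Rmult_le_compat_l => //; lra.
  have e0 : 2 * PI * 0 = 0 by ring.
  have e1 : 2 * PI * (1 / 2) = PI by field.
  have := hm 0 a; have := hm a b hab; have := hm b (1 / 2) hb; have := hm 0 b; rewrite e0 e1.
  by move=> h1 h2 h3 h4; apply: cos_decr_1; lra.
have hcosabs t : tcos 1 t = cos (2 * PI * Rabs t).
  rewrite /tcos Rmult_1_r /Rabs; case: Rcase_abs => // _.
  by rewrite -cos_neg; congr cos; ring.
have hpd0 : 0 < PI * d by apply: Rmult_lt_0_compat.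
have hpd1 : PI * d < PI * (1 / 4) by apply: Rmult_lt_compat_l.
set q1 := (1 + cos (2 * PI * (d / 2))) / 2; set q2 := (1 + cos (2 * PI * d)) / 2.
have hq2 : 1 / 2 < q2.
  have : 0 < cos (2 * PI * d) by apply: cos_gt_0; lra.
  by rewrite /q2; lra.
have hq12 : q2 < q1.
  have : cos (2 * PI * d) < cos (2 * PI * (d / 2)) by apply: cos_decreasing_1; lra.
  by rewrite /q1 /q2; lra.
have hpk u : 0 <= peak x0 u by rewrite /peak /tcos; have := COS_bound (2 * PI * 1 * (u - x0)); lra.
have hpk1 u : Rabs (u - x0) <= d / 2 -> q1 <= peak x0 u.
  move=> hu; rewrite /peak hcosabs /q1; have := hcosdec (Rabs (u - x0)) (d / 2) (Rabs_pos _) hu; lra.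
have hpk2 u : d <= Rabs (u - x0) -> Rabs (u - x0) <= 1 / 2 -> peak x0 u <= q2.
  by move=> hu hu'; rewrite /peak hcosabs /q2; have := hcosdec d (Rabs (u - x0)); lra.
have key n : d * (e * q1 ^ n) <= M * q2 ^ n.
  have [hI _] := RInt_peak_pow h x0 n hc h0 0%Z.
  have hpc := cts_pow _ n (cts_peak x0).
  set g := fun u => h u * peak x0 u ^ n.
  have hg : forall u, continuous g u by rewrite /g; cts.
  have hgp u : g (u + 1) = g u.
    by rewrite /g hp /peak -(tcos_periodic 1 (u - x0)); congr (_ * ((1 + tcos _ _) / 2) ^ _); ring.
  have hg0 : RInt g (x0 - 1 / 2) (x0 - 1 / 2 + 1) = 0.
    rewrite RInt_periodic //; apply: etrans hI; apply: RInt_eq => u.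
    by rewrite /tcos Rmult_0_r Rmult_0_l cos_0 Rmult_1_r.
  have hout u : d <= Rabs (u - x0) -> Rabs (u - x0) <= 1 / 2 -> - (M * q2 ^ n) <= g u.
    move=> hu hu'; have h1 : 0 <= peak x0 u ^ n by apply: pow_le.
    have h2 : peak x0 u ^ n <= q2 ^ n by apply: pow_incr; split; [exact: hpk | exact: hpk2].
    have /Rabs_le_between [h3 h4] := hM u; rewrite /g; nra.
  have hmid u : Rabs (u - x0) < d1 -> 0 <= g u.
    by move=> hu; apply: Rmult_le_pos; [have := hd1 u hu; lra | apply: pow_le].
  have hin u : Rabs (u - x0) <= d / 2 -> e * q1 ^ n <= g u.
    move=> hu; apply: Rmult_le_compat; [lra | apply: pow_le; lra | apply: hd1; lra |].
    by apply: pow_incr; split; [lra | exact: hpk1].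
  move: hg0; rewrite (RInt_split g _ (x0 - d)) // (RInt_split g _ (x0 - d / 2) (x0 - 1 / 2 + 1)) //.
  rewrite (RInt_split g _ (x0 + d / 2) (x0 - 1 / 2 + 1)) // (RInt_split g _ (x0 + d) (x0 - 1 / 2 + 1)) //.
  have i1 := RInt_ge_const g (x0 - 1 / 2) (x0 - d) (- (M * q2 ^ n)) ltac:(lra) hg.
  have i2 := RInt_ge_const g (x0 - d) (x0 - d / 2) 0 ltac:(lra) hg.
  have i3 := RInt_ge_const g (x0 - d / 2) (x0 + d / 2) (e * q1 ^ n) ltac:(lra) hg.
  have i4 := RInt_ge_const g (x0 + d / 2) (x0 + d) 0 ltac:(lra) hg.
  have i5 := RInt_ge_const g (x0 + d) (x0 - 1 / 2 + 1) (- (M * q2 ^ n)) ltac:(lra) hg.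
  have {}i1 : (x0 - d - (x0 - 1 / 2)) * - (M * q2 ^ n) <= RInt g (x0 - 1 / 2) (x0 - d).
    apply: i1 => u hu; apply: hout; rewrite Rabs_left1; lra.
  have {}i2 : 0 <= RInt g (x0 - d) (x0 - d / 2).
    rewrite -[X in X <= _](Rmult_0_r (x0 - d / 2 - (x0 - d))).
    by apply: i2 => u hu; apply: hmid; rewrite Rabs_left1; lra.
  have {}i3 : (x0 + d / 2 - (x0 - d / 2)) * (e * q1 ^ n) <= RInt g (x0 - d / 2) (x0 + d / 2).
    by apply: i3 => u hu; apply: hin; apply: Rabs_le; lra.
  have {}i4 : 0 <= RInt g (x0 + d / 2) (x0 + d).
    rewrite -[X in X <= _](Rmult_0_r (x0 + d - (x0 + d / 2))).
    by apply: i4 => u hu; apply: hmid; rewrite Rabs_pos_eq; lra.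
  have {}i5 : (x0 - 1 / 2 + 1 - (x0 + d)) * - (M * q2 ^ n) <= RInt g (x0 + d) (x0 - 1 / 2 + 1).
    apply: i5 => u hu; apply: hout; rewrite Rabs_pos_eq; lra.
  have hMq : 0 <= M * q2 ^ n by apply: Rmult_le_pos; [lra | apply: pow_le; lra].
  rewrite (_ : x0 + d / 2 - (x0 - d / 2) = d) in i3; last by field.
  move: i1 i2 i3 i4 i5.
  move: (RInt g _ _) (RInt g _ _) (RInt g _ _) (RInt g _ _) (RInt g _ _) => I1 I2 I3 I4 I5.
  nra.
have hr : Rabs (q2 / q1) < 1.
  rewrite Rabs_pos_eq; last by apply: Rlt_le; apply: Rdiv_lt_0_compat; lra.
  by apply: (Rmult_lt_reg_r q1); [lra | rewrite /Rdiv Rmult_assoc Rinv_l; lra].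
have hy : 0 < d * e / M by apply: Rdiv_lt_0_compat => //; apply: Rmult_lt_0_compat.
have [n hn] := pow_lt_1_zero _ hr _ hy.
have := hn n (le_n n); rewrite Rabs_pos_eq; last first.
  by apply: pow_le; apply: Rlt_le; apply: Rdiv_lt_0_compat; lra.
have hq1n : 0 < q1 ^ n by apply: pow_lt; lra.
rewrite /Rdiv Rpow_mult_distr pow_inv => hlt.
have := key n.
have := Rmult_lt_compat_r _ _ _ (Rmult_lt_0_compat _ _ hM0 hq1n) hlt.
rewrite (_ : q2 ^ n * / q1 ^ n * (M * q1 ^ n) = M * q2 ^ n); last by field; lra.
rewrite (_ : d * e * / M * (M * q1 ^ n) = d * (e * q1 ^ n)); last by field; lra.
lra.
Qed.

Lemma fourier_unique (h : R -> R) : (forall x, continuous h x) -> (forall x, h (x + 1) = h x) ->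
  (forall k, fcos h k = 0 /\ fsin h k = 0) -> forall x, h x = 0.
Proof.
move=> hc hp h0 x; apply: Rle_antisym; first exact: fourier_unique_le.
suff : - h x <= 0 by lra.
apply: (fourier_unique_le (fun u => - h u)).
- by move=> u; apply: (continuous_opp h).
- by move=> u; rewrite hp.
move=> k; have [h1 h2] := h0 k; split.
- rewrite /fcos (RInt_eq _ (fun u => (-1) * (h u * tcos k u))); last by move=> u; ring.
  by rewrite RIntZ; ctst; move: h1; rewrite /fcos => ->; toR; ring.
- rewrite /fsin (RInt_eq _ (fun u => (-1) * (h u * tsin k u))); last by move=> u; ring.
  by rewrite RIntZ; ctst; move: h2; rewrite /fsin => ->; toR; ring.
Qed.

Lemma holder_cts (f : R -> R) K : (forall x y, Rabs (f x - f y) <= K * pow34 (Rabs (x - y))) ->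
  forall x, continuous f x.
Proof.
move=> hf x; apply/filterlim_locally => eps.
have hK : 0 < Rabs K + 1 by have := Rabs_pos K; lra.
set a := eps / (Rabs K + 1).
have ha : 0 < a by apply: Rdiv_lt_0_compat => //; apply: cond_pos.
have hd : 0 < Rmin 1 (a * a) by apply: Rmin_glb_lt; [lra | apply: Rmult_lt_0_compat].
exists (mkposreal _ hd) => y; rewrite /ball /= /AbsRing_ball /abs /minus /plus /opp /= => hy.
apply: Rle_lt_trans (hf y x) _.
have hy1 : Rabs (y - x) < a * a by apply: Rlt_le_trans hy _; apply: Rmin_r.
have hy2 : Rabs (y - x) < 1 by apply: Rlt_le_trans hy _; apply: Rmin_l.
have hp := Rabs_pos (y - x).
have h1 : pow34 (Rabs (y - x)) < a.
  apply: Rle_lt_trans (pow34_le_sqrt _ _) _; first lra.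
  by rewrite -(sqrt_square a); [apply: sqrt_lt_1_alt | lra].
have h2 := pow34_ge0 (Rabs (y - x)).
apply: Rle_lt_trans (_ : (Rabs K + 1) * pow34 (Rabs (y - x)) < _).
  by apply: Rmult_le_compat_r => //; have := Rle_abs K; lra.
have := Rmult_lt_compat_l _ _ _ hK h1.
by rewrite /a (_ : (Rabs K + 1) * (eps / (Rabs K + 1)) = eps) //; field; lra.
Qed.

Lemma fcos_opp f k : fcos f (- k) = fcos f k.
Proof.
apply: RInt_eq => u; rewrite /tcos opp_IZR -cos_neg; congr (_ * cos _); ring.
Qed.

Lemma fsin_opp f k : (forall x, continuous f x) -> fsin f (- k) = - fsin f k.
Proof.
move=> hf; rewrite /fsin (RInt_eq _ (fun u => (-1) * (f u * tsin k u))).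
  by rewrite RIntZ; ctst; toR; ring.
by move=> u; rewrite /tsin opp_IZR (_ : _ * - IZR k * u = - (2 * PI * IZR k * u)) ?sin_neg; ring.
Qed.

Lemma psum_kronecker a (j : nat) n c : (j < n)%coq_nat ->
  psum (fun i => a i * (if Z.eqb (zk i) (zk j) then c else 0)) n = a j * c.
Proof.
set u := fun i => _.
have hu i : i <> j -> u i = 0.
  by move=> h; rewrite /u; case: Z.eqb_spec => [|_]; [rewrite /zk; lia | ring].
have hj : u j = a j * c by rewrite /u Z.eqb_refl.
have h0 m : (m <= j)%coq_nat -> psum u m = 0.
  by elim: m => [|m IH] hm //=; rewrite IH ?hu; [ring | lia | lia].
elim: n => [|n IH] hn; first lia.
case: (Nat.eq_dec j n) => [<-|h] /=; first by rewrite h0 ?hj //; ring.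
by rewrite IH ?hu; [ring | lia | lia].
Qed.

Section Inversion.

Variables (f : R -> R) (K : R).
Hypothesis f_per : forall x, f (x + 1) = f x.
Hypothesis f_holder : forall x y, Rabs (f x - f y) <= K * pow34 (Rabs (x - y)).

Let f_cts := holder_cts f K f_holder.

Lemma fourier_summable : ex_series (fun i => Rabs (fcos f (zk i)) + Rabs (fsin f (zk i))).
Proof.
have [M hM] := fourier_abs_bound f f_cts f_per K f_holder.
apply: ex_series_bounded hM => i.
by apply: Rplus_le_le_0_compat; apply: Rabs_pos.
Qed.

Let F (i : nat) (u : R) := 2 * fcos f (zk i) * tcos (zk i) u + 2 * fsin f (zk i) * tsin (zk i) u.

Lemma fourier_term_bound i u :
  Rabs (F i u) <= 2 * (Rabs (fcos f (zk i)) + Rabs (fsin f (zk i))).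
Proof.
have hc x y : Rabs y <= 1 -> Rabs (2 * x * y) <= 2 * Rabs x.
  move=> hy; rewrite !Rabs_mult (Rabs_pos_eq 2); last lra.
  have := Rabs_pos x; nra.
apply: Rle_trans (Rabs_triang _ _) _; rewrite Rmult_plus_distr_l.
by apply: Rplus_le_compat; apply: hc; apply: Rabs_le; [apply: COS_bound | apply: SIN_bound].
Qed.

(** Uniform convergence allows termwise integration, so [f] minus its mean and minus its Fourier
    series has only zero coefficients; being continuous and periodic, it vanishes by
    [fourier_unique]. *)
Lemma fourier_inversion u : is_series (fun i => F i u) (f u - fcos f 0).
Proof.
have hF i : forall x, continuous (F i) x by rewrite /F; ctst.
have he : ex_series (fun i => 2 * (Rabs (fcos f (zk i)) + Rabs (fsin f (zk i)))).
  exact: (ex_series_scal_l 2 _ fourier_summable).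
set G := fun u => Series (fun i => F i u).
have hS u' : is_series (fun i => F i u') (G u').
  by apply: is_series_bounded_terms he => i; exact: fourier_term_bound.
have htail := weierstrass_tail R F _ fourier_term_bound he.
have hP n : forall x, continuous (fun u => psum (fun i => F i u) n) x by apply: cts_psum.
have hSc : forall x, continuous G x.
  apply: (uniform_limit_cts (fun n u => psum (fun i => F i u) n)) => // eps heps.
  by have [n hn] := htail _ heps; exists n => u'; apply: hn.
set h := fun u => f u - fcos f 0 - G u.
have hc : forall x, continuous h x by rewrite /h; cts.
have coef (w : R -> R) l : (forall x, continuous w x) -> (forall x, Rabs (w x) <= 1) ->
    is_lim_seq (fun n => psum (fun i => RInt (fun u => F i u * w u) 0 1) n) (Finite l) ->
    RInt (fun u => h u * w u) 0 1 = RInt (fun u => f u * w u) 0 1 - fcos f 0 * RInt w 0 1 - l.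
  move=> hw hw1 hl.
  have hSw : RInt (fun u => G u * w u) 0 1 = l.
    apply: (RInt_uniform_limit (fun n u => psum (fun i => F i u) n * w u)); cts; first lra.
      by move=> n; cts; apply: hP.
      move=> eps heps; have [n0 hn0] := htail _ heps; exists n0 => n hn x _.
      rewrite -Rmult_minus_distr_r Rabs_mult; have := hn0 n hn x; have := hw1 x.
      by rewrite -/(G x); have := Rabs_pos (G x - psum (fun i => F i x) n); nra.
    apply: is_lim_seq_ext hl => n; rewrite -RInt_psum; last by move=> i; cts; exact: hF.
    by apply: RInt_eq => x; elim: n => [|n IH] /=; rewrite ?IH; ring.
  rewrite (RInt_eq _ (fun u => f u * w u - fcos f 0 * w u - G u * w u)); last by move=> x; rewrite /h; ring.
  by rewrite !RIntB ?RIntZ ?hSw; cts.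
have h0 k : fcos h k = 0 /\ fsin h k = 0.
  have hpos j : fcos h (zk j) = 0 /\ fsin h (zk j) = 0.
    have hj i : (0 < zk i)%Z by rewrite /zk; lia.
    have hj0 : zk j <> 0%Z by rewrite /zk; lia.
    split; rewrite /fcos /fsin.
    - rewrite (coef (tcos (zk j)) (fcos f (zk j))); ctst.
      + by rewrite RInt_tcos // -/(fcos f (zk j)); toR; ring.
      + by move=> x; apply: Rabs_le; apply: COS_bound.
      apply: (is_lim_seq_ext_loc (fun _ => fcos f (zk j))); last exact: is_lim_seq_const.
      (* From this index on the partial sums contain the j-th harmonic, and their coefficient no
         longer changes. *)
      exists (S O + j)%coq_nat => n hn.
      rewrite (psum_eq _ (fun i => 2 * fcos f (zk i) * (if Z.eqb (zk i) (zk j) then 1 / 2 else 0))).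
        by rewrite psum_kronecker; [field | lia].
      move=> i _; rewrite (RInt_eq _ (fun u => 2 * fcos f (zk i) * (tcos (zk i) u * tcos (zk j) u)
        + 2 * fsin f (zk i) * (tsin (zk i) u * tcos (zk j) u))); last by move=> x; rewrite /F; ring.
      rewrite RIntD ?RIntZ; ctst.
      by rewrite -/(fcos (tcos (zk i)) (zk j)) -/(fcos (tsin (zk i)) (zk j)) fcos_tcos // fcos_tsin; ring.
    - rewrite (coef (tsin (zk j)) (fsin f (zk j))); ctst.
      + by rewrite RInt_tsin // -/(fsin f (zk j)); toR; ring.
      + by move=> x; apply: Rabs_le; apply: SIN_bound.
      apply: (is_lim_seq_ext_loc (fun _ => fsin f (zk j))); last exact: is_lim_seq_const.
      exists (S O + j)%coq_nat => n hn.
      rewrite (psum_eq _ (fun i => 2 * fsin f (zk i) * (if Z.eqb (zk i) (zk j) then 1 / 2 else 0))).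
        by rewrite psum_kronecker; [field | lia].
      move=> i _; rewrite (RInt_eq _ (fun u => 2 * fcos f (zk i) * (tcos (zk i) u * tsin (zk j) u)
        + 2 * fsin f (zk i) * (tsin (zk i) u * tsin (zk j) u))); last by move=> x; rewrite /F; ring.
      rewrite RIntD ?RIntZ; ctst.
      by rewrite -/(fsin (tcos (zk i)) (zk j)) -/(fsin (tsin (zk i)) (zk j)) fsin_tcos fsin_tsin //; ring.
  have hzk m : (0 < m)%Z -> exists j, m = zk j.
    by move=> hm; exists (Z.to_nat (m - 1)); rewrite /zk; lia.
  case: (Z.lt_trichotomy k 0) => [hk|[->|hk]].
  - have [j hj] := hzk (- k)%Z ltac:(lia); have -> : k = (- zk j)%Z by lia.
    by have [h1 h2] := hpos j; rewrite fcos_opp fsin_opp // h1 h2 Ropp_0.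
  - have t0 x : tcos 0 x = 1 by rewrite /tcos Rmult_0_r Rmult_0_l cos_0.
    have s0 x : tsin 0 x = 0 by rewrite /tsin Rmult_0_r Rmult_0_l sin_0.
    split; last first.
      rewrite /fsin (RInt_eq _ (fun _ => 0)); last by move=> x; rewrite s0; ring.
      by rewrite RInt_const /scal /= /mult /=; toR; ring.
    rewrite /fcos (coef (tcos 0) 0); ctst.
    + by rewrite RInt_tcos0 -/(fcos f 0); toR; ring.
    + by move=> x; rewrite t0 Rabs_R1; lra.
    apply: (is_lim_seq_ext (fun _ => 0)); last exact: is_lim_seq_const.
    move=> n; rewrite (psum_eq _ (fun _ => 0)); first by rewrite psum_const; ring.
    move=> i _; rewrite (RInt_eq _ (fun u => 2 * fcos f (zk i) * tcos (zk i) u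
        + 2 * fsin f (zk i) * tsin (zk i) u)); last by move=> x; rewrite /F t0; ring.
    rewrite RIntD ?RIntZ; ctst; rewrite RInt_tsin RInt_tcos; last by rewrite /zk; lia.
    by toR; ring.
  - by have [j ->] := hzk k hk; exact: hpos.
have hh : forall x, h x = 0.
  apply: fourier_unique => // x; rewrite /h f_per; congr (_ - _).
  by apply: Series_ext => i; rewrite /F tcos_periodic tsin_periodic.
have -> : f u - fcos f 0 = G u by have := hh u; rewrite /h; lra.
exact: hS.
Qed.

End Inversion.

(** * Complex-valued integrals *)

Lemma C_ext (z w : C) : fst z = fst w -> snd z = snd w -> z = w.
Proof. by case: z w => [a b] [c d] /= -> ->. Qed.

Lemma Cexp_plus z w : Cexp (z + w)%C = (Cexp z * Cexp w)%C.
Proof.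
apply: C_ext; rewrite /Cexp /=; case: z w => [a b] [c d] /=; rewrite exp_plus ?cos_plus ?sin_plus; ring.
Qed.

Lemma Cexp_0 : Cexp 0 = 1.
Proof. by apply: C_ext; rewrite /Cexp /= exp_0 ?cos_0 ?sin_0; ring. Qed.

Lemma Cmod_Cexp z : Cmod (Cexp z) = exp (Re z).
Proof.
rewrite -[RHS]sqrt_square; last by apply: Rlt_le; exact: exp_pos.
rewrite /Cmod /Cexp /=; congr sqrt; have := sin2_cos2 (Im z); rewrite /Rsqr.
move: (exp _) (sin _) (cos _) => e s c h.
transitivity (e * e * (s * s + c * c)); first by ring.
by rewrite h; ring.
Qed.

Lemma Cexp_R (x : R) : Cexp (RtoC x) = RtoC (exp x).
Proof. by apply: C_ext; rewrite /Cexp /= ?cos_0 ?sin_0; ring. Qed.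

Lemma Cmod_le_parts (z : C) : Cmod z <= Rabs (fst z) + Rabs (snd z).
Proof.
have h1 := Rabs_pos (fst z); have h2 := Rabs_pos (snd z).
rewrite /Cmod -(sqrt_square (Rabs (fst z) + Rabs (snd z))); last lra.
apply: sqrt_le_1_alt; rewrite -(pow2_abs (fst z)) -(pow2_abs (snd z)) /=; nra.
Qed.

Lemma Rabs_fst_le (z : C) : Rabs (fst z) <= Cmod z.
Proof. by apply: Rle_trans (Rmax_Cmod z); apply: Rmax_l. Qed.

Lemma Rabs_snd_le (z : C) : Rabs (snd z) <= Cmod z.
Proof. by apply: Rle_trans (Rmax_Cmod z); apply: Rmax_r. Qed.

Lemma ctsC_pair (f : R -> C) : (forall x, continuous (fun t => fst (f t)) x) ->
  (forall x, continuous (fun t => snd (f t)) x) -> forall x, continuous f x.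
Proof.
move=> h1 h2 x.
apply: (continuous_ext (fun t => (fst (f t), snd (f t)))); first by move=> t; case: (f t).
apply: (continuous_comp_2 (fun t => fst (f t)) (fun t => snd (f t)) (fun a b => (a, b))) => //.
apply: (continuous_ext (fun t : R * R => t)); first by case.
exact: continuous_id.
Qed.

Lemma ctsC_fst (f : R -> C) : (forall x, continuous f x) -> forall x, continuous (fun t => fst (f t)) x.
Proof. by move=> hf x; apply: (continuous_comp f fst) => //; case: (f x) => a b; apply: continuous_fst. Qed.

Lemma ctsC_snd (f : R -> C) : (forall x, continuous f x) -> forall x, continuous (fun t => snd (f t)) x.
Proof. by move=> hf x; apply: (continuous_comp f snd) => //; case: (f x) => a b; apply: continuous_snd. Qed.

Lemma ctsC_plus (f g : R -> C) : (forall x, continuous f x) -> (forall x, continuous g x) ->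
  forall x, continuous (fun t => f t + g t)%C x.
Proof.
move=> hf hg; apply: ctsC_pair => /=; apply: cts_plus; by [exact: ctsC_fst | exact: ctsC_snd].
Qed.

Lemma ctsC_minus (f g : R -> C) : (forall x, continuous f x) -> (forall x, continuous g x) ->
  forall x, continuous (fun t => f t - g t)%C x.
Proof.
move=> hf hg; apply: ctsC_pair => /=; apply: cts_minus; by [exact: ctsC_fst | exact: ctsC_snd].
Qed.

Lemma ctsC_mult (f g : R -> C) : (forall x, continuous f x) -> (forall x, continuous g x) ->
  forall x, continuous (fun t => f t * g t)%C x.
Proof.
move=> hf hg; have f1 := ctsC_fst _ hf; have f2 := ctsC_snd _ hf.
have g1 := ctsC_fst _ hg; have g2 := ctsC_snd _ hg.
by apply: ctsC_pair => /=; [apply: cts_minus | apply: cts_plus]; apply: cts_mult.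
Qed.

Lemma ctsC_const (z : C) : forall x : R, continuous (fun _ : R => z) x.
Proof. by move=> x; apply: continuous_const. Qed.

Lemma ctsC_RtoC (f : R -> R) : (forall x, continuous f x) -> forall x, continuous (fun t => RtoC (f t)) x.
Proof. by move=> hf; apply: ctsC_pair => //=; exact: cts_const. Qed.

Lemma ctsC_Cexp (f : R -> C) : (forall x, continuous f x) -> forall x, continuous (fun t => Cexp (f t)) x.
Proof.
move=> hf; have f1 := ctsC_fst _ hf; have f2 := ctsC_snd _ hf.
apply: ctsC_pair => /=; rewrite /Re /Im; apply: cts_mult.
- exact: (cts_comp (fun t => fst (f t)) exp f1 cts_exp).
- exact: (cts_comp (fun t => snd (f t)) cos f2 cts_cos).
- exact: (cts_comp (fun t => fst (f t)) exp f1 cts_exp).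
- exact: (cts_comp (fun t => snd (f t)) sin f2 cts_sin).
Qed.

Ltac ctsC := repeat first
  [ assumption
  | match goal with |- forall x, continuous (fun _ => ?c) x => exact: (ctsC_const c) end
  | match goal with
    | |- forall x, continuous (fun y => (_ + _)%C) x => apply: ctsC_plus
    | |- forall x, continuous (fun y => (_ - _)%C) x => apply: ctsC_minus
    | |- forall x, continuous (fun y => (_ * _)%C) x => apply: ctsC_mult
    | |- forall x, continuous (Cmult ?c) x => apply: (ctsC_mult (fun _ => c) (fun y => y))
    | |- forall x, continuous (fun y => Cexp _) x => apply: ctsC_Cexp
    | |- forall x, continuous (fun y => RtoC _) x => apply: ctsC_RtoC
    | |- forall x, continuous RtoC x => apply: (ctsC_RtoC (fun y => y))
    end
  | progress cts ].

Lemma is_derive_C (f : R -> C) x (l : C) : is_derive (fun t => fst (f t)) x (fst l) ->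
  is_derive (fun t => snd (f t)) x (snd l) -> is_derive (K := R_AbsRing) (V := C_R_NormedModule) f x l.
Proof.
move=> h1 h2.
apply: (filterdiff_ext_lin (K := R_AbsRing) (V := C_R_NormedModule) f
  (fun y : R => (scal y (fst l), scal y (snd l)))); last by case: l {h1 h2}.
apply: (filterdiff_ext (K := R_AbsRing) (V := C_R_NormedModule) (fun t => (fst (f t), snd (f t)))).
  by move=> t; case: (f t).
apply: (filterdiff_comp'_2 (W := C_R_NormedModule) (fun t => fst (f t)) (fun t => snd (f t)) (fun a b => (a, b)) x
   (fun y => scal y (fst l)) (fun y => scal y (snd l)) (fun a b => (a, b))) => //.
apply: (filterdiff_ext (fun t : R * R => t)); first by case.
apply: (filterdiff_ext_lin _ (fun t : R * R => t)); first exact: filterdiff_id.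
by case.
Qed.

Lemma is_derive_Cexp (z : C) (v : R) :
  is_derive (K := R_AbsRing) (V := C_R_NormedModule) (fun v : R => Cexp (z * RtoC v)%C) v (z * Cexp (z * RtoC v))%C.
Proof.
by apply: is_derive_C; rewrite /Cexp /Re /Im /=; auto_derive => //; rewrite /Rminus; ring.
Qed.

Notation CInt := (@RInt C_R_CompleteNormedModule).

Section ComplexIntegrals.

Implicit Types f g : R -> C.

Lemma ctsC_ex f a b : (forall x, continuous f x) -> ex_RInt (V := C_R_NormedModule) f a b.
Proof. by move=> hf; apply: (@ex_RInt_continuous C_R_CompleteNormedModule) => z _; exact: hf. Qed.

Lemma ctsC_is f a b : (forall x, continuous f x) -> is_RInt (V := C_R_NormedModule) f a b (CInt f a b).
Proof. by move=> hf; apply: (@RInt_correct C_R_CompleteNormedModule); apply: ctsC_ex. Qed.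

Lemma CInt_fst f a b : (forall x, continuous f x) -> fst (CInt f a b) = RInt (fun t => fst (f t)) a b.
Proof.
move=> hf; symmetry; apply: is_RInt_unique.
exact: (is_RInt_fct_extend_fst (U := R_NormedModule) (V := R_NormedModule) f a b _ (ctsC_is f a b hf)).
Qed.

Lemma CInt_snd f a b : (forall x, continuous f x) -> snd (CInt f a b) = RInt (fun t => snd (f t)) a b.
Proof.
move=> hf; symmetry; apply: is_RInt_unique.
exact: (is_RInt_fct_extend_snd (U := R_NormedModule) (V := R_NormedModule) f a b _ (ctsC_is f a b hf)).
Qed.

Lemma CInt_plus f g a b : (forall x, continuous f x) -> (forall x, continuous g x) ->
  CInt (fun t => f t + g t)%C a b = (CInt f a b + CInt g a b)%C.
Proof. by move=> hf hg; apply: (@RInt_plus C_R_CompleteNormedModule); apply: ctsC_ex. Qed.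

Lemma CInt_minus f g a b : (forall x, continuous f x) -> (forall x, continuous g x) ->
  CInt (fun t => f t - g t)%C a b = (CInt f a b - CInt g a b)%C.
Proof. by move=> hf hg; apply: (@RInt_minus C_R_CompleteNormedModule); apply: ctsC_ex. Qed.

Lemma CInt_mult (z : C) f a b : (forall x, continuous f x) ->
  CInt (fun t => z * f t)%C a b = (z * CInt f a b)%C.
Proof.
move=> hf; have f1 := ctsC_fst _ hf; have f2 := ctsC_snd _ hf.
apply: C_ext.
  rewrite CInt_fst; last by ctsC.
  rewrite (RInt_eq _ (fun t => fst z * fst (f t) - snd z * snd (f t))) //=.
  by rewrite RIntB ?RIntZ -?CInt_fst -?CInt_snd //; cts.
rewrite CInt_snd; last by ctsC.
rewrite (RInt_eq _ (fun t => fst z * snd (f t) + snd z * fst (f t))) //=.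
by rewrite RIntD ?RIntZ -?CInt_fst -?CInt_snd //; cts.
Qed.

Lemma CInt_eq f g a b : (forall x, f x = g x) -> CInt f a b = CInt g a b.
Proof. by move=> h; apply: RInt_ext => x _. Qed.

Lemma CInt_Chasles f a b c : (forall x, continuous f x) ->
  CInt f a c = (CInt f a b + CInt f b c)%C.
Proof. by move=> hf; rewrite -(@RInt_Chasles C_R_CompleteNormedModule f a b c) //; apply: ctsC_ex. Qed.

Lemma CInt_bound f (g : R -> R) a b : a <= b -> (forall x, continuous f x) -> (forall x, continuous g x) ->
  (forall x, a <= x <= b -> Cmod (f x) <= g x) -> Cmod (CInt f a b) <= RInt g a b.
Proof.
move=> hab hf hg h; rewrite Cmod_norm.
apply: (norm_RInt_le (V := C_R_NormedModule) f g a b _ _ hab); last first.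
- exact: cts_is_RInt.
- exact: ctsC_is.
- by move=> x hx; have := h x hx; rewrite Cmod_norm.
Qed.

Lemma CInt_derive f (df : R -> C) a b :
  (forall x, Rmin a b <= x <= Rmax a b -> is_derive (K := R_AbsRing) (V := C_R_NormedModule) f x (df x)) ->
  (forall x, continuous df x) -> CInt df a b = (f b - f a)%C.
Proof.
move=> hf hdf; apply: is_RInt_unique.
by apply: (@is_RInt_derive C_R_CompleteNormedModule f df) => // x _; exact: hdf.
Qed.

Lemma CInt_lin f u v a b : (forall x, continuous f x) ->
  CInt (fun t => RtoC u * f (u * t + v)%R)%C a b = CInt f (u * a + v) (u * b + v).
Proof.
move=> hf; rewrite -(@RInt_comp_lin C_R_CompleteNormedModule f u v a b); last exact: ctsC_ex.
by apply: CInt_eq => x; apply: C_ext; rewrite /= /scal /= /mult /=; toR; ring.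
Qed.

Lemma CInt_point f a : CInt f a a = RtoC 0.
Proof. exact: (@RInt_point C_R_CompleteNormedModule). Qed.

End ComplexIntegrals.

(** * Improper integrals of exponentially decaying functions *)

Lemma exp_small k eps : 0 < k -> 0 < eps -> exists X, 0 <= X /\ forall v, X <= v -> exp (- k * v) <= eps.
Proof.
move=> hk he; exists (/ (k * eps)).
have hke : 0 < k * eps by apply: Rmult_lt_0_compat.
have hX : 0 < / (k * eps) by apply: Rinv_0_lt_compat.
split; first lra.
move=> v hv; have hv0 : 0 < v by lra.
have h1 : / eps <= k * v.
  have := Rmult_le_compat_l k _ _ (Rlt_le _ _ hk) hv.
  by rewrite (_ : k * / (k * eps) = / eps) //; field; lra.
have h2 : k * v <= exp (k * v) by have := exp_ineq1_le (k * v); lra.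
rewrite (_ : - k * v = - (k * v)); last ring.
rewrite exp_Ropp -(Rinv_inv eps); apply: Rinv_le_contravar; last lra.
by apply: Rinv_0_lt_compat.
Qed.

Lemma Cmod_small_0 z : (forall eps, 0 < eps -> Cmod z <= eps) -> z = RtoC 0.
Proof.
move=> h; apply: Cmod_eq_0; apply: Rle_antisym; last exact: Cmod_ge_0.
by apply: le_epsilon => eps he; rewrite Rplus_0_l; apply: h.
Qed.

Lemma RInt_exp_decay M k X Y : 0 < k ->
  RInt (fun v => M * exp (- k * v)) X Y = M / k * (exp (- k * X) - exp (- k * Y)).
Proof.
move=> hk; apply: is_RInt_unique.
have := is_RInt_derive (fun v => - (M / k) * exp (- k * v)) (fun v => M * exp (- k * v)) X Y.
rewrite (_ : minus (- (M / k) * exp (- k * Y)) (- (M / k) * exp (- k * X)) = M / k * (exp (- k * X) - exp (- k * Y))).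
  apply.
  - by move=> x _; auto_derive => //; field; lra.
  - by move=> x _; move: x; cts.
by rewrite /minus /plus /opp /=; ring.
Qed.

(** The upper limit runs through the integers; for continuous integrands with exponential decay
    [CInf_lim] recovers the limit along the reals. *)
Definition CInf (f : R -> C) : C :=
  (real (Lim_seq (fun n => fst (CInt f 0 (INR n)))), real (Lim_seq (fun n => snd (CInt f 0 (INR n))))).

Definition decays (f : R -> C) (M k : R) : Prop := forall v, 0 <= v -> Cmod (f v) <= M * exp (- k * v).

Section Improper.

Variables (f : R -> C) (M k : R).
Hypothesis f_cts : forall x, continuous f x.
Hypothesis k_pos : 0 < k.
Hypothesis f_dec : decays f M k.

Lemma decays_M_ge0 : 0 <= M.
Proof.
have := f_dec 0 (Rle_refl 0); rewrite Rmult_0_r exp_0; have := Cmod_ge_0 (f 0); lra.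
Qed.

Lemma CInt_tail X Y : 0 <= X -> X <= Y -> Cmod (CInt f X Y) <= M / k * exp (- k * X).
Proof.
move=> hX hXY; apply: Rle_trans (CInt_bound f (fun v => M * exp (- k * v)) X Y hXY f_cts _ _) _.
- cts.
- by move=> x hx; apply: f_dec; lra.
rewrite RInt_exp_decay // Rmult_minus_distr_l.
have hM := decays_M_ge0; have := exp_pos (- k * Y) => he.
have : 0 <= M / k * exp (- k * Y); last lra.
apply: Rmult_le_pos; last lra.
by apply: Rmult_le_pos => //; apply: Rlt_le; apply: Rinv_0_lt_compat.
Qed.

Lemma CInt_cauchy eps : 0 < eps -> exists n0, forall n m, (n0 <= n)%coq_nat -> (n0 <= m)%coq_nat ->
  Cmod (CInt f 0 (INR n) - CInt f 0 (INR m))%C < eps.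
Proof.
move=> he; have hM := decays_M_ge0.
have hMk0 : 0 <= M / k by apply: Rmult_le_pos => //; apply: Rlt_le; apply: Rinv_0_lt_compat.
have hMk : 0 < M / k + 1 by lra.
have he' : 0 < eps / 2 / (M / k + 1) by apply: Rdiv_lt_0_compat; lra.
have [X [hX0 hX]] := exp_small k _ k_pos he'.
have [n0 hn0] := INR_archimed 1 X Rlt_0_1; rewrite Rmult_1_r in hn0.
have hlt n m : (n0 <= n)%coq_nat -> (n <= m)%coq_nat -> Cmod (CInt f (INR n) (INR m)) < eps.
  move=> hn hm; have h1 := le_INR _ _ hn; have h2 := le_INR _ _ hm.
  apply: Rle_lt_trans (CInt_tail _ _ _ h2) _; first exact: pos_INR.
  have h3 := hX (INR n) ltac:(lra); have h4 := exp_pos (- k * INR n).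
  apply: Rle_lt_trans (_ : (M / k + 1) * (eps / 2 / (M / k + 1)) < _).
    by apply: Rmult_le_compat => //; lra.
  by rewrite (_ : (M / k + 1) * (eps / 2 / (M / k + 1)) = eps / 2); [lra | field; split; nra].
exists n0 => n m hn hm; case: (Nat.le_ge_cases n m) => hnm.
- rewrite (CInt_Chasles f 0 (INR n) (INR m) f_cts).
  rewrite (_ : (_ - _)%C = (- CInt f (INR n) (INR m))%C) ?Cmod_opp; first exact: hlt.
  by apply: C_ext => /=; ring.
- rewrite (CInt_Chasles f 0 (INR m) (INR n) f_cts).
  rewrite (_ : (_ - _)%C = (CInt f (INR m) (INR n))%C); first exact: hlt.
  by apply: C_ext => /=; ring.
Qed.

Lemma CInf_lim_nat eps : 0 < eps -> exists n0, forall n, (n0 <= n)%coq_nat ->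
  Cmod (CInf f - CInt f 0 (INR n))%C <= eps.
Proof.
move=> he.
have h1 : ex_finite_lim_seq (fun n => fst (CInt f 0 (INR n))).
  apply/ex_lim_seq_cauchy_corr => e; have [n0 hn0] := CInt_cauchy _ (cond_pos e).
  by exists n0 => n m hn hm; apply: Rle_lt_trans (hn0 n m hn hm); exact: (Rabs_fst_le (_ - _)%C).
have h2 : ex_finite_lim_seq (fun n => snd (CInt f 0 (INR n))).
  apply/ex_lim_seq_cauchy_corr => e; have [n0 hn0] := CInt_cauchy _ (cond_pos e).
  by exists n0 => n m hn hm; apply: Rle_lt_trans (hn0 n m hn hm); exact: (Rabs_snd_le (_ - _)%C).
have he2 : 0 < eps / 2 by lra.
have /is_lim_seq_spec /(_ (mkposreal _ he2)) [n1 /= hn1] := Lim_seq_correct' _ h1.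
have /is_lim_seq_spec /(_ (mkposreal _ he2)) [n2 /= hn2] := Lim_seq_correct' _ h2.
exists (Nat.max n1 n2) => n hn; apply: Rle_trans (Cmod_le_parts _) _.
have := hn1 n ltac:(lia); have := hn2 n ltac:(lia).
rewrite Rabs_minus_sym => a1; rewrite Rabs_minus_sym => a2.
by rewrite /CInf /= -!/(Rminus _ _); lra.
Qed.

Lemma CInf_tail X : 0 <= X -> Cmod (CInf f - CInt f 0 X)%C <= M / k * exp (- k * X).
Proof.
move=> hX; apply: le_epsilon => eps he.
have [n0 hn0] := CInf_lim_nat _ he.
have [n1 hn1] := INR_archimed 1 X Rlt_0_1; rewrite Rmult_1_r in hn1.
have hn : X <= INR (Nat.max n0 n1) by have := le_INR n1 (Nat.max n0 n1) ltac:(lia); lra.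
have h1 := hn0 (Nat.max n0 n1) ltac:(lia).
rewrite (_ : (CInf f - CInt f 0 X)%C = ((CInf f - CInt f 0 (INR (Nat.max n0 n1))) + CInt f X (INR (Nat.max n0 n1)))%C).
  apply: Rle_trans (Cmod_triangle _ _) _; have := CInt_tail _ _ hX hn; lra.
rewrite (CInt_Chasles f 0 X (INR (Nat.max n0 n1)) f_cts).
by apply: C_ext => /=; ring.
Qed.

Lemma CInf_bound : Cmod (CInf f) <= M / k.
Proof.
have := CInf_tail 0 (Rle_refl 0); rewrite CInt_point Rmult_0_r exp_0 Rmult_1_r.
by rewrite (_ : (CInf f - 0)%C = CInf f) //; apply: C_ext => /=; ring.
Qed.

Lemma CInf_lim eps : 0 < eps -> exists X0, 0 <= X0 /\ forall X, X0 <= X ->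
  Cmod (CInf f - CInt f 0 X)%C <= eps.
Proof.
move=> he; have hM := decays_M_ge0.
have hMk0 : 0 <= M / k by apply: Rmult_le_pos => //; apply: Rlt_le; apply: Rinv_0_lt_compat.
have he' : 0 < eps / (M / k + 1) by apply: Rdiv_lt_0_compat; lra.
have [X0 [hX0 hX]] := exp_small k _ k_pos he'.
exists X0; split=> // X hXX; apply: Rle_trans (CInf_tail X _) _; first lra.
have h3 := hX X hXX; have h4 := exp_pos (- k * X).
apply: Rle_trans (_ : (M / k + 1) * (eps / (M / k + 1)) <= _).
  by apply: Rmult_le_compat => //; lra.
by rewrite (_ : (M / k + 1) * (eps / (M / k + 1)) = eps); [lra | field; split; nra].
Qed.

(** The freedom in the upper limits is used in [CInf_gker], where they advance by whole periods from
    a starting point that is not an integer. *)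
Lemma CInf_unique (u : nat -> R) l : is_lim_seq u p_infty ->
  (forall eps, 0 < eps -> exists n0, forall n, (n0 <= n)%coq_nat -> Cmod (CInt f 0 (u n) - l)%C <= eps) ->
  CInf f = l.
Proof.
move=> /is_lim_seq_spec hu hl.
have h0 : (CInf f - l)%C = RtoC 0.
  apply: Cmod_small_0 => eps he; have he2 : 0 < eps / 2 by lra.
  have [X0 [_ hX]] := CInf_lim _ he2; have [n0 hn0] := hl _ he2; have [n1 hn1] := hu X0.
  have a1 := hX (u (Nat.max n0 n1)) (Rlt_le _ _ (hn1 (Nat.max n0 n1) ltac:(lia))).
  have a2 := hn0 (Nat.max n0 n1) ltac:(lia).
  rewrite (_ : (CInf f - l)%C = ((CInf f - CInt f 0 (u (Nat.max n0 n1))) + (CInt f 0 (u (Nat.max n0 n1)) - l))%C).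
    by apply: Rle_trans (Cmod_triangle _ _) _; lra.
  by apply: C_ext => /=; ring.
rewrite (_ : CInf f = (l + (CInf f - l))%C); last by apply: C_ext => /=; ring.
by rewrite h0 Cplus_0_r.
Qed.

Lemma decays_weaken k' : 0 < k' <= k -> decays f M k'.
Proof.
move=> hk' v hv; apply: Rle_trans (f_dec v hv) _.
apply: Rmult_le_compat_l; first exact: decays_M_ge0.
have h : k' * v <= k * v by apply: Rmult_le_compat_r; lra.
have [h1|h1] : - k * v < - k' * v \/ - k * v = - k' * v by lra.
  by apply: Rlt_le; apply: exp_increasing.
by rewrite h1; lra.
Qed.

End Improper.

Lemma CInf_mult z (f : R -> C) M k : (forall x, continuous f x) -> 0 < k -> decays f M k ->
  CInf (fun v => z * f v)%C = (z * CInf f)%C.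
Proof.
move=> hf hk hd.
have hd' : decays (fun v => z * f v)%C (Cmod z * M) k.
  move=> v hv; rewrite Cmod_mult Rmult_assoc; apply: Rmult_le_compat_l; first exact: Cmod_ge_0.
  exact: hd.
apply: (CInf_unique _ _ _ _ hk hd' _ _ is_lim_seq_INR); first by ctsC.
move=> eps he; have hz := Cmod_ge_0 z.
have he' : 0 < eps / (Cmod z + 1) by apply: Rdiv_lt_0_compat; lra.
have [n0 hn0] := CInf_lim_nat f M k hf hk hd _ he'.
exists n0 => n hn; rewrite CInt_mult //.
rewrite (_ : (_ - _)%C = (z * (- (CInf f - CInt f 0 (INR n))))%C); last by apply: C_ext => /=; ring.
rewrite Cmod_mult Cmod_opp; have h1 := hn0 n hn; have h2 := Cmod_ge_0 (CInf f - CInt f 0 (INR n))%C.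
apply: Rle_trans (_ : (Cmod z + 1) * (eps / (Cmod z + 1)) <= _); first by apply: Rmult_le_compat => //; lra.
by rewrite (_ : (Cmod z + 1) * (eps / (Cmod z + 1)) = eps); [lra | field; lra].
Qed.

Lemma CInf_plus (f g : R -> C) Mf Mg k : (forall x, continuous f x) -> (forall x, continuous g x) ->
  0 < k -> decays f Mf k -> decays g Mg k -> CInf (fun v => f v + g v)%C = (CInf f + CInf g)%C.
Proof.
move=> hf hg hk hdf hdg.
have hd' : decays (fun v => f v + g v)%C (Mf + Mg) k.
  move=> v hv; apply: Rle_trans (Cmod_triangle _ _) _.
  by rewrite Rmult_plus_distr_r; apply: Rplus_le_compat; [exact: hdf | exact: hdg].
apply: (CInf_unique _ _ _ _ hk hd' _ _ is_lim_seq_INR); first by ctsC.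
move=> eps he; have he' : 0 < eps / 2 by lra.
have [n0 hn0] := CInf_lim_nat f Mf k hf hk hdf _ he'.
have [n1 hn1] := CInf_lim_nat g Mg k hg hk hdg _ he'.
exists (Nat.max n0 n1) => n hn; rewrite CInt_plus //.
have h1 := hn0 n ltac:(lia); have h2 := hn1 n ltac:(lia).
rewrite (_ : (_ - _)%C = (- (CInf f - CInt f 0 (INR n)) + - (CInf g - CInt g 0 (INR n)))%C); last by apply: C_ext => /=; ring.
by apply: Rle_trans (Cmod_triangle _ _) _; rewrite !Cmod_opp; lra.
Qed.

Lemma CInf_ext (f g : R -> C) : (forall v, f v = g v) -> CInf f = CInf g.
Proof.
move=> h; rewrite /CInf; congr (_, _); congr real; apply: Lim_seq_ext => n; by rewrite (CInt_eq f g).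
Qed.

(** * Taylor remainder of the complex exponential *)

Fixpoint csum (u : nat -> C) (n : nat) : C :=
  match n with O => RtoC 0 | S m => (csum u m + u m)%C end.

Lemma csum_eq u v n : (forall i, u i = v i) -> csum u n = csum v n.
Proof. by move=> h; elim: n => [|n IH] //=; rewrite IH h. Qed.

Lemma csum_mult z u n : csum (fun i => z * u i)%C n = (z * csum u n)%C.
Proof. by elim: n => [|n IH] /=; [ring | rewrite IH; ring]. Qed.

Lemma csum_plus u v n : csum (fun i => u i + v i)%C n = (csum u n + csum v n)%C.
Proof. by elim: n => [|n IH] /=; [ring | rewrite IH; ring]. Qed.

Lemma csum_Sl u n : csum u (S n) = (u O + csum (fun i => u (S i)) n)%C.
Proof. by elim: n => [|n IH]; [rewrite /=; ring | move: IH => /= ->; ring]. Qed.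

Lemma ctsC_csum (F : nat -> R -> C) n : (forall i x, continuous (F i) x) ->
  forall x, continuous (fun t => csum (fun i => F i t) n) x.
Proof. by move=> hF; elim: n => [|n IH] /=; ctsC; apply: hF. Qed.

Definition exp_term (w : C) (i : nat) : C := (RtoC (/ INR (fact i)) * w ^ i)%C.

Lemma is_derive_RtoC_mult (g : R -> R) t (dg : R) (z : C) : is_derive g t dg ->
  is_derive (K := R_AbsRing) (V := C_R_NormedModule) (fun t => (RtoC (g t) * z)%C) t (RtoC dg * z)%C.
Proof.
move=> hg; apply: is_derive_C => /=.
  apply: (is_derive_ext (fun t => fst z * g t)); first by move=> x /=; ring.
  rewrite (_ : _ - _ = fst z * dg); last by ring.
  exact: is_derive_scal.
apply: (is_derive_ext (fun t => snd z * g t)); first by move=> x /=; ring.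
rewrite (_ : _ + _ = snd z * dg); last by ring.
exact: is_derive_scal.
Qed.

Lemma fact_INR_pos n : 0 < INR (fact n).
Proof. exact: INR_fact_lt_0. Qed.

Lemma exp_term_scaled w t i : exp_term (RtoC t * w)%C i = (RtoC (t ^ i) * exp_term w i)%C.
Proof. by rewrite /exp_term Cpow_mult_l RtoC_pow; ring. Qed.

Lemma is_derive_exp_partial w n t :
  is_derive (K := R_AbsRing) (V := C_R_NormedModule)
    (fun t => csum (fun i => exp_term (RtoC t * w)%C i) (S n)) t
    (w * csum (fun i => exp_term (RtoC t * w)%C i) n)%C.
Proof.
elim: n => [|n IH].
  apply: (is_derive_ext (K := R_AbsRing) (V := C_R_NormedModule) (fun _ : R => RtoC 1)).
    by move=> x /=; rewrite /exp_term /=; apply: C_ext => /=; field.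
  rewrite /= Cmult_0_r; exact: (@is_derive_const R_AbsRing C_R_NormedModule).
apply: (is_derive_ext (K := R_AbsRing) (V := C_R_NormedModule) (fun t => (csum (fun i => exp_term (RtoC t * w)%C i) (S n) + RtoC (t ^ S n) * exp_term w (S n))%C)).
  by move=> x; rewrite -exp_term_scaled.
have -> : (w * csum (fun i => exp_term (RtoC t * w)%C i) (S n))%C =
    (w * csum (fun i => exp_term (RtoC t * w)%C i) n + RtoC (INR (S n) * t ^ n) * exp_term w (S n))%C.
  rewrite -[csum _ (S n)]/(_ + _)%C Cmult_plus_distr_l exp_term_scaled; congr (_ + _)%C.
  rewrite /exp_term -[(w ^ S n)%C]/(w * w ^ n)%C fact_simpl mult_INR RtoC_mult.
  rewrite Rinv_mult RtoC_mult.
  transitivity (RtoC (INR (S n) * / INR (S n)) * (RtoC (t ^ n) * RtoC (/ INR (fact n)) * (w * w ^ n)))%C.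
    by rewrite Rinv_r; [ring | exact: not_0_INR].
  by rewrite RtoC_mult; ring.
apply: (@is_derive_plus R_AbsRing C_R_NormedModule); first exact: IH.
apply: is_derive_RtoC_mult.
have h := is_derive_pow (fun x => x) (S n) t 1 (is_derive_id t).
by rewrite (_ : INR n.+1 * t ^ n = INR n.+1 * 1 * t ^ Nat.pred n.+1) //=; ring.
Qed.

(** Along the segment from 0 to [w], the remainder of order n + 1 vanishes at t = 0 and has
    derivative [w] times the remainder of order n. The real parameter [t] is there to make this
    induction an integration over an interval. *)
Lemma Cexp_remainder_unit n w t : 0 <= t <= 1 ->
  Cmod (Cexp (RtoC t * w) - csum (fun i => exp_term (RtoC t * w) i) n)%C
    <= (t * Cmod w) ^ n / INR (fact n) * exp (Cmod w).
Proof.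
have hw := Cmod_ge_0 w.
elim: n t => [|n IH] t ht.
  rewrite /= (_ : (_ - 0)%C = Cexp (RtoC t * w)); last by apply: C_ext => /=; ring.
  rewrite Cmod_Cexp /Rdiv Rinv_1 !Rmult_1_l /=.
  have h1 : fst w <= Cmod w by apply: Rle_trans (Rabs_fst_le w); apply: Rle_abs.
  have h2 : t * fst w - 0 * snd w <= Cmod w by nra.
  by case: h2 => [h|->]; [apply: Rlt_le; apply: exp_increasing | apply: Rle_refl].
set E := fun n (t : R) => (Cexp (RtoC t * w) - csum (fun i => exp_term (RtoC t * w) i) n)%C.
have hE m : forall x, continuous (E m) x.
  rewrite /E; apply: ctsC_minus; first by ctsC.
  apply: (ctsC_csum (fun i t => exp_term (RtoC t * w) i)) => i.
  rewrite /exp_term; apply: ctsC_mult; first by ctsC.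
  by elim: i => [|i IHi] /=; ctsC.
have hd x : is_derive (K := R_AbsRing) (V := C_R_NormedModule) (E (S n)) x (w * E n x)%C.
  have -> : (w * E n x)%C = (w * Cexp (RtoC x * w) - w * csum (fun i => exp_term (RtoC x * w) i) n)%C.
    by rewrite /E; ring.
  apply: (@is_derive_minus R_AbsRing C_R_NormedModule); last exact: is_derive_exp_partial.
  apply: (is_derive_ext (K := R_AbsRing) (V := C_R_NormedModule) (fun v => Cexp (w * RtoC v))); first by move=> v; rewrite Cmult_comm.
  by rewrite (Cmult_comm (RtoC x)); exact: is_derive_Cexp.
have h0 : E (S n) 0 = RtoC 0.
  rewrite /E csum_Sl Cmult_0_l Cexp_0 {1}/exp_term /= Rinv_1 Cmult_1_l.
  have -> : csum (fun i => exp_term 0 (S i)) n = RtoC 0.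
    rewrite (csum_eq _ (fun _ => RtoC 0)); last by move=> i; rewrite /exp_term /=; ring.
    by elim: n {IH hE hd} => [|m IHm] //=; rewrite IHm; ring.
  ring.
have -> : (Cexp (RtoC t * w) - csum (fun i => exp_term (RtoC t * w) i) (S n))%C = CInt (fun x => w * E n x)%C 0 t.
  rewrite (CInt_derive (E (S n))) ?h0; first by rewrite /E; ring.
  - by move=> x _; exact: hd.
  - by ctsC; exact: hE.
set c := Cmod w ^ S n / INR (fact n) * exp (Cmod w).
apply: Rle_trans (CInt_bound _ (fun x => c * x ^ n) 0 t _ _ _ _) _; first lra.
- by ctsC; exact: hE.
- by apply: cts_mult; [exact: cts_const | elim: n {IH hE hd h0 E c} => [|m IHm] /=; cts].
- move=> x hx; rewrite Cmod_mult; have h1 := IH x ltac:(lra).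
  apply: Rle_trans (Rmult_le_compat_l _ _ _ hw h1) _.
  rewrite /c Rpow_mult_distr /= /Rdiv.
  by apply: Req_le; ring.
rewrite (is_RInt_unique _ 0 t (c * (t ^ S n / INR (S n)))).
  apply: Req_le; rewrite /c fact_simpl mult_INR Rpow_mult_distr; field.
  by split; apply: not_0_INR => //; apply: fact_neq_0.
have hder := is_RInt_derive (fun x => c * (x ^ S n / INR (S n))) (fun x => c * x ^ n) 0 t.
have e : minus (c * (t ^ S n / INR (S n))) (c * (0 ^ S n / INR (S n))) = c * (t ^ S n / INR (S n)).
  by rewrite /minus /plus /opp /= Rmult_0_l /Rdiv Rmult_0_l; ring.
rewrite -e; apply: hder.
- move=> x _; auto_derive => //; move: (not_0_INR (S n) (Nat.neq_succ_0 n)) => /= hn.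
  by field; exact: hn.
- by move=> x _; move: x; apply: cts_mult; [exact: cts_const | elim: n {IH hE hd h0 E c e} => [|m IHm] /=; cts].
Qed.

Lemma Cexp_remainder n w :
  Cmod (Cexp w - csum (exp_term w) n)%C <= Cmod w ^ n / INR (fact n) * exp (Cmod w).
Proof.
have := Cexp_remainder_unit n w 1 ltac:(lra).
by rewrite Rmult_1_l Cmult_1_l.
Qed.

(** * Power series on discs *)

Definition Cconv (u : nat -> C) (l : C) : Prop :=
  forall eps, 0 < eps -> exists n0, forall n, (n0 <= n)%coq_nat -> Cmod (csum u n - l)%C <= eps.

(** Equivalent to [analytic_at] by [analytic_at_disc], with an explicit radius in place of a
    neighbourhood filter. *)
Definition disc_analytic (f : C -> C) (z0 : C) : Prop :=
  exists a r, 0 < r /\ forall z, Cmod (z - z0)%C < r -> Cconv (fun i => a i * (z - z0) ^ i)%C (f z).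

Lemma sqrt2_lt2 : sqrt 2 < 2.
Proof. by have := sqrt_less_alt 2 ltac:(lra). Qed.

(** Balls of the product structure are squares, which costs a factor sqrt 2, rounded up to 2. *)
Lemma Cball_Cmod (x y : C) (e : posreal) : ball (M := C_UniformSpace) x e y -> Cmod (y - x)%C < 2 * e.
Proof.
move=> h; apply: Rlt_le_trans (C_NormedModule_mixin_compat2 x y e h) _.
by have := sqrt2_lt2; have := cond_pos e; nra.
Qed.

Lemma csum_sum_n u n : @sum_n C_NormedModule u n = csum u (S n).
Proof.
elim: n => [|n IH]; first by rewrite sum_O /= Cplus_0_l.
by rewrite sum_Sn IH.
Qed.

Lemma Cconv_is_series u l : Cconv u l <-> @is_series C_AbsRing C_NormedModule u l.
Proof.
split=> h.
- apply/filterlim_locally => eps.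
  have he : 0 < eps / 2 by have := cond_pos eps; lra.
  have [n0 hn0] := h _ he; exists n0 => n hn; rewrite csum_sum_n.
  apply: C_NormedModule_mixin_compat1.
  by apply: Rle_lt_trans (hn0 (S n) _) _; [lia | have := cond_pos eps; lra].
- move=> eps he; have he2 : 0 < eps / 2 by lra.
  have /filterlim_locally /(_ (mkposreal _ he2)) [n0 hn0] := h.
  exists (S n0) => -[|n] hn; first lia.
  have := hn0 n ltac:(lia); rewrite csum_sum_n => /Cball_Cmod /= hc; lra.
Qed.

Lemma Cconv_ext u v l : (forall i, u i = v i) -> Cconv u l -> Cconv v l.
Proof.
by move=> h hu eps he; have [n0 hn0] := hu eps he; exists n0 => n hn; rewrite -(csum_eq u v) //; exact: hn0.
Qed.

Lemma pow_n_Cpow (z : C) n : @pow_n C_Ring z n = (z ^ n)%C.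
Proof. by elim: n => [|n IH] //=; rewrite IH. Qed.

Lemma locally_Cmod (z0 : C) (P : C -> Prop) :
  locally (T := C_UniformSpace) z0 P <-> exists r, 0 < r /\ forall z, Cmod (z - z0)%C < r -> P z.
Proof.
split=> [[e he]|[r [hr h]]].
  exists e; split; first exact: cond_pos.
  by move=> z hz; apply: he; apply: C_NormedModule_mixin_compat1.
have hr2 : 0 < r / 2 by lra.
exists (mkposreal _ hr2) => z /Cball_Cmod /= hz; apply: h; lra.
Qed.

Lemma analytic_at_disc f z0 : analytic_at f z0 <-> disc_analytic f z0.
Proof.
have hs a z l : is_pseries (K := C_AbsRing) (V := C_NormedModule) a (z - z0)%C l <-> Cconv (fun i => a i * (z - z0) ^ i)%C l.
  rewrite Cconv_is_series; split; apply: is_series_ext => n.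
    by rewrite pow_n_Cpow Cmult_comm.
  by rewrite pow_n_Cpow Cmult_comm.
split=> [[a /locally_Cmod [r [hr h]]]|[a [r [hr h]]]].
  by exists a, r; split=> // z hz; apply/hs; exact: h.
exists a; apply/locally_Cmod; exists r; split=> // z hz.
by apply/hs; exact: h.
Qed.

Lemma disc_analytic_ext f g z0 r : 0 < r -> (forall z, Cmod (z - z0)%C < r -> f z = g z) ->
  disc_analytic f z0 -> disc_analytic g z0.
Proof.
move=> hr hfg [a [r' [hr' h]]]; exists a, (Rmin r r'); split; first by apply: Rmin_glb_lt.
move=> z hz; rewrite -hfg; first by apply: h; apply: Rlt_le_trans hz _; apply: Rmin_r.
by apply: Rlt_le_trans hz _; apply: Rmin_l.
Qed.

Lemma Cconv_plus u v l m : Cconv u l -> Cconv v m -> Cconv (fun i => u i + v i)%C (l + m)%C.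
Proof.
move=> hu hv eps he; have he2 : 0 < eps / 2 by lra.
have [n0 hn0] := hu _ he2; have [n1 hn1] := hv _ he2.
exists (Nat.max n0 n1) => n hn; rewrite csum_plus.
have h0 := hn0 n ltac:(lia); have h1 := hn1 n ltac:(lia).
rewrite (_ : (_ - _)%C = ((csum u n - l) + (csum v n - m))%C); last by ring.
by apply: Rle_trans (Cmod_triangle _ _) _; lra.
Qed.

Lemma Cconv_mult z u l : Cconv u l -> Cconv (fun i => z * u i)%C (z * l)%C.
Proof.
move=> hu eps he; have hz := Cmod_ge_0 z.
have he' : 0 < eps / (Cmod z + 1) by apply: Rdiv_lt_0_compat; lra.
have [n0 hn0] := hu _ he'; exists n0 => n hn; rewrite csum_mult.
rewrite (_ : (_ - _)%C = (z * (csum u n - l))%C); last by ring.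
rewrite Cmod_mult; have h1 := hn0 n hn; have h2 := Cmod_ge_0 (csum u n - l)%C.
apply: Rle_trans (_ : (Cmod z + 1) * (eps / (Cmod z + 1)) <= _); first by apply: Rmult_le_compat => //; lra.
by rewrite (_ : (Cmod z + 1) * (eps / (Cmod z + 1)) = eps); [lra | field; lra].
Qed.

Lemma Cconv_shift u l : Cconv u l -> Cconv (fun i => if i is S j then u j else RtoC 0) l.
Proof.
move=> hu eps he; have [n0 hn0] := hu _ he; exists (S n0) => -[|n] hn; first lia.
by rewrite csum_Sl Cplus_0_l; apply: hn0; lia.
Qed.

Lemma disc_analytic_plus f g z0 : disc_analytic f z0 -> disc_analytic g z0 ->
  disc_analytic (fun z => f z + g z)%C z0.
Proof.
move=> [a [r [hr ha]]] [b [r' [hr' hb]]].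
exists (fun i => a i + b i)%C, (Rmin r r'); split; first by apply: Rmin_glb_lt.
move=> z hz.
have h1 := ha z (Rlt_le_trans _ _ _ hz (Rmin_l _ _)).
have h2 := hb z (Rlt_le_trans _ _ _ hz (Rmin_r _ _)).
by apply: (Cconv_ext _ _ _ _ (Cconv_plus _ _ _ _ h1 h2)) => i; ring.
Qed.

Lemma disc_analytic_scal c f z0 : disc_analytic f z0 -> disc_analytic (fun z => c * f z)%C z0.
Proof.
move=> [a [r [hr ha]]]; exists (fun i => c * a i)%C, r; split=> // z hz.
by apply: (Cconv_ext _ _ _ _ (Cconv_mult c _ _ (ha z hz))) => i; ring.
Qed.

(** Write z = z0 + (z - z0): the second summand shifts the coefficients by one. Together with sums
    and constants this is all the multiplication that [zetaE] involves. *)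
Lemma disc_analytic_mult_id f z0 : disc_analytic f z0 -> disc_analytic (fun z => z * f z)%C z0.
Proof.
move=> [a [r [hr ha]]].
exists (fun i => z0 * a i + (if i is S j then a j else RtoC 0))%C, r; split=> // z hz.
have h1 := Cconv_mult z0 _ _ (ha z hz).
have h2 := Cconv_mult (z - z0)%C _ _ (Cconv_shift _ _ (ha z hz)).
have -> : (z * f z)%C = (z0 * f z + (z - z0) * f z)%C by ring.
have h2' := Cconv_shift _ _ (Cconv_mult (z - z0)%C _ _ (ha z hz)).
apply: (Cconv_ext _ _ _ _ (Cconv_plus _ _ _ _ h1 h2')) => -[|i] /=; ring.
Qed.

Lemma disc_analytic_const c z0 : disc_analytic (fun _ => c) z0.
Proof.
exists (fun i => if i is S _ then RtoC 0 else c), 1; split; first lra.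
move=> z _ eps he; exists 1%nat => -[|n] hn; first lia.
rewrite csum_Sl (csum_eq _ (fun _ => RtoC 0)); last by move=> i; ring.
have -> : csum (fun _ => RtoC 0) n = RtoC 0 by elim: n {hn} => [|n IH] //=; rewrite IH; ring.
rewrite (_ : (_ - _)%C = RtoC 0) ?Cmod_0; [lra | by rewrite /=; ring].
Qed.

Lemma disc_analytic_shift f c z0 : disc_analytic f (z0 + c)%C -> disc_analytic (fun z => f (z + c)%C) z0.
Proof.
move=> [a [r [hr ha]]]; exists a, r; split=> // z hz.
have e : (z + c - (z0 + c))%C = (z - z0)%C by ring.
by have := ha (z + c)%C; rewrite e; apply.
Qed.

Lemma exp_term_mult z w i : exp_term (z * w)%C i = (exp_term w i * z ^ i)%C.
Proof. by rewrite /exp_term Cpow_mult_l; ring. Qed.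

Lemma disc_analytic_exp c z0 : disc_analytic (fun z => Cexp (c * z)%C) z0.
Proof.
exists (fun i => Cexp (c * z0) * exp_term c i)%C, 1; split; first lra.
move=> z _; have -> : Cexp (c * z)%C = (Cexp (c * z0) * Cexp ((z - z0) * c))%C.
  by rewrite -Cexp_plus; congr Cexp; ring.
apply: (Cconv_ext (fun i => Cexp (c * z0) * exp_term ((z - z0) * c) i)%C).
  by move=> i; rewrite exp_term_mult; ring.
apply: Cconv_mult; set w := ((z - z0) * c)%C => eps he.
have he' : 0 < eps / exp (Cmod w) by apply: Rdiv_lt_0_compat => //; exact: exp_pos.
have [n0 hn0] := cv_speed_pow_fact (Cmod w) _ he'.
exists n0 => n hn.
rewrite -Cmod_opp (_ : (- _)%C = (Cexp w - csum (exp_term w) n)%C); last by ring.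
apply: Rle_trans (Cexp_remainder n w) _.
have := hn0 n hn; rewrite /Rdist Rminus_0_r => h.
have hp := exp_pos (Cmod w).
apply: Rle_trans (_ : eps / exp (Cmod w) * exp (Cmod w) <= _).
  by apply: Rmult_le_compat_r; [lra | apply: Rle_trans (Rle_abs _) _; lra].
by apply: Req_le; field; lra.
Qed.

Lemma disc_analytic_inv c z0 : z0 <> c -> disc_analytic (fun z => / (z - c))%C z0.
Proof.
move=> hz0; set d := (z0 - c)%C.
have hd : d <> RtoC 0 by move=> h; apply: hz0; rewrite -(Cplus_0_r c) -h /d; ring.
have hd0 : 0 < Cmod d by apply/Cmod_gt_0.
exists (fun i => / d * (- / d) ^ i)%C, (Cmod d / 2); split; first lra.
move=> z hz; set h := (z - z0)%C in hz *.
have hdh : (z - c)%C = (d + h)%C by rewrite /d /h; ring.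
have hdh0 : Cmod d / 2 <= Cmod (d + h)%C.
  have := Cmod_triangle (d + h)%C (- h)%C; rewrite Cmod_opp.
  by rewrite (_ : (d + h + - h)%C = d); [lra | ring].
have hdhn : (d + h)%C <> RtoC 0 by move=> e; rewrite e Cmod_0 in hdh0; lra.
set q := (- (h / d))%C.
have hq : Cmod q <= 1 / 2.
  rewrite /q Cmod_opp Cmod_div //; apply: (Rmult_le_reg_r (Cmod d)) => //.
  by rewrite /Rdiv Rmult_assoc Rinv_l; lra.
have hsum n : csum (fun i => / d * (- / d) ^ i * h ^ i)%C n = (/ (d + h) - / (d + h) * q ^ n)%C.
  elim: n => [|n IH]; first by rewrite /=; ring.
  have e : ((- / d) ^ n * h ^ n)%C = (q ^ n)%C.
    by rewrite -Cpow_mult_l; congr (_ ^ _)%C; rewrite /q /Cdiv; ring.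
  rewrite /= IH -Cmult_assoc e.
  have -> : (/ d)%C = (/ (d + h) * (1 - q))%C by rewrite /q; field; split.
  by ring.
move=> eps he.
have hr : Rabs (1 / 2) < 1 by rewrite Rabs_pos_eq; lra.
have he' : 0 < eps * (Cmod d / 2) by apply: Rmult_lt_0_compat; lra.
have [n0 hn0] := pow_lt_1_zero _ hr _ he'.
exists n0 => n hn; rewrite hsum hdh.
rewrite (_ : (_ - _)%C = (- (/ (d + h) * q ^ n))%C); last by ring.
rewrite Cmod_opp Cmod_mult Cmod_inv // Cmod_pow.
have h1 : Cmod q ^ n <= eps * (Cmod d / 2).
  apply: Rle_trans (_ : (1 / 2) ^ n <= _); first by apply: pow_incr; split => //; exact: Cmod_ge_0.
  by apply: Rle_trans (Rle_abs _) _; apply: Rlt_le; exact: hn0.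
apply: (Rmult_le_reg_l (Cmod (d + h)%C)); first lra.
rewrite -Rmult_assoc Rinv_r ?Rmult_1_l; last lra.
apply: Rle_trans h1 _; rewrite Rmult_comm; apply: Rmult_le_compat_r; lra.
Qed.

(** * Continuation of Laplace integrals *)

Lemma pow_fact_le_exp x n : 0 <= x -> x ^ n / INR (fact n) <= exp x.
Proof.
move=> hx; apply: Rle_trans (exp_ge_taylor x n hx).
have hpos i : 0 <= x ^ i / INR (fact i).
  by apply: Rmult_le_pos; [exact: pow_le | apply: Rlt_le; apply: Rinv_0_lt_compat; exact: fact_INR_pos].
by case: n => [|n] /=; [lra | have := cond_pos_sum _ n hpos; rewrite -/(fact (S n)); lra].
Qed.

Definition lap_integrand (phi : R -> R) (s : C) (v : R) : C := (RtoC (phi v) * Cexp (- s * RtoC v))%C.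

Definition Lap (phi : R -> R) (s : C) : C := CInf (lap_integrand phi s).

Section Laplace.

Variables (phi : R -> R) (M : R).
Hypothesis phi_cts : forall x, continuous phi x.
Hypothesis phi_bound : forall v, Rabs (phi v) <= M.

Lemma lap_cts s : forall x, continuous (lap_integrand phi s) x.
Proof. rewrite /lap_integrand; ctsC. Qed.

Lemma Cmod_lap_integrand s v : Cmod (lap_integrand phi s v) = Rabs (phi v) * exp (- Re s * v).
Proof.
rewrite /lap_integrand Cmod_mult Cmod_R Cmod_Cexp; congr (_ * exp _).
by rewrite /Re /=; ring.
Qed.

Lemma lap_decays s : decays (lap_integrand phi s) M (Re s).
Proof.
move=> v hv; rewrite Cmod_lap_integrand.
by apply: Rmult_le_compat_r => //; apply: Rlt_le; exact: exp_pos.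
Qed.

(** The factor exp (- (s - s0) v) is expanded in powers of s - s0 under the integral sign; the i-th
    coefficient is the integral of the integrand at [s0] times (- v)^i / i!. *)
Lemma Lap_analytic s0 : 0 < Re s0 -> disc_analytic (Lap phi) s0.
Proof.
set sg := Re s0 => hsg.
have hM : 0 <= M by apply: Rle_trans (phi_bound 0); exact: Rabs_pos.
set g := fun i v => (lap_integrand phi s0 v * exp_term (- RtoC v) i)%C.
have hg i : forall v, continuous (g i) v.
  rewrite /g; apply: ctsC_mult; first exact: lap_cts.
  rewrite /exp_term; apply: ctsC_mult; first by ctsC.
  elim: i => [|i IH] /=; ctsC.
  apply: (ctsC_pair (fun v => - RtoC v)%C) => /=; last by cts.
  by move=> x; apply: (continuous_opp (fun y : R => y)); exact: continuous_id.
have h2 : 0 < sg / 2 by lra.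
have hdec0 i v : 0 <= v -> Cmod (g i v) <= M * (v ^ i / INR (fact i)) * exp (- sg * v).
  move=> hv; rewrite /g Cmod_mult Cmod_lap_integrand /exp_term Cmod_mult Cmod_R Cmod_pow Cmod_opp Cmod_R.
  have hf := fact_INR_pos i.
  rewrite (Rabs_pos_eq v) // (Rabs_pos_eq (/ _)); last by apply: Rlt_le; apply: Rinv_0_lt_compat.
  have hq : 0 <= v ^ i / INR (fact i).
    by apply: Rmult_le_pos; [exact: pow_le | apply: Rlt_le; apply: Rinv_0_lt_compat].
  have he := exp_pos (- sg * v).
  have -> : Rabs (phi v) * exp (- sg * v) * (/ INR (fact i) * v ^ i) = Rabs (phi v) * (v ^ i / INR (fact i)) * exp (- sg * v).
    by rewrite /Rdiv; ring.
  apply: Rmult_le_compat_r; first lra.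
  exact: Rmult_le_compat_r.
have hdec i : decays (g i) (M * (4 / sg) ^ i) (sg / 2).
  move=> v hv; apply: Rle_trans (hdec0 i v hv) _.
  have h1 : v ^ i / INR (fact i) <= (4 / sg) ^ i * exp (sg / 4 * v).
    have hx : 0 <= sg / 4 * v by apply: Rmult_le_pos; lra.
    have := pow_fact_le_exp _ i hx.
    rewrite Rpow_mult_distr => h.
    have hp : 0 < (4 / sg) ^ i by apply: pow_lt; apply: Rdiv_lt_0_compat; lra.
    have := Rmult_le_compat_l _ _ _ (Rlt_le _ _ hp) h.
    rewrite /Rdiv -!Rmult_assoc -Rpow_mult_distr (_ : 4 * / sg * (sg * / 4) = 1) ?pow1 ?Rmult_1_l //.
    by field; lra.
  have he := exp_pos (- sg * v).
  apply: Rle_trans (_ : M * ((4 / sg) ^ i * exp (sg / 4 * v)) * exp (- sg * v) <= _).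
    by apply: Rmult_le_compat_r; [lra | exact: Rmult_le_compat_l].
  have hp : 0 <= M * (4 / sg) ^ i.
    by apply: Rmult_le_pos => //; apply: pow_le; apply: Rlt_le; apply: Rdiv_lt_0_compat; lra.
  rewrite -Rmult_assoc Rmult_assoc -exp_plus; apply: Rmult_le_compat_l => //.
  have [h|h] : sg / 4 * v + - sg * v < - (sg / 2) * v \/ sg / 4 * v + - sg * v = - (sg / 2) * v by nra.
    by apply: Rlt_le; exact: exp_increasing.
  by rewrite h; lra.
have hsum z n : CInf (fun v => csum (fun i => z ^ i * g i v) n)%C = csum (fun i => z ^ i * CInf (g i))%C n
    /\ exists M', decays (fun v => csum (fun i => z ^ i * g i v)%C n) M' (sg / 2).
  elim: n => [|n [IH [M' hM']]].
    have hd : decays (fun _ => RtoC 0) 0 (sg / 2) by move=> v hv; rewrite Cmod_0; lra.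
    split; last by exists 0.
    apply: Cmod_eq_0; apply: Rle_antisym; last exact: Cmod_ge_0.
    by have := CInf_bound _ _ _ (ctsC_const 0) h2 hd; rewrite /Rdiv Rmult_0_l.
  have hd : decays (fun v => z ^ n * g n v)%C (Cmod (z ^ n) * (M * (4 / sg) ^ n)) (sg / 2).
    move=> v hv; rewrite Cmod_mult Rmult_assoc; apply: Rmult_le_compat_l; first exact: Cmod_ge_0.
    exact: hdec.
  have hc1 : forall v, continuous (fun v => csum (fun i => z ^ i * g i v)%C n) v.
    by apply: (ctsC_csum (fun i v => z ^ i * g i v)%C) => i; ctsC; exact: hg.
  have hc2 : forall v, continuous (fun v => z ^ n * g n v)%C v by ctsC; exact: hg.
  split.
    rewrite /= (CInf_plus _ _ _ _ _ hc1 hc2 h2 hM' hd) IH.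
    by rewrite (CInf_mult _ _ _ _ (hg n) h2 (hdec n)).
  exists (M' + Cmod (z ^ n) * (M * (4 / sg) ^ n)) => v hv /=.
  apply: Rle_trans (Cmod_triangle _ _) _; rewrite Rmult_plus_distr_r.
  by apply: Rplus_le_compat; [exact: hM' | exact: hd].
(* Within this radius rho v is at most half of sg v / 4, so that (rho v)^n / n! <= 2^(-n) exp (sg v
   / 4). The Taylor remainder costs a further exp (sg v / 8), and the total growth rate 3 sg / 8
   still leaves decay at rate sg / 2. *)
exists (fun i => CInf (g i)), (sg / 8); split; first lra.
move=> s hs eps heps; set z := (s - s0)%C in hs *.
set rho := Cmod z in hs *.
have hrho : 0 <= rho by exact: Cmod_ge_0.
have hlim : 0 < eps / (M * 2 / sg + 1).
  apply: Rdiv_lt_0_compat => //; have : 0 <= M * 2 / sg; last lra.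
  by apply: Rmult_le_pos; [lra | apply: Rlt_le; exact: Rinv_0_lt_compat].
have hr : Rabs (1 / 2) < 1 by rewrite Rabs_pos_eq; lra.
have [n0 hn0] := pow_lt_1_zero _ hr _ hlim.
exists n0 => n hn.
have -> : csum (fun i => CInf (g i) * z ^ i)%C n = CInf (fun v => csum (fun i => z ^ i * g i v)%C n).
  by have [-> _] := hsum z n; apply: csum_eq => i; ring.
have [_ [M' hM']] := hsum z n.
set h := fun v => csum (fun i => z ^ i * g i v)%C n.
have hhc : forall v, continuous h v.
  by apply: (ctsC_csum (fun i v => z ^ i * g i v)%C) => i; ctsC; exact: hg.
have hre : sg / 2 <= Re s.
  have : Rabs (fst z) <= rho by exact: Rabs_fst_le.
  by rewrite /z /= => /Rabs_le_between; rewrite /sg /Re; move: hs; rewrite /sg /Re; lra.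
have hl : decays (lap_integrand phi s) M (sg / 2).
  by apply: (decays_weaken _ _ _ (lap_decays s)); lra.
have e1 : (CInf h - Lap phi s)%C = CInf (fun v => h v + (RtoC (-1)) * lap_integrand phi s v)%C.
  have hd1 : decays (fun v => RtoC (-1) * lap_integrand phi s v)%C M (sg / 2).
    by move=> v hv; rewrite Cmod_mult Cmod_R Rabs_Ropp Rabs_R1 Rmult_1_l; exact: hl.
  rewrite (CInf_plus _ _ _ _ _ hhc _ h2 hM' hd1); last by ctsC; exact: lap_cts.
  by rewrite (CInf_mult _ _ _ _ (lap_cts s) h2 hl) /Lap; ring.
rewrite e1.
have hdiff v : (h v + RtoC (-1) * lap_integrand phi s v)%C =
    (- (lap_integrand phi s0 v * (Cexp (z * - RtoC v) - csum (exp_term (z * - RtoC v)) n)))%C.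
  have -> : lap_integrand phi s v = (lap_integrand phi s0 v * Cexp (z * - RtoC v))%C.
    rewrite /lap_integrand -Cmult_assoc -Cexp_plus; congr (_ * Cexp _)%C; rewrite /z; ring.
  have -> : h v = (lap_integrand phi s0 v * csum (exp_term (z * - RtoC v)) n)%C.
    by rewrite /h -csum_mult; apply: csum_eq => i; rewrite exp_term_mult /g; ring.
  by ring.
have hdd : decays (fun v => h v + RtoC (-1) * lap_integrand phi s v)%C (M * (1 / 2) ^ n) (sg / 2).
  move=> v hv; rewrite hdiff Cmod_opp Cmod_mult Cmod_lap_integrand -/sg.
  have hrv : Cmod (z * - RtoC v)%C = rho * v by rewrite Cmod_mult Cmod_opp Cmod_R Rabs_pos_eq.
  have hrem := Cexp_remainder n (z * - RtoC v)%C; rewrite hrv in hrem.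
  have hx : 0 <= sg / 4 * v by apply: Rmult_le_pos; lra.
  have h1 : (rho * v) ^ n / INR (fact n) <= (1 / 2) ^ n * exp (sg / 4 * v).
    apply: Rle_trans (_ : (1 / 2) ^ n * ((sg / 4 * v) ^ n / INR (fact n)) <= _).
      rewrite /Rdiv -Rmult_assoc -Rpow_mult_distr; apply: Rmult_le_compat_r.
        by apply: Rlt_le; apply: Rinv_0_lt_compat; exact: fact_INR_pos.
      apply: pow_incr; split; first exact: Rmult_le_pos.
      by rewrite -!Rmult_assoc; apply: Rmult_le_compat_r => //; lra.
    apply: Rmult_le_compat_l; first by apply: pow_le; lra.
    exact: pow_fact_le_exp.
  have hp2 : 0 <= (1 / 2) ^ n by apply: pow_le; lra.
  have e0 := exp_pos (- sg * v); have e2 := exp_pos (rho * v); have e3 := exp_pos (sg / 4 * v).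
  apply: Rle_trans (_ : M * exp (- sg * v) * ((1 / 2) ^ n * exp (sg / 4 * v) * exp (rho * v)) <= _).
    apply: Rmult_le_compat.
    - by apply: Rmult_le_pos; [exact: Rabs_pos | lra].
    - exact: Cmod_ge_0.
    - by apply: Rmult_le_compat_r; [lra | exact: phi_bound].
    - apply: Rle_trans hrem _; apply: Rmult_le_compat_r => //; lra.
  have -> : M * exp (- sg * v) * ((1 / 2) ^ n * exp (sg / 4 * v) * exp (rho * v)) =
      M * (1 / 2) ^ n * exp (- sg * v + sg / 4 * v + rho * v) by rewrite !exp_plus; ring.
  apply: Rmult_le_compat_l; first exact: Rmult_le_pos.
  have hrv8 : rho * v <= sg / 8 * v by apply: Rmult_le_compat_r => //; lra.
  have [hh|hh] : - sg * v + sg / 4 * v + rho * v < - (sg / 2) * v \/ - sg * v + sg / 4 * v + rho * v = - (sg / 2) * v by lra.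
    by apply: Rlt_le; exact: exp_increasing.
  by rewrite hh; lra.
apply: Rle_trans (CInf_bound _ _ _ _ h2 hdd) _; first by ctsC; exact: lap_cts.
have h5 : (1 / 2) ^ n <= eps / (M * 2 / sg + 1).
  by apply: Rle_trans (Rle_abs _) _; apply: Rlt_le; exact: hn0.
have hMs : 0 <= M * 2 / sg by apply: Rmult_le_pos; [lra | apply: Rlt_le; exact: Rinv_0_lt_compat].
apply: Rle_trans (_ : (M * 2 / sg + 1) * (eps / (M * 2 / sg + 1)) <= _).
  have -> : M * (1 / 2) ^ n / (sg / 2) = M * 2 / sg * (1 / 2) ^ n by field; lra.
  apply: Rmult_le_compat => //; [apply: pow_le; lra | lra].
by apply: Req_le; field; split; [lra | have := Rmult_le_pos _ _ hMs (Rlt_le _ _ hsg); rewrite /Rdiv Rmult_assoc Rinv_l; lra].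
Qed.

End Laplace.

Lemma is_derive_RtoC_Cexp (g : R -> R) (dg : R) (z : C) v : is_derive g v dg ->
  is_derive (K := R_AbsRing) (V := C_R_NormedModule) (fun v : R => RtoC (g v) * Cexp (z * RtoC v))%C v
    (RtoC dg * Cexp (z * RtoC v) + RtoC (g v) * (z * Cexp (z * RtoC v)))%C.
Proof.
move=> hg; have hex : ex_derive g v by exists dg.
have hD : Derive (fun x => g x) v = dg by exact: is_derive_unique.
by apply: is_derive_C; rewrite /Cexp /Re /Im /=; auto_derive => //; rewrite hD /Rminus; ring.
Qed.

Lemma CInf_derive (F G : R -> C) M M' k : (forall x, continuous G x) -> 0 < k ->
  decays G M k -> decays F M' k ->
  (forall v, is_derive (K := R_AbsRing) (V := C_R_NormedModule) F v (G v)) ->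
  CInf G = (- F 0)%C.
Proof.
move=> hG hk hdG hdF hF.
apply: (CInf_unique G M k hG hk hdG _ _ is_lim_seq_INR) => eps he.
have hM' := decays_M_ge0 F M' k hdF.
have he' : 0 < eps / (M' + 1) by apply: Rdiv_lt_0_compat; lra.
have [X [hX0 hX]] := exp_small k _ hk he'.
have [n0 hn0] := INR_archimed 1 X Rlt_0_1; rewrite Rmult_1_r in hn0.
exists n0 => n hn; have hnX : X <= INR n by have := le_INR _ _ hn; lra.
rewrite (CInt_derive F) //.
rewrite (_ : (_ - _)%C = F (INR n)); last by ring.
apply: Rle_trans (hdF (INR n) (pos_INR n)) _.
have h1 := hX _ hnX; have h2 := exp_pos (- k * INR n).
apply: Rle_trans (_ : (M' + 1) * (eps / (M' + 1)) <= _); first by apply: Rmult_le_compat => //; lra.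
by apply: Req_le; field; lra.
Qed.

(** Zero mean is the condition under which an antiderivative is again periodic, hence bounded. *)
Record zero_mean_periodic (B : R -> R) : Prop := {
  zmp_cts : forall x, continuous B x;
  zmp_per : forall x, B (x + 1) = B x;
  zmp_mean : RInt B 0 1 = 0 }.

(** The constant of integration is chosen to restore zero mean, so that the operation can be
    iterated. *)
Definition prim (B : R -> R) (x : R) : R := RInt B 0 x - RInt (fun y => RInt B 0 y) 0 1.

Lemma is_derive_RInt0 (B : R -> R) x : (forall x, continuous B x) ->
  is_derive (fun y => RInt B 0 y) x (B x).
Proof.
move=> hB; apply: (is_derive_RInt B _ 0 x) => //.
by exists (mkposreal 1 Rlt_0_1) => y _; apply: cts_is_RInt.
Qed.

Lemma is_derive_prim (B : R -> R) x : (forall x, continuous B x) -> is_derive (prim B) x (B x).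
Proof.
move=> hB; rewrite -[B x]Rminus_0_r; apply: (is_derive_minus (fun y => RInt B 0 y)).
  exact: is_derive_RInt0.
exact: is_derive_const.
Qed.

Lemma prim_zmp B : zero_mean_periodic B -> zero_mean_periodic (prim B).
Proof.
move=> [hc hp hm].
have hc0 : forall x, continuous (fun y => RInt B 0 y) x.
  by apply: (cts_derivable _ B) => x; exact: is_derive_RInt0.
split.
- by apply: (cts_derivable _ B) => x; exact: is_derive_prim.
- move=> x; rewrite /prim; congr (_ - _).
  rewrite (RInt_split B 0 x) //.
  by rewrite (RInt_periodic _ B x) // hm Rplus_0_r.
- rewrite /prim RIntB //; last by cts.
  have e (c : R) : RInt (fun _ => c) 0 1 = c by rewrite RInt_const /scal /= /mult /=; toR; ring.
  by rewrite e; exact: Rminus_diag_eq.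
Qed.

Lemma zmp_bounded B : zero_mean_periodic B -> exists M, forall x, Rabs (B x) <= M.
Proof. by move=> [hc hp _]; have [M [_ hM]] := cts_bounded B hc hp; exists M. Qed.

(* Integrating by parts [k] times expresses the Laplace integral of [B (exp v)] through antiderivatives of [B] of mean
   zero, at [s + k]: this gives its continuation to [Re s > - k]. *)
Fixpoint lap_ext (k : nat) (B : R -> R) (s : C) : C :=
  match k with
  | O => Lap (fun v => B (exp v)) s
  | S k => (- RtoC (prim B 1) + (s + 1) * lap_ext k (prim B) (s + 1))%C
  end.

Lemma cts_exp_comp (B : R -> R) : (forall x, continuous B x) -> forall v, continuous (fun v => B (exp v)) v.
Proof. by move=> hB; apply: (cts_comp exp B cts_exp hB). Qed.

(** Differentiating [prim B (exp v)] produces a factor exp v, which is absorbed by passing from s to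
    s + 1. The boundary term is the value at v = 0, where exp v = 1. *)
Lemma lap_by_parts B s : zero_mean_periodic B -> 0 < Re s ->
  Lap (fun v => B (exp v)) s = (- RtoC (prim B 1) + (s + 1) * Lap (fun v => prim B (exp v)) (s + 1))%C.
Proof.
move=> hB hs; have hP := prim_zmp B hB.
have [M hM] := zmp_bounded _ hB; have [M' hM'] := zmp_bounded _ hP.
have cB : forall v, continuous (fun v : R => B (exp v)) v := cts_exp_comp _ (zmp_cts _ hB).
have cP : forall v, continuous (fun v : R => prim B (exp v)) v := cts_exp_comp _ (zmp_cts _ hP).
have d1 := lap_decays _ M (fun v => hM (exp v)) s.
have hs1 : Re (s + 1)%C = Re s + 1 by [].
have d2 : decays (lap_integrand (fun v => prim B (exp v)) (s + 1)%C) M' (Re s).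
  by apply: (decays_weaken _ _ _ (lap_decays _ M' (fun v => hM' (exp v)) (s + 1)%C)); rewrite hs1; lra.
have c1 := lap_cts _ cB s; have c2 := lap_cts _ cP (s + 1)%C.
set G := fun v => (lap_integrand (fun v => B (exp v)) s v + - (s + 1) * lap_integrand (fun v => prim B (exp v)) (s + 1) v)%C.
have d2' : decays (fun v => - (s + 1) * lap_integrand (fun v => prim B (exp v)) (s + 1) v)%C (Cmod (- (s + 1))%C * M') (Re s).
  by move=> v hv; rewrite Cmod_mult Rmult_assoc; apply: Rmult_le_compat_l; [exact: Cmod_ge_0 | exact: d2].
have c2' : forall v, continuous (fun v => - (s + 1) * lap_integrand (fun v => prim B (exp v)) (s + 1) v)%C v by ctsC.
have dG : decays G (M + Cmod (- (s + 1))%C * M') (Re s).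
  move=> v hv; apply: Rle_trans (Cmod_triangle _ _) _; rewrite Rmult_plus_distr_r.
  by apply: Rplus_le_compat; [exact: d1 | exact: d2'].
have cG : forall v, continuous G v by rewrite /G; ctsC.
have hG := CInf_derive (lap_integrand (fun v => prim B (exp v)) (s + 1)%C) G _ M' (Re s) cG hs dG d2.
have {}hG : CInf G = (- RtoC (prim B 1))%C.
  rewrite hG; first by rewrite /lap_integrand exp_0 Cmult_0_r Cexp_0 Cmult_1_r.
  move=> v; rewrite /G.
  have hd : is_derive (fun v => prim B (exp v)) v (exp v * B (exp v)).
    apply: (is_derive_comp (prim B) exp v (B (exp v)) (exp v)); first exact: is_derive_prim (zmp_cts _ hB).
    by apply/is_derive_Reals/derivable_pt_lim_exp.
  have := is_derive_RtoC_Cexp _ _ (- (s + 1))%C v hd; rewrite -/(lap_integrand _ _ v) => h.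
  have <- : (RtoC (exp v * B (exp v)) * Cexp (- (s + 1) * RtoC v)
      + RtoC (prim B (exp v)) * (- (s + 1) * Cexp (- (s + 1) * RtoC v)))%C =
    (lap_integrand (fun v => B (exp v)) s v + - (s + 1) * lap_integrand (fun v => prim B (exp v)) (s + 1) v)%C.
    have -> : lap_integrand (fun v => B (exp v)) s v = (RtoC (B (exp v)) * (RtoC (exp v) * Cexp (- (s + 1) * RtoC v)))%C.
      by rewrite /lap_integrand -Cexp_R -Cexp_plus; congr (_ * Cexp _)%C; ring.
    by rewrite /lap_integrand RtoC_mult; ring.
  exact: h.
rewrite -hG /G (CInf_plus _ _ _ _ _ c1 c2' hs d1 d2') (CInf_mult _ _ _ _ c2 hs d2) /Lap; ring.
Qed.

Lemma lap_ext_S k B s : zero_mean_periodic B -> - INR k < Re s -> lap_ext k B s = lap_ext (S k) B s.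
Proof.
elim: k B s => [|k IH] B s hB hs.
  by apply: lap_by_parts => //; move: hs; rewrite /=; lra.
rewrite -[lap_ext (S k) B s]/(- RtoC (prim B 1) + (s + 1) * lap_ext k (prim B) (s + 1))%C.
rewrite IH //; first exact: prim_zmp.
by move: hs; rewrite S_INR /Re /=; lra.
Qed.

Lemma lap_ext_agree k m B s : zero_mean_periodic B -> - INR k < Re s -> lap_ext k B s = lap_ext (k + m)%coq_nat B s.
Proof.
move=> hB hs; elim: m => [|m ->]; first by rewrite Nat.add_0_r.
rewrite Nat.add_succ_r; apply: lap_ext_S => //.
by rewrite plus_INR; have := pos_INR m; lra.
Qed.

Lemma lap_ext_analytic k B s : zero_mean_periodic B -> - INR k < Re s -> disc_analytic (lap_ext k B) s.
Proof.
elim: k B s => [|k IH] B s hB hs.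
  have [M hM] := zmp_bounded _ hB.
  apply: (Lap_analytic (fun v => B (exp v)) M); last by move: hs; rewrite /=; lra.
  - exact: cts_exp_comp (zmp_cts _ hB).
  - by move=> v; exact: hM.
have h1 : disc_analytic (fun z => lap_ext k (prim B) (z + 1)%C) s.
  apply: (disc_analytic_shift (lap_ext k (prim B))); apply: IH; first exact: prim_zmp.
  by move: hs; rewrite S_INR /Re /=; lra.
apply: (disc_analytic_plus (fun _ => - RtoC (prim B 1))%C (fun z => (z + 1) * lap_ext k (prim B) (z + 1))%C).
  exact: disc_analytic_const.
apply: (disc_analytic_ext (fun z => z * lap_ext k (prim B) (z + 1) + lap_ext k (prim B) (z + 1))%C _ _ 1 Rlt_0_1).
  by move=> z _; rewrite Cmult_plus_distr_r Cmult_1_l.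
by apply: disc_analytic_plus => //; exact: disc_analytic_mult_id.
Qed.

(** The number of integrations by parts depends on s and is large enough by [up_bound]; by [lapE_eq]
    every sufficient number gives the same value, which makes the function analytic across the jumps
    of [up]. *)
Definition lapE (B : R -> R) (s : C) : C := lap_ext (Z.to_nat (up (- Re s))) B s.

Lemma up_bound x : - INR (Z.to_nat (up (- x))) < x.
Proof.
have [h _] := archimed (- x).
case: (Z_le_dec 0 (up (- x))) => h0.
  by rewrite INR_IZR_INZ Z2Nat.id //; lra.
have : IZR (up (- x)) < 0 by apply: IZR_lt; lia.
have := pos_INR (Z.to_nat (up (- x))); lra.
Qed.

Lemma lapE_eq k B s : zero_mean_periodic B -> - INR k < Re s -> lapE B s = lap_ext k B s.
Proof.
move=> hB hs; rewrite /lapE; have h := up_bound (Re s).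
set j := Z.to_nat _ in h *.
by rewrite (lap_ext_agree j k) // (lap_ext_agree k j) // Nat.add_comm.
Qed.

Lemma lapE_analytic B s : zero_mean_periodic B -> disc_analytic (lapE B) s.
Proof.
move=> hB; have h := up_bound (Re s); set k := Z.to_nat _ in h.
apply: (disc_analytic_ext (lap_ext k B) _ _ (Re s + INR k)); last exact: lap_ext_analytic.
  lra.
move=> z hz; symmetry; apply: lapE_eq => //.
have : Rabs (fst (z - s)%C) <= Cmod (z - s)%C by exact: Rabs_fst_le.
by move=> /= /Rabs_le_between; rewrite /Re in hz *; lra.
Qed.

(** * The Hurwitz zeta function *)

Lemma cts_bump_shift a : forall x, continuous (fun x : R => bump (x - a)) x.
Proof. by apply: (cts_comp (fun x => x - a) bump); [cts | exact: bump_continuous]. Qed.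

Lemma cts_bump_exp a : forall v, continuous (fun v : R => bump (exp v - a)) v.
Proof. exact: (cts_comp exp (fun x => bump (x - a)) cts_exp (cts_bump_shift a)). Qed.

Lemma Rabs_bump x : Rabs (bump x) <= 1.
Proof. rewrite Rabs_pos_eq; [have := bump_le x; lra | exact: bump_ge0]. Qed.

Lemma RInt_bump : RInt bump 0 1 = 1 / 12.
Proof.
rewrite (RInt_ext _ (fun t => t * (1 - t) / 2)); last first.
  move=> t; rewrite /Rmin /Rmax; case: Rle_dec => // h ht; [apply: bump_unit; lra | lra].
apply: is_RInt_unique.
have := is_RInt_derive (fun t => t ^ 2 / 4 - t ^ 3 / 6) (fun t => t * (1 - t) / 2) 0 1.
rewrite (_ : minus _ _ = 1 / 12); last by rewrite /minus /plus /opp /=; field.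
apply.
- by move=> x _; auto_derive => //; field.
- by move=> x _; move: x; rewrite /Rdiv; cts.
Qed.

Definition bump0 (al x : R) : R := bump (x - al) - 1 / 12.

Lemma bump0_zmp al : zero_mean_periodic (bump0 al).
Proof.
have hc := cts_bump_shift al.
split.
- by rewrite /bump0; cts.
- by move=> x; rewrite /bump0 (_ : x + 1 - al = x - al + 1) ?(bumpD_Z _ 1); ring.
- rewrite /bump0 RIntB //; last by cts.
  have -> : RInt (fun x => bump (x - al)) 0 1 = RInt bump 0 1.
    apply: (RInt_shift_periodic bump (- al) bump_continuous) => x.
    exact: (bumpD_Z x 1).
  by rewrite RInt_bump RInt_const /scal /= /mult /=; toR; field.
Qed.

(* Second-order Euler-Maclaurin formula; [1 / 12] is the mean of [bump]. *)
Definition zetaE (al : R) (s : C) : C :=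
  (Cexp (- RtoC (ln al) * s) + / (s - 1) + RtoC (1 / 2 - al) + RtoC (1 / 12 - al * (1 - al) / 2) * s
   + s * ((s + 1) * lapE (bump0 al) (s + 1)))%C.

Lemma zetaE_analytic al s : s <> RtoC 1 -> disc_analytic (zetaE al) s.
Proof.
move=> hs; rewrite /zetaE.
have hL : disc_analytic (fun z => lapE (bump0 al) (z + 1)%C) s.
  apply: (disc_analytic_shift (lapE (bump0 al))).
  by apply: lapE_analytic; exact: bump0_zmp.
have hid : disc_analytic (fun z => z) s.
  apply: (disc_analytic_ext (fun z => z * 1)%C _ _ 1 Rlt_0_1); first by move=> z _; ring.
  by apply: disc_analytic_mult_id; exact: disc_analytic_const.
have h1 := disc_analytic_exp (- RtoC (ln al))%C s.
have h2 := disc_analytic_inv _ _ hs.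
have h3 := disc_analytic_const (RtoC (1 / 2 - al)) s.
have h4 := disc_analytic_scal (RtoC (1 / 12 - al * (1 - al) / 2)) _ _ hid.
have h5 : disc_analytic (fun z => z * ((z + 1) * lapE (bump0 al) (z + 1)))%C s.
  apply: disc_analytic_mult_id.
  apply: (disc_analytic_ext (fun z => z * lapE (bump0 al) (z + 1) + lapE (bump0 al) (z + 1))%C _ _ 1 Rlt_0_1).
    by move=> z _; rewrite Cmult_plus_distr_r Cmult_1_l.
  by apply: disc_analytic_plus => //; exact: disc_analytic_mult_id.
exact: disc_analytic_plus (disc_analytic_plus _ _ _ (disc_analytic_plus _ _ _ (disc_analytic_plus _ _ _ h1 h2) h3) h4) h5.
Qed.

Lemma Lap_const (c : R) s : 0 < Re s -> Lap (fun _ => c) s = (RtoC c / s)%C.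
Proof.
move=> hs.
have hs0 : s <> RtoC 0 by move=> e; rewrite e /= in hs; lra.
have hd : decays (fun v => RtoC 1 * Cexp (- s * RtoC v))%C 1 (Re s).
  by apply: (lap_decays (fun _ => 1) 1 _ s) => v; rewrite Rabs_R1; lra.
have hc : forall v, continuous (fun v => RtoC 1 * Cexp (- s * RtoC v))%C v by ctsC.
have h := is_derive_RtoC_Cexp (fun _ => 1) 0 (- s)%C.
have hG : CInf (fun v => - s * (RtoC 1 * Cexp (- s * RtoC v)))%C = (- RtoC 1)%C.
  have hd' : decays (fun v => - s * (RtoC 1 * Cexp (- s * RtoC v)))%C (Cmod (- s)%C * 1) (Re s).
    by move=> v hv; rewrite Cmod_mult Rmult_assoc; apply: Rmult_le_compat_l; [exact: Cmod_ge_0 | exact: hd].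
  rewrite (CInf_derive _ _ _ _ _ _ hs hd' hd).
  - by rewrite Cmult_0_r Cexp_0; ring.
  - by ctsC.
  move=> v; have := h v (is_derive_const 1 v).
  rewrite (_ : (RtoC 0 * Cexp (- s * RtoC v) + RtoC 1 * (- s * Cexp (- s * RtoC v)))%C = (- s * (RtoC 1 * Cexp (- s * RtoC v)))%C) //.
  by ring.
rewrite (CInf_mult _ _ _ _ hc hs hd) in hG.
have e : CInf (fun v => RtoC 1 * Cexp (- s * RtoC v))%C = (/ s)%C.
  move: hG; move: (CInf _) => X hX.
  have e : (s * X)%C = RtoC 1 by rewrite (_ : (s * X)%C = (- (- s * X))%C); [rewrite hX; ring | ring].
  by rewrite (_ : X = (/ s * (s * X))%C); [rewrite e; ring | field].
rewrite /Lap (CInf_ext _ (fun v => RtoC c * (RtoC 1 * Cexp (- s * RtoC v)))%C).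
  by rewrite (CInf_mult _ _ _ _ hc hs hd) e.
by move=> v; rewrite /lap_integrand Cmult_1_l.
Qed.

(** In this half-plane the Laplace integral converges without continuation. Undoing the centring of
    [bump] then cancels the summand s/12, because the constant 1/12 has Laplace integral 1/(12 (s +
    1)) at s + 1. *)
Lemma zetaE_bump al s : -1 < Re s ->
  zetaE al s = (Cexp (- RtoC (ln al) * s) + / (s - 1) + RtoC (1 / 2 - al) - RtoC (al * (1 - al) / 2) * s
   + s * (s + 1) * Lap (fun v => bump (exp v - al)) (s + 1))%C.
Proof.
move=> hs; rewrite /zetaE.
have hs1 : 0 < Re (s + 1)%C by rewrite /Re /=; rewrite /Re in hs; lra.
have hs0 : (s + 1)%C <> RtoC 0 by move=> e; rewrite e /= in hs1; lra.
rewrite (lapE_eq 0); [|exact: bump0_zmp | by rewrite /= Ropp_0].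
rewrite -[lap_ext 0 _ _]/(Lap (fun v => bump0 al (exp v)) (s + 1)%C).
have -> : Lap (fun v => bump0 al (exp v)) (s + 1)%C =
    (Lap (fun v => bump (exp v - al)) (s + 1) - RtoC (1 / 12) / (s + 1))%C.
  rewrite -Lap_const //.
  have h1 := lap_decays _ 1 (fun v => Rabs_bump (exp v - al)) (s + 1)%C.
  have hb (v : R) : Rabs (1 / 12) <= 1 by rewrite Rabs_pos_eq; lra.
  have h2 := lap_decays (fun _ => 1 / 12) 1 hb (s + 1)%C.
  have c1 := lap_cts _ (cts_bump_exp al) (s + 1)%C.
  have c2 := lap_cts (fun _ => 1 / 12) (cts_const _) (s + 1)%C.
  have h2' : decays (fun v => RtoC (-1) * lap_integrand (fun _ => (1 / 12)%R) (s + 1) v)%C 1 (Re (s + 1)%C).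
    by move=> v hv; rewrite Cmod_mult Cmod_R Rabs_Ropp Rabs_R1 Rmult_1_l; exact: h2.
  have c2' : forall v, continuous (fun v => RtoC (-1) * lap_integrand (fun _ => (1 / 12)%R) (s + 1) v)%C v by ctsC.
  rewrite {1}/Lap (CInf_ext _ (fun v => lap_integrand (fun v => bump (exp v - al)) (s + 1) v
     + RtoC (-1) * lap_integrand (fun _ => (1 / 12)%R) (s + 1) v)%C); last first.
    move=> v; rewrite /lap_integrand /bump0 RtoC_minus; ring.
  rewrite (CInf_plus _ _ _ _ _ c1 c2' hs1 h1 h2') (CInf_mult _ _ _ _ c2 hs1 h2) /Lap; ring.
have e : ((s + 1) * (Lap (fun v => bump (exp v - al)) (s + 1) - RtoC (1 / 12) / (s + 1)))%C =
    ((s + 1) * Lap (fun v => bump (exp v - al)) (s + 1) - RtoC (1 / 12))%C by field.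
by rewrite e (RtoC_minus (1 / 12)); ring.
Qed.

Definition parab (a x : R) : R := (x - a) * (1 - (x - a)) / 2.

(** Two integrations by parts lead to this antiderivative of s (s + 1) times the Laplace integrand
    of a single parabola; see [is_derive_zeta_prim]. *)
Definition zeta_prim (s : C) (a v : R) : C :=
  (RtoC (parab a (exp v)) * (Cexp (- (s + 1) * RtoC v) * - s)
   + RtoC (1 / 2 - (exp v - a)) * (Cexp (- s * RtoC v) * - RtoC 1)
   + RtoC 1 * (Cexp ((1 - s) * RtoC v) * - / (1 - s)))%C.

Lemma is_derive_eqC (f : R -> C) v (l l' : C) :
  is_derive (K := R_AbsRing) (V := C_R_NormedModule) f v l -> l = l' ->
  is_derive (K := R_AbsRing) (V := C_R_NormedModule) f v l'.
Proof. by move=> h <-. Qed.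

Lemma is_derive_Cplus (f g : R -> C) v (l m : C) :
  is_derive (K := R_AbsRing) (V := C_R_NormedModule) f v l ->
  is_derive (K := R_AbsRing) (V := C_R_NormedModule) g v m ->
  is_derive (K := R_AbsRing) (V := C_R_NormedModule) (fun v => f v + g v)%C v (l + m)%C.
Proof. exact: (@is_derive_plus R_AbsRing C_R_NormedModule). Qed.

Section ZetaPrim.

Variables (al : R) (s : C).
Hypothesis s_neq1 : s <> RtoC 1.

Let s1 : (1 - s)%C <> RtoC 0.
Proof. by move=> e; apply: s_neq1; rewrite -(Cplus_0_r s) -e; ring. Qed.

Lemma is_derive_RtoC_Cexp_mult (g : R -> R) (dg : R) (z w : C) v : is_derive g v dg ->
  is_derive (K := R_AbsRing) (V := C_R_NormedModule) (fun v : R => RtoC (g v) * (Cexp (z * RtoC v) * w))%C v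
    (RtoC dg * (Cexp (z * RtoC v) * w) + RtoC (g v) * (z * Cexp (z * RtoC v) * w))%C.
Proof.
move=> hg; have hex : ex_derive g v by exists dg.
have hD : Derive (fun x => g x) v = dg by exact: is_derive_unique.
by apply: is_derive_C; rewrite /Cexp /Re /Im /=; auto_derive => //; rewrite hD /Rminus; ring.
Qed.

Lemma Cexp_mult_exp z v : (RtoC (exp v) * Cexp (z * RtoC v))%C = Cexp ((z + 1) * RtoC v)%C.
Proof. by rewrite -Cexp_R -Cexp_plus; congr Cexp; ring. Qed.

Lemma is_derive_zeta_prim a v :
  is_derive (K := R_AbsRing) (V := C_R_NormedModule) (zeta_prim s a) v
    (s * (s + 1) * lap_integrand (fun v => parab a (exp v)) (s + 1) v)%C.
Proof.
have h1 : is_derive (fun v => parab a (exp v)) v (exp v * (1 / 2 - (exp v - a))).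
  by rewrite /parab; auto_derive => //; field.
have h2 : is_derive (fun v => 1 / 2 - (exp v - a)) v (- exp v).
  by auto_derive => //; field.
have d1 := is_derive_RtoC_Cexp_mult _ _ (- (s + 1))%C (- s)%C v h1.
have d2 := is_derive_RtoC_Cexp_mult _ _ (- s)%C (- RtoC 1)%C v h2.
have d3 := is_derive_RtoC_Cexp_mult (fun _ => 1) 0 (1 - s)%C (- / (1 - s))%C v (is_derive_const 1 v).
have d := is_derive_Cplus _ _ _ _ _ (is_derive_Cplus _ _ _ _ _ d1 d2) d3.
have e1 : Cexp (- s * RtoC v)%C = (RtoC (exp v) * Cexp (- (s + 1) * RtoC v))%C.
  by rewrite Cexp_mult_exp; congr Cexp; ring.
have e2 : Cexp ((1 - s) * RtoC v)%C = (RtoC (exp v) * (RtoC (exp v) * Cexp (- (s + 1) * RtoC v)))%C.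
  by rewrite !Cexp_mult_exp; congr Cexp; ring.
move: d; rewrite e1 e2 /lap_integrand /zeta_prim.
set E := Cexp (- (s + 1) * RtoC v)%C; rewrite RtoC_opp !RtoC_mult.
by move=> d; apply: (is_derive_eqC _ _ _ _ d); field.
Qed.

Lemma zeta_prim_segment (n : Z) v1 v2 : v1 <= v2 -> al + IZR n <= exp v1 -> exp v2 <= al + IZR n + 1 ->
  (s * (s + 1) * CInt (lap_integrand (fun v => bump (exp v - al)) (s + 1)) v1 v2)%C =
  (zeta_prim s (al + IZR n) v2 - zeta_prim s (al + IZR n) v1)%C.
Proof.
move=> h12 ha hb.
have hc := lap_cts _ (cts_bump_exp al) (s + 1)%C.
rewrite -CInt_mult //; apply: CInt_derive; last by ctsC.
move=> v; rewrite Rmin_left // Rmax_right // => hv.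
have e1 : exp v1 <= exp v by case: (Rle_lt_or_eq_dec _ _ (proj1 hv)) => [h|->]; [left; exact: exp_increasing | right].
have e2 : exp v <= exp v2 by case: (Rle_lt_or_eq_dec _ _ (proj2 hv)) => [h|->]; [left; exact: exp_increasing | right].
have -> : lap_integrand (fun v => bump (exp v - al)) (s + 1)%C v = lap_integrand (fun v => parab (al + IZR n) (exp v)) (s + 1)%C v.
  rewrite /lap_integrand; congr (RtoC _ * _)%C.
  by rewrite (bump_shift_unit n) /parab; [field | lra].
exact: is_derive_zeta_prim.
Qed.

(* [zeta_prim] at a kink [x] of [bump], seen from the left; seen from the right it is smaller by [x ^ - s]. *)
Definition zeta_bd (x : R) : C :=
  (RtoC (1 / 2) * Cexp (- s * RtoC (ln x)) - Cexp ((1 - s) * RtoC (ln x)) / (1 - s))%C.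

Lemma zeta_prim_right a : 0 < a + 1 -> zeta_prim s a (ln (a + 1)) = zeta_bd (a + 1).
Proof.
move=> ha; rewrite /zeta_prim exp_ln // /parab /zeta_bd.
rewrite (_ : (a + 1 - a) * (1 - (a + 1 - a)) / 2 = 0); last by field.
rewrite (_ : 1 / 2 - (a + 1 - a) = - (1 / 2)); last by field.
by rewrite RtoC_opp /Cdiv; ring.
Qed.

Lemma zeta_prim_left a : 0 < a -> zeta_prim s a (ln a) = (zeta_bd a - Cexp (- s * RtoC (ln a)))%C.
Proof.
move=> ha; rewrite /zeta_prim exp_ln // /parab /zeta_bd.
rewrite (_ : (a - a) * (1 - (a - a)) / 2 = 0); last by field.
rewrite (_ : 1 / 2 - (a - a) = 1 / 2); last by field.
have e : (RtoC (1 / 2) + RtoC (1 / 2))%C = RtoC 1 by rewrite -RtoC_plus; congr RtoC; field.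
set h := RtoC (1 / 2) in e *; set X := Cexp _; set Y := Cexp (- s * _)%C; set Z := Cexp _.
rewrite (_ : (h * Y - Z / (1 - s) - Y)%C = (h * Y - Z / (1 - s) - (h + h) * Y)%C); last by rewrite e; ring.
by rewrite /Cdiv; ring.
Qed.

(** The integral is cut at the kinks of [bump]. Each interior kink x contributes the jump x^(-s),
    and the jumps build the Dirichlet sum. The lower end v = 0, that is x = 1, lies in the first
    piece from [al] to [al + 1], so the kink at [al] itself is not passed and its term stands
    apart. *)
Lemma zeta_partial_sum N : 0 < al <= 1 ->
  csum (fun m => Cexp (- s * RtoC (ln (al + INR m)))) (S N) =
  (Cexp (- s * RtoC (ln al)) + zeta_prim s al 0 - zeta_bd (al + INR (S N))
   + s * (s + 1) * CInt (lap_integrand (fun v => bump (exp v - al)) (s + 1)) 0 (ln (al + INR (S N))))%C.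
Proof.
move=> hal; have hc : forall v, continuous (lap_integrand (fun v : R => bump (exp v - al)) (s + 1)%C) v.
  exact: lap_cts (cts_bump_exp al) (s + 1)%C.
elim: N => [|N IH].
  have hln : 0 <= ln (al + 1) by rewrite -ln_1; apply: ln_le; lra.
  have := zeta_prim_segment 0 0 (ln (al + 1)) hln; rewrite Rplus_0_r exp_0 exp_ln; last lra.
  move=> /(_ ltac:(lra) ltac:(lra)) h; rewrite h zeta_prim_right; last lra.
  by rewrite /= Rplus_0_r; ring.
rewrite -[csum _ (S (S N))]/(csum _ (S N) + _)%C IH.
have h0 := pos_INR N; have hS : INR (S N) = INR N + 1 by exact: S_INR.
have hSS : INR (S (S N)) = INR (S N) + 1 by exact: S_INR.
have hln : ln (al + INR (S N)) <= ln (al + INR (S (S N))) by apply: ln_le; lra.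
have := zeta_prim_segment (Z.of_nat (S N)) _ _ hln; rewrite -INR_IZR_INZ !exp_ln; [|lra|lra].
move=> /(_ ltac:(lra) ltac:(lra)) h.
rewrite (CInt_Chasles _ 0 (ln (al + INR (S N))) (ln (al + INR (S (S N)))) hc) (Cmult_plus_distr_l (s * (s + 1))%C) h.
have e : al + INR (S (S N)) = al + INR (S N) + 1 by lra.
rewrite e zeta_prim_right; last lra.
rewrite zeta_prim_left; last lra.
ring.
Qed.

Lemma zeta_prim_0 : zeta_prim s al 0 =
  (/ (s - 1) + RtoC (1 / 2 - al) - RtoC (al * (1 - al) / 2) * s)%C.
Proof.
rewrite /zeta_prim exp_0 !Cmult_0_r Cexp_0 /parab.
have hs1 : (s - 1)%C <> RtoC 0 by move=> e; apply: s_neq1; rewrite -(Cplus_0_r 1) -e; ring.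
rewrite (_ : (1 - al) * (1 - (1 - al)) / 2 = al * (1 - al) / 2); last by field.
rewrite (_ : 1 / 2 - (1 - al) = - (1 / 2 - al)); last by field.
by rewrite RtoC_opp; field.
Qed.

End ZetaPrim.

Lemma zeta_bd_small s eps : 1 < Re s -> 0 < eps -> exists X, 0 <= X /\ forall x, X <= ln x -> Cmod (zeta_bd s x) <= eps.
Proof.
move=> hs he.
have hs1 : (1 - s)%C <> RtoC 0.
  by move=> e; have : Re (1 - s)%C = 0 by [rewrite e]; rewrite /Re /= in hs *; lra.
set K := 1 / 2 + / Cmod (1 - s)%C.
have hK : 0 < K by rewrite /K; have := Rinv_0_lt_compat _ (proj1 (Cmod_gt_0 _) hs1); lra.
have [X [hX0 hX]] := exp_small (Re s - 1) _ ltac:(lra) (Rdiv_lt_0_compat _ _ he hK).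
exists X; split=> // x hx; have h := hX _ hx; have hp := exp_pos (- (Re s - 1) * ln x).
rewrite /zeta_bd /Cminus; apply: Rle_trans (Cmod_triangle _ _) _.
rewrite Cmod_opp Cmod_div // !Cmod_mult Cmod_R !Cmod_Cexp Rabs_pos_eq; last lra.
have -> : Re ((1 - s) * RtoC (ln x))%C = - (Re s - 1) * ln x by rewrite /Re /=; ring.
have h2 : exp (Re (- s * RtoC (ln x))%C) <= exp (- (Re s - 1) * ln x).
  have -> : Re (- s * RtoC (ln x))%C = - Re s * ln x by rewrite /Re /=; ring.
  have [h3|h3] : - Re s * ln x < - (Re s - 1) * ln x \/ - Re s * ln x = - (Re s - 1) * ln x by lra.
    by left; exact: exp_increasing.
  by right; rewrite h3.
apply: Rle_trans (_ : K * (eps / K) <= _); last by right; field; lra.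
apply: Rle_trans (_ : K * exp (- (Re s - 1) * ln x) <= _); last by apply: Rmult_le_compat_l; lra.
by rewrite /K /Rdiv /Cminus; lra.
Qed.

Lemma zetaE_dirichlet al s : 0 < al <= 1 -> 1 < Re s ->
  Cconv (fun m => Cexp (- s * RtoC (ln (al + INR m)))) (zetaE al s).
Proof.
move=> hal hs eps he.
have hs1 : s <> RtoC 1 by move=> e; rewrite e /= in hs; lra.
have he2 : 0 < eps / 2 by lra.
have [X [hX0 hX]] := zeta_bd_small s _ hs he2.
have hre : 0 < Re (s + 1)%C by rewrite /Re /=; rewrite /Re in hs; lra.
have hss : 0 < Cmod (s * (s + 1))%C + 1 by have := Cmod_ge_0 (s * (s + 1))%C; lra.
have [X' [hX'0 hX']] := CInf_lim _ _ _ (lap_cts _ (cts_bump_exp al) (s + 1)%C) hre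
  (lap_decays _ 1 (fun v => Rabs_bump (exp v - al)) (s + 1)%C) _ (Rdiv_lt_0_compat _ _ he2 hss).
have [n0 hn0] := INR_archimed 1 (exp (X + X')) Rlt_0_1; rewrite Rmult_1_r in hn0.
exists (S n0) => -[|n] hn; first lia.
rewrite zeta_partial_sum // zetaE_bump; last lra.
rewrite zeta_prim_0 // (_ : (- RtoC (ln al) * s)%C = (- s * RtoC (ln al))%C); last by ring.
have hlarge : X + X' <= ln (al + INR (S n)).
  rewrite -(ln_exp (X + X')); apply: ln_le; first exact: exp_pos.
  by have := le_INR _ _ hn; rewrite !S_INR; lra.
set J := CInt _ _ _; set L := Lap _ _.
rewrite (_ : (_ - _)%C = (- zeta_bd s (al + INR (S n)) + - (s * (s + 1)) * (L - J))%C); last by ring.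
apply: Rle_trans (Cmod_triangle _ _) _; rewrite Cmod_mult !Cmod_opp.
have h1 := hX (al + INR (S n)) ltac:(lra).
have h2 : Cmod (L - J)%C <= eps / 2 / (Cmod (s * (s + 1)) + 1) by apply: hX'; lra.
have h3 : Cmod (s * (s + 1))%C * Cmod (L - J)%C <= eps / 2.
  apply: Rle_trans (_ : (Cmod (s * (s + 1))%C + 1) * (eps / 2 / (Cmod (s * (s + 1)) + 1)) <= _); last by right; field; lra.
  by apply: Rmult_le_compat => //; [exact: Cmod_ge_0 | exact: Cmod_ge_0 | lra].
lra.
Qed.

(** * Identity theorem and uniqueness of the continuation *)

Lemma Cconv_bounded u l : Cconv u l -> exists M, forall n, Cmod (u n) <= M.
Proof.
move=> hu; have [n0 hn0] := hu 1 Rlt_0_1.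
have [M hM] : exists M, forall n, (n < n0)%coq_nat -> Cmod (u n) <= M.
  elim: n0 {hn0} => [|k [M hM]]; first by exists 0 => n; lia.
  exists (Rmax M (Cmod (u k))) => n hn; case: (Nat.eq_dec n k) => [->|h]; first exact: Rmax_r.
  by apply: Rle_trans (Rmax_l _ _); apply: hM; lia.
exists (Rmax M 2) => n; case: (Nat.lt_ge_cases n n0) => hn.
  by apply: Rle_trans (Rmax_l _ _); exact: hM.
apply: Rle_trans (Rmax_r _ _).
have -> : u n = ((csum u (S n) - l) + - (csum u n - l))%C by rewrite /=; ring.
apply: Rle_trans (Cmod_triangle _ _) _; rewrite Cmod_opp.
by have := hn0 n hn; have := hn0 (S n) ltac:(lia); lra.
Qed.

Lemma Cconv_unique u l m : Cconv u l -> Cconv u m -> l = m.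
Proof.
move=> hl hm; have h : (l - m)%C = RtoC 0.
  apply: Cmod_small_0 => eps he; have he2 : 0 < eps / 2 by lra.
  have [n0 hn0] := hl _ he2; have [n1 hn1] := hm _ he2.
  have h0 := hn0 (Nat.max n0 n1) ltac:(lia); have h1 := hn1 (Nat.max n0 n1) ltac:(lia).
  have -> : (l - m)%C = (- (csum u (Nat.max n0 n1) - l) + (csum u (Nat.max n0 n1) - m))%C by ring.
  by apply: Rle_trans (Cmod_triangle _ _) _; rewrite Cmod_opp; lra.
by rewrite -(Cplus_0_r m) -h; ring.
Qed.

(** Convergence at the fixed point r/2 bounds all terms there, so that at a smaller x the part
    beyond [b O] is O(x); now let x tend to 0 from the right. *)
Lemma power_series_head_0 b r : 0 < r ->
  (forall x, 0 < x < r -> Cconv (fun i => b i * RtoC x ^ i)%C (RtoC 0)) -> b O = RtoC 0.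
Proof.
move=> hr hb; set x0 := r / 2.
have hx0 : 0 < x0 by rewrite /x0; lra.
have [M hM] := Cconv_bounded _ _ (hb x0 ltac:(rewrite /x0; lra)).
have hM0 : 0 <= M by apply: Rle_trans (hM O); exact: Cmod_ge_0.
have hterm i : Cmod (b i) * x0 ^ i <= M.
  by have := hM i; rewrite Cmod_mult Cmod_pow Cmod_R Rabs_pos_eq //; lra.
have key x : 0 < x <= x0 / 2 -> Cmod (b O) <= M * 2 * (x / x0).
  move=> hx; set q := x / x0.
  have hq0 : 0 <= q by apply: Rlt_le; apply: Rdiv_lt_0_compat; lra.
  have hq : q <= 1 / 2.
    by apply: (Rmult_le_reg_r x0) => //; rewrite /q /Rdiv Rmult_assoc Rinv_l; lra.
  apply: le_epsilon => eps he.
  have [n0 hn0] := hb x ltac:(rewrite /x0 in hx; lra) eps he.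
  have := hn0 (S n0) ltac:(lia); rewrite csum_Sl.
  set t := csum _ n0 => h.
  have ht : Cmod t <= M * q * psum (fun i => q ^ i) n0.
    rewrite /t; elim: n0 {hn0 t h} => [|n IH]; first by rewrite /= Cmod_0; lra.
    rewrite /=; apply: Rle_trans (Cmod_triangle _ _) _; rewrite Rmult_plus_distr_l.
    apply: Rplus_le_compat => //.
    rewrite -[(RtoC x * RtoC x ^ n)%C]/(RtoC x ^ S n)%C Cmod_mult Cmod_pow Cmod_R Rabs_pos_eq; last lra.
    have -> : x ^ S n = x0 ^ S n * q ^ S n by rewrite -Rpow_mult_distr; congr (_ ^ _); rewrite /q; field; lra.
    rewrite -Rmult_assoc (Rmult_assoc M) tech_pow_Rmult.
    have h1 := hterm (S n); have h2 : 0 <= q ^ S n by exact: pow_le.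
    exact: Rmult_le_compat_r.
  have hg : psum (fun i => q ^ i) n0 <= 2.
    apply: Rle_trans (psum_geom_le q n0 _) _; first lra.
    rewrite -(Rinv_inv 2); apply: Rinv_le_contravar; lra.
  have h2 : Cmod t <= M * 2 * q.
    apply: Rle_trans ht _; have := Rmult_le_compat_l (M * q) _ _ (Rmult_le_pos _ _ hM0 hq0) hg; lra.
  have -> : b O = ((b O * RtoC x ^ 0 + t - 0) + - t)%C by rewrite /=; ring.
  by apply: Rle_trans (Cmod_triangle _ _) _; rewrite Cmod_opp; lra.
apply: Cmod_small_0 => eps he.
have hd : 0 < eps / (M * 2 + 1) by apply: Rdiv_lt_0_compat; lra.
set x := Rmin (x0 / 2) (x0 * (eps / (M * 2 + 1))).
have hx : 0 < x <= x0 / 2.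
  by split; [apply: Rmin_glb_lt; [lra | exact: Rmult_lt_0_compat] | exact: Rmin_l].
apply: Rle_trans (key x hx) _.
have h1 : x / x0 <= eps / (M * 2 + 1).
  apply: (Rmult_le_reg_r x0) => //; rewrite /Rdiv Rmult_assoc Rinv_l; last lra.
  by rewrite Rmult_1_r Rmult_comm; exact: Rmin_r.
have h0 : 0 <= x / x0 by apply: Rlt_le; apply: Rdiv_lt_0_compat; lra.
apply: Rle_trans (_ : (M * 2 + 1) * (eps / (M * 2 + 1)) <= _); last by right; field; lra.
apply: Rmult_le_compat => //; lra.
Qed.

Lemma power_series_0 a r : 0 < r ->
  (forall x, 0 < x < r -> Cconv (fun i => a i * RtoC x ^ i)%C (RtoC 0)) -> forall n, a n = RtoC 0.
Proof.
move=> hr ha n.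
suff h : forall x, 0 < x < r -> Cconv (fun i => a (n + i)%coq_nat * RtoC x ^ i)%C (RtoC 0).
  by have := power_series_head_0 (fun i => a (n + i)%coq_nat) r hr h; rewrite Nat.add_0_r.
elim: n => [|n IH] x hx; first exact: ha.
have h0 := power_series_head_0 (fun i => a (n + i)%coq_nat) r hr IH; rewrite Nat.add_0_r in h0.
move=> eps he; have [n0 hn0] := IH x hx (eps * x) ltac:(apply: Rmult_lt_0_compat; lra).
exists n0 => m hm; have := hn0 (S m) ltac:(lia).
rewrite csum_Sl Nat.add_0_r h0.
have -> : (0 * RtoC x ^ 0 + csum (fun i => a (n + S i)%coq_nat * RtoC x ^ S i) m - 0)%C =
    (RtoC x * (csum (fun i => a (S n + i)%coq_nat * RtoC x ^ i) m - 0))%C.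
  rewrite (csum_eq _ (fun i => RtoC x * (a (S n + i)%coq_nat * RtoC x ^ i))%C).
    by rewrite csum_mult; ring.
  by move=> i; rewrite Nat.add_succ_r Nat.add_succ_l -[(RtoC x ^ S i)%C]/(RtoC x * RtoC x ^ i)%C; ring.
rewrite Cmod_mult Cmod_R Rabs_pos_eq; last lra.
by move=> h; apply: (Rmult_le_reg_l x); lra.
Qed.

(** A line off the real axis misses the pole, and connectedness of C without 1 reduces to a supremum
    argument on it. At the leftmost point reached, the power series vanishes to the right, hence in
    a whole disc, and the zero set extends further left. *)
Lemma horizontal_identity (h : C -> C) t : t <> 0 ->
  (forall s, s <> RtoC 1 -> disc_analytic h s) -> (forall s, 1 < Re s -> h s = RtoC 0) ->
  forall x, h (x, t) = RtoC 0.
Proof.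
move=> ht han h1 x; apply: NNPP => hx.
(* The end point is negated because [completeness] yields suprema, while an infimum of abscissae is
   wanted. *)
pose E := fun y => forall z, - y <= z -> h (z, t) = RtoC 0.
have hub : is_upper_bound E (- x).
  by move=> y hy; apply: Rnot_lt_le => hlt; apply: hx; apply: hy; lra.
have hne : E (-2) by move=> z hz; apply: h1; rewrite /=; lra.
have [m [hm1 hm2]] := completeness E (ex_intro _ _ hub) (ex_intro _ _ hne).
have habove z : - m < z -> h (z, t) = RtoC 0.
  move=> hz; apply: NNPP => hnz.
  have : m <= - z; last lra.
  by apply: hm2 => y hy; apply: Rnot_lt_le => hlt; apply: hnz; apply: hy; lra.
have hs0 : ((- m, t) : C) <> RtoC 1 by move=> [_ e]; apply: ht.
have [a [r [hr ha]]] := han _ hs0.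
have ha0 : forall n, a n = RtoC 0.
  apply: (power_series_0 a r hr) => y hy.
  have e : (((- m + y)%R, t) - ((- m)%R, t))%C = RtoC y by apply: C_ext => /=; ring.
  have := ha ((- m + y)%R, t); rewrite e Cmod_R Rabs_pos_eq; last lra.
  by rewrite habove; [apply; lra | lra].
have hdisc z : Cmod (z - ((- m)%R, t))%C < r -> h z = RtoC 0.
  move=> hz; apply: Cmod_small_0 => eps he; have [n0 hn0] := ha z hz eps he.
  have := hn0 n0 (le_n _); rewrite (csum_eq _ (fun _ => RtoC 0)); last by move=> i; rewrite ha0; ring.
  have -> : csum (fun _ => RtoC 0) n0 = RtoC 0 by elim: n0 {hn0} => [|n IH] //=; rewrite IH; ring.
  by rewrite (_ : (0 - h z)%C = (- h z)%C) ?Cmod_opp //; ring.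
have : E (m + r / 2).
  move=> z hz; case: (Rlt_dec (- m) z) => hmz; first exact: habove.
  apply: hdisc.
  have -> : ((z, t) - ((- m)%R, t))%C = RtoC (z + m) by apply: C_ext => /=; ring.
  by rewrite Cmod_R; apply: Rabs_def1; lra.
by move=> /hm1; lra.
Qed.

Lemma is_hurwitz_zetaE a : is_hurwitz_zeta a (zetaE (IZR (up (- a)) + a)).
Proof.
have [hu1 hu2] := archimed (- a).
split=> s hs.
  apply/Cconv_is_series.
  apply: (Cconv_ext _ _ _ _ (zetaE_dirichlet (IZR (up (- a)) + a) s _ hs)); last lra.
  move=> m; rewrite /Rcpow plus_IZR -INR_IZR_INZ; congr (Cexp (_ * RtoC (ln _)))%C; ring.
by apply/analytic_at_disc; exact: zetaE_analytic.
Qed.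

(** Existence of a continuation, by [is_hurwitz_zetaE], gives the specification of the function
    chosen by [epsilon]; both functions sum the same series for real part above 1, and
    [horizontal_identity] carries the equality to s. *)
Lemma hurwitz_zetaE a s : Im s <> 0 -> hurwitz_zeta s a = zetaE (IZR (up (- a)) + a) s.
Proof.
move=> hs; have hg := is_hurwitz_zetaE a.
have hf : is_hurwitz_zeta a (fun s => hurwitz_zeta s a).
  by apply: (epsilon_spec (inhabits (fun _ : C => RtoC 0)) (is_hurwitz_zeta a)); eexists; exact: hg.
set g := zetaE _ in hg *.
have [hf1 hf2] := hf; have [hg1 hg2] := hg.
have h : forall x, (hurwitz_zeta (x, Im s) a + RtoC (-1) * g (x, Im s))%C = RtoC 0.
  apply: (horizontal_identity (fun s => hurwitz_zeta s a + RtoC (-1) * g s)%C _ hs).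
  - move=> z hz; apply: disc_analytic_plus; first by apply/analytic_at_disc; exact: hf2.
    by apply: disc_analytic_scal; apply/analytic_at_disc; exact: hg2.
  - move=> z hz.
    have u1 := hf1 z hz; have u2 := hg1 z hz.
    have -> : hurwitz_zeta z a = g z by apply: (Cconv_unique _ _ _ _ _); apply/Cconv_is_series; [exact: u1 | exact: u2].
    by ring.
have := h (Re s); rewrite -[(Re s, Im s)]/(fst s, snd s) -surjective_pairing => e.
by rewrite -(Cplus_0_r (g s)) -e; ring.
Qed.

(** * The periodic profile of a sum of ramps *)

(* [saw al] is the second periodic Bernoulli function based at [al], normalised to vanish at [0];
   for [x >= 0], [ramp al x] is the sum of [max (x - (n + al)) 0] over [n >= 0]. *)
Definition saw (al x : R) : R := bump (x - al) - bump al.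

Definition ramp (al x : R) : R := x * x / 2 + (1 / 2 - al) * x + saw al x.

Definition takagi (b al x : R) : R := Series (fun m => / b ^ m * saw al (b ^ m * x)).

Lemma saw_bound al x : Rabs (saw al x) <= 1.
Proof.
rewrite /saw; have := bump_ge0 (x - al); have := bump_le (x - al); have := bump_ge0 al; have := bump_le al.
by move=> *; apply: Rabs_le; lra.
Qed.

Lemma saw_pow34 al x y : Rabs (saw al x - saw al y) <= pow34 (Rabs (x - y)).
Proof.
rewrite /saw (_ : _ - _ = bump (x - al) - bump (y - al)); last by ring.
by rewrite -(_ : x - al - (y - al) = x - y); [exact: bump_pow34 | ring].
Qed.

(** No ramp has started on this range: [ramp al x] is 0, so [saw] is the opposite of the quadratic
    part. *)
Lemma saw_small al x : 0 < al <= 1 -> 0 <= x <= al -> saw al x = - (x * x) / 2 - (1 / 2 - al) * x.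
Proof.
move=> hal hx; rewrite /saw (_ : x - al = - (al - x)); last by ring.
by rewrite bump_opp !bump_unit; [field | lra | lra].
Qed.

Lemma psumS u n : psum u (S n) = psum u n + u n.
Proof. by []. Qed.

Section Takagi.

Variables b al : R.
Hypothesis b_ge2 : 2 <= b.

Let b_pos n : 0 < b ^ n.
Proof. apply: pow_lt; lra. Qed.

Let ib : 0 < / b <= 1 / 2.
Proof. by split; [apply: Rinv_0_lt_compat; lra | rewrite /Rdiv Rmult_1_l; apply: Rinv_le_contravar; lra]. Qed.

Lemma takagi_term_bound m x : Rabs (/ b ^ m * saw al (b ^ m * x)) <= (/ b) ^ m.
Proof.
rewrite Rabs_mult Rabs_pos_eq; last by apply: Rlt_le; exact: Rinv_0_lt_compat.
rewrite -pow_inv -[X in _ <= X]Rmult_1_r; apply: Rmult_le_compat_l; last exact: saw_bound.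
apply: pow_le; lra.
Qed.

Lemma ex_series_inv_pow : ex_series (fun m => (/ b) ^ m).
Proof. by apply: ex_series_geom; rewrite Rabs_pos_eq; lra. Qed.

Lemma ex_series_takagi x : ex_series (fun m => / b ^ m * saw al (b ^ m * x)).
Proof.
by eexists; apply: is_series_bounded_terms ex_series_inv_pow => m; exact: takagi_term_bound.
Qed.

Lemma takagi_bound x : Rabs (takagi b al x) <= 2.
Proof.
have h : ex_series (fun m => Rabs (/ b ^ m * saw al (b ^ m * x))).
  apply: (ex_series_le (K := R_AbsRing) (V := R_CompleteNormedModule) _ _ _ ex_series_inv_pow) => m.
  by rewrite /norm /= /abs /= Rabs_Rabsolu; exact: takagi_term_bound.
apply: Rle_trans (Series_Rabs _ h) _.
apply: Rle_trans (Series_le _ _ _ ex_series_inv_pow) _.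
  by move=> m; split; [exact: Rabs_pos | exact: takagi_term_bound].
rewrite Series_geom; last by rewrite Rabs_pos_eq; lra.
rewrite -(Rinv_inv 2); apply: Rinv_le_contravar; lra.
Qed.

Lemma takagi_eq x : takagi b al x = saw al x + takagi b al (b * x) / b.
Proof.
rewrite /takagi (Series_incr_1 _ (ex_series_takagi x)) /= Rinv_1 !Rmult_1_l.
congr (_ + _); rewrite /Rdiv -Series_scal_r; apply: Series_ext => m.
have hm := b_pos m; rewrite (_ : b * b ^ m * x = b ^ m * (b * x)); last by ring.
by field; split; lra.
Qed.

(* The functional equation determines the bounded solution. *)
Lemma takagi_unique (f : R -> R) M : (forall x, Rabs (f x) <= M) ->
  (forall x, f x = saw al x + f (b * x) / b) -> forall x, f x = takagi b al x.
Proof.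
move=> hM hf x; set d := fun x => f x - takagi b al x.
have hd y : d y = d (b * y) / b by rewrite /d hf takagi_eq; field; lra.
have hn n : forall y, d y = d (b ^ n * y) / b ^ n.
  elim: n => [|n IH] y; first by rewrite /= Rmult_1_l; field.
  have h1 := b_pos n; rewrite IH (hd (b ^ n * y)) (_ : b * (b ^ n * y) = b ^ S n * y); last by rewrite /=; ring.
  by rewrite /=; field; split; lra.
suff : Rabs (d x) <= 0.
  by have := Rabs_pos (d x) => h1 h2; have : d x = 0; [apply: Rabs_eq_0; lra | rewrite /d; lra].
apply: le_epsilon => eps he; rewrite Rplus_0_l.
have hb y : Rabs (d y) <= M + 2.
  have := Rabs_triang (f y) (- takagi b al y); rewrite Rabs_Ropp.
  by have := hM y; have := takagi_bound y; rewrite /d /Rminus; lra.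
have hM2 : 0 < M + 3 by have := hb 0; have := Rabs_pos (d 0); lra.
have hr : Rabs (/ b) < 1 by rewrite Rabs_pos_eq; lra.
have [n hnn] := pow_lt_1_zero _ hr _ (Rdiv_lt_0_compat _ _ he hM2).
have h1 : (/ b) ^ n <= eps / (M + 3) by apply: Rle_trans (Rle_abs _) _; left; exact: hnn.
have h2 : 0 <= (/ b) ^ n by apply: pow_le; lra.
rewrite (hn n) /Rdiv -pow_inv Rabs_mult (Rabs_pos_eq (_ ^ _)) //.
apply: Rle_trans (_ : (M + 3) * (eps / (M + 3)) <= _); last by right; field; lra.
by apply: Rmult_le_compat => //; [exact: Rabs_pos | have := hb (b ^ n * x); lra].
Qed.

(** The m-th term has Hoelder constant b^(-m) times b^(3m/4), and the ratio [r], equal to b^(-1/4),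
    is summable. With exponent 1 the ratio would be 1. *)
Lemma takagi_holder : exists K, 0 <= K /\ forall x y, Rabs (takagi b al x - takagi b al y) <= K * pow34 (Rabs (x - y)).
Proof.
set r := pow34 b / b.
have hr0 : 0 <= r by apply: Rmult_le_pos; [exact: pow34_ge0 | lra].
have hr1 : r < 1.
  apply: (Rmult_lt_reg_r b); first lra.
  by rewrite /r /Rdiv Rmult_assoc Rinv_l; [have := pow34_lt_id b; lra | lra].
have hr : Rabs r < 1 by rewrite Rabs_pos_eq.
exists (/ (1 - r)); split; first by left; apply: Rinv_0_lt_compat; lra.
move=> x y; set c := pow34 (Rabs (x - y)).
have hterm m : Rabs (/ b ^ m * saw al (b ^ m * x) - / b ^ m * saw al (b ^ m * y)) <= r ^ m * c.
  have hm := b_pos m.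
  rewrite -Rmult_minus_distr_l Rabs_mult Rabs_pos_eq; last by left; exact: Rinv_0_lt_compat.
  have h := saw_pow34 al (b ^ m * x) (b ^ m * y).
  rewrite -Rmult_minus_distr_l Rabs_mult (Rabs_pos_eq (b ^ m)) in h; last lra.
  rewrite pow34_mult ?pow34_pow in h; [|lra|lra|exact: Rabs_pos].
  apply: Rle_trans (Rmult_le_compat_l _ _ _ (Rlt_le _ _ (Rinv_0_lt_compat _ hm)) h) _.
  by right; rewrite /r /c Rpow_mult_distr pow_inv; ring.
rewrite /takagi -Series_minus; [|exact: ex_series_takagi|exact: ex_series_takagi].
have hg : ex_series (fun m => r ^ m * c) by apply: ex_series_scal_r; exact: ex_series_geom.
have ha : ex_series (fun m => Rabs (/ b ^ m * saw al (b ^ m * x) - / b ^ m * saw al (b ^ m * y))).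
  apply: (ex_series_le (K := R_AbsRing) (V := R_CompleteNormedModule) _ _ _ hg) => m.
  by rewrite /norm /= /abs /= Rabs_Rabsolu; exact: hterm.
apply: Rle_trans (Series_Rabs _ ha) _.
apply: Rle_trans (Series_le _ _ _ hg) _.
  by move=> m; split; [exact: Rabs_pos | exact: hterm].
by rewrite Series_scal_r Series_geom //; right; ring.
Qed.

(** With x = b^u, this is [takagi b al x / x] corrected by the two terms that make it invariant
    under x -> b x wherever [saw_small] applies. *)
Definition prof0 (u : R) : R :=
  takagi b al (exp (ln b * u)) / exp (ln b * u) - exp (ln b * u) / (2 * (b - 1)) - (1 / 2 - al) * u.

Hypothesis al_range : 1 / 3 <= al <= 1.

Lemma exp_ln_step u : exp (ln b * (u + 1)) = b * exp (ln b * u).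
Proof. by rewrite Rmult_plus_distr_l Rmult_1_r exp_plus exp_ln; [ring | lra]. Qed.

Lemma prof0_step u : exp (ln b * u) <= al -> prof0 (u + 1) = prof0 u.
Proof.
move=> hu; rewrite /prof0 exp_ln_step; move: hu; have := exp_pos (ln b * u).
move: (exp (ln b * u)) => y hy hu.
by rewrite (takagi_eq y) saw_small; [field; lra | lra | lra].
Qed.

Lemma ln_b_pos : 0 < ln b.
Proof. by rewrite -ln_1; apply: ln_increasing; lra. Qed.

Lemma prof0_sub_nat n u : exp (ln b * u) <= b * al -> prof0 u = prof0 (u - INR n).
Proof.
move=> hu; elim: n => [|n ->]; first by rewrite Rminus_0_r.
rewrite S_INR (_ : u - INR n = u - (INR n + 1) + 1); last by ring.
apply: prof0_step; apply: (Rmult_le_reg_l b); first lra.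
rewrite -exp_ln_step; apply: Rle_trans hu.
have hn := pos_INR n; have hl := ln_b_pos.
have [h|h] : ln b * (u - (INR n + 1) + 1) < ln b * u \/ ln b * (u - (INR n + 1) + 1) = ln b * u.
  have : ln b * (u - (INR n + 1) + 1) <= ln b * u by apply: Rmult_le_compat_l; lra.
  lra.
  by left; exact: exp_increasing.
by rewrite h; right.
Qed.

(* [prof0] has period 1 only on the half-line [exp (ln b * u) <= b * al], which contains [u <= - 1]; [prof] extends its
   values on [[-2, -1)], since [u - IZR (up u)] lies in [[-1, 0)]. *)
Definition prof (u : R) : R := prof0 (u - IZR (up u) - 1).

Lemma prof_periodic u : prof (u + 1) = prof u.
Proof.
rewrite /prof.
have -> : up (u + 1) = (up u + 1)%Z.
  have [h1 h2] := archimed u; symmetry; apply: tech_up; rewrite plus_IZR; lra.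
by congr prof0; rewrite plus_IZR; ring.
Qed.

Lemma exp_b_neg1 u : u <= -1 -> exp (ln b * u) <= b * al.
Proof.
move=> hu; have hl := ln_b_pos.
have h : exp (ln b * u) <= exp (ln b * -1).
  have [h|h] : ln b * u < ln b * -1 \/ ln b * u = ln b * -1.
    have : ln b * u <= ln b * -1 by apply: Rmult_le_compat_l; lra.
    lra.
  by left; exact: exp_increasing.
  by rewrite h; right.
apply: Rle_trans h _; rewrite (_ : ln b * -1 = - ln b); last by ring.
rewrite exp_Ropp exp_ln; last lra.
have := Rmult_le_compat 2 b (1 / 3) al; lra.
Qed.

Lemma prof_eq u : exp (ln b * u) <= b * al -> prof u = prof0 u.
Proof.
move=> hu; rewrite /prof; have [h1 h2] := archimed u.
case: (Z_le_dec 0 (up u + 1)) => hn.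
  rewrite (prof0_sub_nat (Z.to_nat (up u + 1)) u hu) INR_IZR_INZ Z2Nat.id // plus_IZR.
  by congr prof0; ring.
rewrite (prof0_sub_nat (Z.to_nat (- (up u + 1))) (u - IZR (up u) - 1)).
  rewrite INR_IZR_INZ Z2Nat.id; last lia.
  by congr prof0; rewrite opp_IZR plus_IZR; ring.
by apply: exp_b_neg1; lra.
Qed.

Lemma prof_sub_Z u (n : Z) : prof (u - IZR n) = prof u.
Proof.
have hN (m : nat) v : prof (v + INR m) = prof v.
  elim: m v => [|m IH] v; first by rewrite Rplus_0_r.
  by rewrite S_INR -Rplus_assoc prof_periodic IH.
case: (Z_le_dec 0 n) => hn.
  by rewrite -(hN (Z.to_nat n) (u - IZR n)) INR_IZR_INZ Z2Nat.id //; congr prof; ring.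
rewrite -(hN (Z.to_nat (- n)) u) INR_IZR_INZ Z2Nat.id; last lia.
by rewrite opp_IZR; congr prof; ring.
Qed.

(** The hypothesis says that the next level already satisfies [x / b ^ S n <= al], so all further
    ramps vanish and the finite sum is the full one. Unrolling the functional equation from x / b^n
    up to x produces the saws, and at x / b^n the value of [takagi] is expressed by the profile. *)
Lemma ramp_sum x n : 0 < x -> x / b ^ n <= b * al ->
  psum (fun i => b ^ S i * ramp al (x / b ^ S i)) n =
  x * prof (ln x / ln b) + (1 / 2 - al) * x * (ln x / ln b) + x * x / (2 * (b - 1)) - takagi b al x.
Proof.
move=> hx hn; have hl := ln_b_pos.
have h1 m : b ^ m * takagi b al (x / b ^ m) = psum (fun i => b ^ S i * saw al (x / b ^ S i)) m + takagi b al x.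
  elim: m => [|m IH]; first by rewrite /= /Rdiv Rinv_1 Rmult_1_r; ring.
  have hm := b_pos m.
  have e : takagi b al (x / b ^ S m) = saw al (x / b ^ S m) + takagi b al (x / b ^ m) / b.
    by rewrite takagi_eq (_ : b * (x / b ^ S m) = x / b ^ m) //=; field; lra.
  transitivity (b ^ S m * saw al (x / b ^ S m) + b ^ m * takagi b al (x / b ^ m)).
    by rewrite e -(tech_pow_Rmult b m); field; lra.
  by rewrite IH psumS; ring.
have h2 : psum (fun i => b ^ S i * ramp al (x / b ^ S i)) n =
    psum (fun i => b ^ S i * saw al (x / b ^ S i)) n + x * x / (2 * (b - 1)) * (1 - / b ^ n) + INR n * ((1 / 2 - al) * x).
  elim: {hn} n => [|m IH]; first by rewrite /= Rinv_1; ring.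
  have hm := b_pos m.
  rewrite !psumS IH S_INR /ramp; move: (saw al _) (psum _ m) => w t.
  by rewrite -(tech_pow_Rmult b m); field; lra.
rewrite h2.
have hn0 := b_pos n.
have e : ln (x / b ^ n) / ln b = ln x / ln b - INR n.
  by rewrite ln_div // ln_pow; [field; lra | lra].
have hy : 0 < x / b ^ n by exact: Rdiv_lt_0_compat.
have e2 : exp (ln b * (ln x / ln b - INR n)) = x / b ^ n.
  by rewrite -e (_ : ln b * _ = ln (x / b ^ n)) ?exp_ln //; field; lra.
have -> : prof (ln x / ln b) = prof0 (ln x / ln b - INR n).
  by rewrite -prof_eq ?e2 // INR_IZR_INZ prof_sub_Z.
rewrite /prof0 e2.
have -> : takagi b al (x / b ^ n) = (psum (fun i => b ^ S i * saw al (x / b ^ S i)) n + takagi b al x) / b ^ n.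
  by rewrite -h1; field; lra.
by field; lra.
Qed.

Lemma exp_lip a c m : a <= m -> c <= m -> Rabs (exp a - exp c) <= exp m * Rabs (a - c).
Proof.
have h x y : x <= y -> y <= m -> 0 <= exp y - exp x <= exp m * (y - x).
  move=> hxy hy; have e1 : exp x <= exp y by case: (Rle_lt_or_eq_dec _ _ hxy) => [h|->]; [left; exact: exp_increasing | right].
  have e2 : exp y <= exp m by case: (Rle_lt_or_eq_dec _ _ hy) => [h|->]; [left; exact: exp_increasing | right].
  split; first lra.
  have -> : exp y - exp x = exp y * (1 - exp (x - y)).
    by rewrite Rmult_minus_distr_l -exp_plus (_ : y + (x - y) = x); ring.
  have h1 := exp_ineq1_le (x - y); have h2 := exp_pos y.
  apply: Rle_trans (_ : exp y * (y - x) <= _); first by apply: Rmult_le_compat_l; lra.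
  by apply: Rmult_le_compat_r; lra.
move=> ha hc; case: (Rle_dec a c) => hac.
  have [h1 h2] := h a c hac hc; rewrite !Rabs_left1; lra.
have hca : c <= a by lra.
have [h1 h2] := h c a hca ha; rewrite !Rabs_pos_eq; lra.
Qed.

(** On a bounded window the exponential is Lipschitz and bounded away from 0, so the Hoelder bound
    passes to the quotient. The window has length 2 because [prof_holder] translates one of two
    points at distance at most 1 into its right half. *)
Lemma prof0_holder : exists K, 0 <= K /\ forall u v, -3 <= u <= -1 -> -3 <= v <= -1 -> Rabs (u - v) <= 1 ->
  Rabs (prof0 u - prof0 v) <= K * pow34 (Rabs (u - v)).
Proof.
have [K [hK hW]] := takagi_holder; have hl := ln_b_pos; set l := ln b in hl *.
set e3 := exp (3 * l).
have he3 : 0 < e3 by exact: exp_pos.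
set c1 := e3 * (K * pow34 l) + 2 * (e3 * l) + l / (2 * (b - 1)) + Rabs (1 / 2 - al).
have hp34 := pow34_ge0 l.
have hib : 0 < / (2 * (b - 1)) by apply: Rinv_0_lt_compat; lra.
have hlb : 0 <= l / (2 * (b - 1)) by apply: Rmult_le_pos; lra.
have hc1 : 0 <= c1.
  rewrite /c1; have := Rabs_pos (1 / 2 - al); have := Rmult_le_pos _ _ hK hp34 => h1 h2.
  have := Rmult_le_pos e3 _ (Rlt_le _ _ he3) h1; have := Rmult_le_pos e3 l; lra.
exists c1; split=> // u v hu hv huv.
set d := Rabs (u - v) in huv *.
have hd : 0 <= d by exact: Rabs_pos.
have hd34 : d <= pow34 d by exact: pow34_ge_id.
rewrite /prof0 -/l; set x := exp (l * u); set y := exp (l * v).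
have hx : 0 < x by exact: exp_pos.
have hy : 0 < y by exact: exp_pos.
have hlu w : -3 <= w <= -1 -> - (3 * l) <= l * w <= 0.
  by move=> hw; have := Rmult_le_compat_l l _ _ (Rlt_le _ _ hl) (proj1 hw);
     have := Rmult_le_compat_l l _ _ (Rlt_le _ _ hl) (proj2 hw); lra.
have hxy : Rabs (x - y) <= l * d.
  have := exp_lip (l * u) (l * v) 0 (proj2 (hlu u hu)) (proj2 (hlu v hv)).
  by rewrite exp_0 Rmult_1_l -Rmult_minus_distr_l Rabs_mult (Rabs_pos_eq l) //; lra.
have hix : / x <= e3.
  rewrite /x -exp_Ropp /e3; have [h|h] : - (l * u) < 3 * l \/ - (l * u) = 3 * l by have := hlu u hu; lra.
    by left; exact: exp_increasing.
  by rewrite h; right.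
have hixy : Rabs (/ x - / y) <= e3 * (l * d).
  rewrite /x /y -!exp_Ropp.
  apply: Rle_trans (exp_lip _ _ (3 * l) _ _) _; [have := hlu u hu; lra | have := hlu v hv; lra |].
  rewrite (_ : - (l * u) - - (l * v) = - (l * (u - v))); last by ring.
  by rewrite Rabs_Ropp Rabs_mult (Rabs_pos_eq l); [right | lra].
have hix0 : 0 < / x by exact: Rinv_0_lt_compat.
have hA : Rabs ((takagi b al x - takagi b al y) * / x) <= e3 * (K * pow34 l) * pow34 d.
  rewrite Rabs_mult (Rabs_pos_eq (/ x)); last lra.
  have h1 : Rabs (takagi b al x - takagi b al y) <= K * (pow34 l * pow34 d).
    apply: Rle_trans (hW x y) _; apply: Rmult_le_compat_l => //.
    rewrite -pow34_mult //; last lra.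
    by apply: pow34_le => //; exact: Rabs_pos.
  rewrite (_ : e3 * (K * pow34 l) * pow34 d = K * (pow34 l * pow34 d) * e3); last by ring.
  by apply: Rmult_le_compat => //; [exact: Rabs_pos | lra].
have hB : Rabs (takagi b al y * (/ x - / y)) <= 2 * (e3 * l) * pow34 d.
  rewrite Rabs_mult (_ : 2 * (e3 * l) * pow34 d = 2 * (e3 * l * pow34 d)); last by ring.
  apply: Rmult_le_compat; [exact: Rabs_pos | exact: Rabs_pos | exact: takagi_bound |].
  apply: Rle_trans hixy _; rewrite -Rmult_assoc; apply: Rmult_le_compat_l => //.
  by apply: Rmult_le_pos; lra.
have hC : Rabs ((y - x) * / (2 * (b - 1))) <= l / (2 * (b - 1)) * pow34 d.
  rewrite Rabs_mult (Rabs_pos_eq (/ _)); last lra.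
  rewrite Rabs_minus_sym (_ : l / (2 * (b - 1)) * pow34 d = l * pow34 d * / (2 * (b - 1))); last by rewrite /Rdiv; ring.
  apply: Rmult_le_compat_r; first lra.
  by apply: Rle_trans hxy _; apply: Rmult_le_compat_l; lra.
have hD : Rabs ((1 / 2 - al) * (v - u)) <= Rabs (1 / 2 - al) * pow34 d.
  rewrite Rabs_mult (Rabs_minus_sym v u); apply: Rmult_le_compat_l => //; exact: Rabs_pos.
rewrite (_ : _ - _ = (takagi b al x - takagi b al y) * / x + takagi b al y * (/ x - / y)
   + (y - x) * / (2 * (b - 1)) + (1 / 2 - al) * (v - u)); last by rewrite /Rdiv; ring.
apply: Rle_trans (Rabs_triang _ _) _.
apply: Rle_trans (Rplus_le_compat_r _ _ _ (Rabs_triang _ _)) _.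
apply: Rle_trans (Rplus_le_compat_r _ _ _ (Rplus_le_compat_r _ _ _ (Rabs_triang _ _))) _.
rewrite /c1; lra.
Qed.

Lemma prof_bounded : exists M, 0 <= M /\ forall u, Rabs (prof u) <= M.
Proof.
have hl := ln_b_pos; set l := ln b in hl *.
exists (2 * exp (2 * l) + 1 + 1); split; first by have := exp_pos (2 * l); lra.
move=> u; rewrite /prof; have [h1 h2] := archimed u.
set w := u - IZR (up u) - 1; have hw : -2 <= w <= -1 by rewrite /w; lra.
rewrite /prof0 -/l; set x := exp (l * w).
have hx : 0 < x by exact: exp_pos.
have hlw : - (2 * l) <= l * w <= 0.
  by have := Rmult_le_compat_l l _ _ (Rlt_le _ _ hl) (proj1 hw);
     have := Rmult_le_compat_l l _ _ (Rlt_le _ _ hl) (proj2 hw); lra.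
have hix : / x <= exp (2 * l).
  rewrite /x -exp_Ropp; have [h|h] : - (l * w) < 2 * l \/ - (l * w) = 2 * l by lra.
    by left; exact: exp_increasing.
  by rewrite h; right.
have hx1 : x <= 1.
  rewrite /x -exp_0; have [h|h] : l * w < 0 \/ l * w = 0 by lra.
    by left; exact: exp_increasing.
  by rewrite h; right.
have hA : Rabs (takagi b al x / x) <= 2 * exp (2 * l).
  have hix0 := Rinv_0_lt_compat _ hx.
  rewrite /Rdiv Rabs_mult (Rabs_pos_eq (/ x)); last lra.
  by apply: Rmult_le_compat => //; [exact: Rabs_pos | lra | exact: takagi_bound].
have hB : 0 <= x / (2 * (b - 1)) <= 1 / 2.
  have h3 : 0 < / (2 * (b - 1)) by apply: Rinv_0_lt_compat; lra.
  have h4 : / (2 * (b - 1)) <= / 2 by apply: Rinv_le_contravar; lra.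
  split; first by apply: Rmult_le_pos; lra.
  have := Rmult_le_compat x 1 (/ (2 * (b - 1))) (/ 2); rewrite /Rdiv; lra.
have hC : Rabs ((1 / 2 - al) * w) <= 1.
  have h5 : Rabs (1 / 2 - al) <= 1 / 2 by apply: Rabs_le; lra.
  have h6 : Rabs w <= 2 by apply: Rabs_le; lra.
  rewrite Rabs_mult; have := Rmult_le_compat _ _ _ _ (Rabs_pos _) (Rabs_pos _) h5 h6; lra.
move/Rabs_le_between: hA => hA; move/Rabs_le_between: hC => hC.
apply: Rabs_le; lra.
Qed.

Lemma prof_holder : exists K, 0 <= K /\ forall u v, Rabs (prof u - prof v) <= K * pow34 (Rabs (u - v)).
Proof.
have [K [hK h0]] := prof0_holder; have [M [hM hb]] := prof_bounded.
exists (K + 2 * M); split; first lra.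
have hnear u v : u <= v -> v - u <= 1 -> Rabs (prof u - prof v) <= K * pow34 (Rabs (u - v)).
  move=> huv h1; have [a1 a2] := archimed v.
  rewrite -(prof_sub_Z u (up v + 1)) -(prof_sub_Z v (up v + 1)) !plus_IZR.
  rewrite !prof_eq; [|apply: exp_b_neg1; lra|apply: exp_b_neg1; lra].
  have := h0 (u - (IZR (up v) + 1)) (v - (IZR (up v) + 1)).
  rewrite (_ : u - (IZR (up v) + 1) - (v - (IZR (up v) + 1)) = u - v); last by ring.
  by apply; [lra | lra | rewrite Rabs_left1; lra].
move=> u v; have hp := pow34_ge0 (Rabs (u - v)).
case: (Rle_dec (Rabs (u - v)) 1) => h1.
  apply: Rle_trans (_ : K * pow34 (Rabs (u - v)) <= _); last by apply: Rmult_le_compat_r; lra.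
  case: (Rle_dec u v) => huv; first by apply: hnear => //; move: h1; rewrite Rabs_left1; lra.
  rewrite Rabs_minus_sym (Rabs_minus_sym u); apply: hnear; first lra.
  by move: h1; rewrite Rabs_pos_eq; lra.
have h2 : 1 <= pow34 (Rabs (u - v)) by apply: pow34_ge1; lra.
have := Rabs_triang (prof u) (- prof v); rewrite Rabs_Ropp.
have := hb u; have := hb v; have := Rmult_le_compat_l (K + 2 * M) _ _ ltac:(lra) h2; rewrite /Rminus; lra.
Qed.

End Takagi.

(** * Scaling identities under multiplication by 3 and under squaring of the base *)

Lemma bump_triple x : bump (x - 1 / 3) + bump (x - 2 / 3) + bump x = bump (3 * x) / 3 + 2 / 9.
Proof.
have hf := frac_part_bound x; have hx := frac_part_decomp x.
set n := Int_part x in hx; set f := frac_part x in hf hx.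
have h0 : bump x = f * (1 - f) / 2 by [].
have e1 : IZR (n - 1) = IZR n - 1 by rewrite minus_IZR.
have e3 k : IZR (3 * n + k) = 3 * IZR n + IZR k by rewrite plus_IZR mult_IZR.
have shift m y : IZR m <= y <= IZR m + 1 -> bump y = (y - IZR m) * (1 - (y - IZR m)) / 2.
  exact: bump_shift_unit.
rewrite h0; case: (Rle_dec f (1 / 3)) => h1; last case: (Rle_dec f (2 / 3)) => h2.
- have := shift (n - 1)%Z (x - 1 / 3); have := shift (n - 1)%Z (x - 2 / 3); have := shift (3 * n + 0)%Z (3 * x).
  rewrite e1 e3 => -> ; last lra; move=> ->; last lra; move=> ->; last lra.
  by rewrite hx; field.
- have := shift n (x - 1 / 3); have := shift (n - 1)%Z (x - 2 / 3); have := shift (3 * n + 1)%Z (3 * x).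
  rewrite e1 e3 => -> ; last lra; move=> ->; last lra; move=> ->; last lra.
  by rewrite hx; field.
- have := shift n (x - 1 / 3); have := shift n (x - 2 / 3); have := shift (3 * n + 2)%Z (3 * x).
  rewrite e3 => -> ; last lra; move=> ->; last lra; move=> ->; last lra.
  by rewrite hx; field.
Qed.

Lemma bump_third : bump (1 / 3) = 1 / 9.
Proof. by rewrite bump_unit; [field | lra]. Qed.

Lemma bump_two_thirds : bump (2 / 3) = 1 / 9.
Proof. by rewrite bump_unit; [field | lra]. Qed.

Lemma bump_1 : bump 1 = 0.
Proof. by rewrite bump_unit; [field | lra]. Qed.

(** The multiplication formula of the second Bernoulli function for the factor 3; normalising to 0
    at the origin removes the constant of [bump_triple]. *)
Lemma saw_triple x : saw (1 / 3) x + saw (2 / 3) x + saw 1 x = saw 1 (3 * x) / 3.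
Proof.
rewrite /saw bump_third bump_two_thirds bump_1.
have -> : bump (x - 1) = bump x by rewrite -(bumpD_Z (x - 1) 1); congr bump; ring.
have -> : bump (3 * x - 1) = bump (3 * x) by rewrite -(bumpD_Z (3 * x - 1) 1); congr bump; ring.
have := bump_triple x; lra.
Qed.

Lemma takagi_triple b x : 2 <= b ->
  takagi b (1 / 3) x + takagi b (2 / 3) x + takagi b 1 x = takagi b 1 (3 * x) / 3.
Proof.
move=> hb; rewrite /takagi -Series_plus; try exact: ex_series_takagi.
rewrite -Series_plus; try exact: ex_series_takagi; last first.
  apply: (ex_series_plus (K := R_AbsRing) (V := R_NormedModule)); exact: ex_series_takagi.
rewrite /Rdiv -Series_scal_r; apply: Series_ext => m.
rewrite -!Rmult_plus_distr_l saw_triple (_ : b ^ m * (3 * x) = 3 * (b ^ m * x)); last by ring.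
by rewrite /Rdiv; ring.
Qed.

Lemma prof0_triple b u : 2 <= b ->
  prof0 b (1 / 3) u + prof0 b (2 / 3) u + prof0 b 1 u = prof0 b 1 (u + ln 3 / ln b) - ln 3 / ln b / 2.
Proof.
move=> hb; have hl := ln_b_pos b hb.
rewrite /prof0.
have -> : exp (ln b * (u + ln 3 / ln b)) = 3 * exp (ln b * u).
  rewrite Rmult_plus_distr_l exp_plus (_ : ln b * (ln 3 / ln b) = ln 3); last by field; lra.
  by rewrite exp_ln; lra.
have hy := exp_pos (ln b * u); move: (exp _) hy => y hy.
have h := takagi_triple b y hb.
have -> : takagi b 1 (3 * y) = 3 * (takagi b (1 / 3) y + takagi b (2 / 3) y + takagi b 1 y) by lra.
by field; split; lra.
Qed.

Lemma prof_triple b u : 2 <= b ->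
  prof b (1 / 3) u + prof b (2 / 3) u + prof b 1 u = prof b 1 (u + ln 3 / ln b) - ln 3 / ln b / 2.
Proof.
move=> hb; have hl := ln_b_pos b hb.
have hl3 : 0 < ln 3 / ln b by apply: Rdiv_lt_0_compat => //; rewrite -ln_1; apply: ln_increasing; lra.
(* Translation by an integer moves all arguments below -1, where [prof] and [prof0] agree. *)
have [h1 _] := archimed (u + ln 3 / ln b + 2); set n := up _ in h1.
have b1 : 1 / 3 <= 1 / 3 <= 1 by lra.
have b2 : 1 / 3 <= 2 / 3 <= 1 by lra.
have b3 : 1 / 3 <= 1 <= 1 by lra.
rewrite -(prof_sub_Z b _ u n) -(prof_sub_Z b _ u n) -(prof_sub_Z b _ u n) -(prof_sub_Z b _ (u + _) n).
rewrite !prof_eq //; try by apply: exp_b_neg1 => //; lra.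
rewrite prof0_triple // (_ : u - IZR n + ln 3 / ln b = u + ln 3 / ln b - IZR n) //; ring.
Qed.

(** The two summands are the even and the odd terms of the series in base p. Checking that their sum
    is bounded and solves the functional equation in base p avoids rearranging a series. *)
Lemma takagi_square p al x : 2 <= p ->
  takagi p al x = takagi (p * p) al x + takagi (p * p) al (p * x) / p.
Proof.
move=> hp; have hb : 2 <= p * p by nra.
symmetry; apply: (takagi_unique p al hp (fun x => takagi (p * p) al x + takagi (p * p) al (p * x) / p) 4) x.
  move=> y; apply: Rle_trans (Rabs_triang _ _) _.
  have h1 := takagi_bound (p * p) al hb y; have h2 := takagi_bound (p * p) al hb (p * y).
  have h3 : 0 < / p <= 1 by split; [apply: Rinv_0_lt_compat; lra | rewrite -Rinv_1; apply: Rinv_le_contravar; lra].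
  rewrite /Rdiv Rabs_mult (Rabs_pos_eq (/ p)); last lra.
  have := Rmult_le_compat _ _ _ _ (Rabs_pos _) (Rlt_le _ _ (proj1 h3)) h2 (proj2 h3); lra.
move=> y; rewrite {1}(takagi_eq (p * p) al hb y) (_ : p * (p * y) = p * p * y); last by ring.
by field; lra.
Qed.

Lemma prof0_square p al u : 2 <= p ->
  prof0 p al u = prof0 (p * p) al (u / 2) + prof0 (p * p) al (u / 2 + 1 / 2) + (1 / 2 - al) / 2.
Proof.
move=> hp; have hl := ln_b_pos p hp.
rewrite /prof0 ln_mult; try lra.
have -> : (ln p + ln p) * (u / 2) = ln p * u by field.
have -> : (ln p + ln p) * (u / 2 + 1 / 2) = ln p + ln p * u by field.
rewrite exp_plus exp_ln; last lra.
have hy := exp_pos (ln p * u); move: (exp _) hy => y hy.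
have h4 : 0 < p * p - 1 by nra.
by rewrite (takagi_square p al y hp); field; repeat split; lra.
Qed.

Lemma prof_square p al u : 2 <= p -> 1 / 3 <= al <= 1 ->
  prof p al u = prof (p * p) al (u / 2) + prof (p * p) al (u / 2 + 1 / 2) + (1 / 2 - al) / 2.
Proof.
move=> hp hal; have hb : 2 <= p * p by nra.
have [h1 h2] := archimed (Rabs u + 3); set n := up _ in h1.
have hu := Rle_abs u; have hu0 := Rabs_pos u.
rewrite -(prof_sub_Z p al u (2 * n)) -(prof_sub_Z (p * p) al (u / 2) n) -(prof_sub_Z (p * p) al (u / 2 + 1 / 2) n).
rewrite mult_IZR (prof_eq p al hp hal); last by apply: (exp_b_neg1 p al hp hal); lra.
rewrite (prof_eq (p * p) al hb hal (u / 2 - IZR n)); last by apply: (exp_b_neg1 (p * p) al hb hal); lra.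
rewrite (prof_eq (p * p) al hb hal (u / 2 + 1 / 2 - IZR n)); last by apply: (exp_b_neg1 (p * p) al hb hal); lra.
rewrite (prof0_square p al _ hp).
have -> : (u - 2 * IZR n) / 2 = u / 2 - IZR n by field.
by have -> : u / 2 - IZR n + 1 / 2 = u / 2 + 1 / 2 - IZR n by ring.
Qed.

(** * Fourier coefficients of the profile *)

(* Applying it restates an equality of complex integrals in [C] itself, where [ring] and [field] apply. *)
Lemma C_eqI (x y : C) : x = y -> x = y.
Proof. by []. Qed.

Lemma C_solve (z w l x : C) : z <> RtoC 0 -> w <> RtoC 0 -> l <> RtoC 0 ->
  x = (z * w * (l * x) / (z * w * l))%C.
Proof. by move=> hz hw hl; field. Qed.

Lemma C_eq_sub (x y z : C) : y = (x + z)%C -> z = (y - x)%C.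
Proof. by move=> ->; ring. Qed.

Lemma CInt_derive_eq (f df : R -> C) (l : C) a b :
  (f b - f a)%C = l ->
  (forall x, Rmin a b <= x <= Rmax a b -> is_derive (K := R_AbsRing) (V := C_R_NormedModule) f x (df x)) ->
  (forall x, continuous df x) -> CInt df a b = l.
Proof. by move=> <- h1 h2; exact: CInt_derive. Qed.

Section ProfileCoefficients.

Variables b al : R.
Hypothesis b_ge2 : 2 <= b.
Hypothesis al_range : 1 / 3 <= al <= 1.
Variable k : Z.
Hypothesis k_neq0 : k <> 0%Z.

Let L := ln b.
Let L_pos : 0 < L. Proof. exact: ln_b_pos. Qed.

(** The exponents whose power of b is 1, cf. [Cexp_freq_period]. For b = p this is [chi p k], for b
    = p * p it is [chi_half p k]. *)
Definition freq : C := (0, 2 * PI * IZR k / L).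

Local Notation chi := freq.

Lemma freq_neq0 : chi <> RtoC 0.
Proof.
move=> [e]; have := two_pi_k_neq0 _ k_neq0 => h; apply: h.
by have -> : 2 * PI * IZR k = 2 * PI * IZR k / L * L; [field; lra | rewrite e; ring].
Qed.

Lemma freq_plus1_neq0 : (chi + 1)%C <> RtoC 0.
Proof. by move=> [e _]; move: e => /=; lra. Qed.

Lemma freq_minus1_neq0 : (1 - chi)%C <> RtoC 0.
Proof. by move=> [e _]; move: e => /=; lra. Qed.

Lemma freq_neq1 : chi <> RtoC 1.
Proof. by move=> [e _]; move: e => /=; lra. Qed.

Lemma Cexp_freq_period (m : Z) : Cexp (- chi * RtoC (IZR m * L))%C = RtoC 1.
Proof.
have e : (- chi * RtoC (IZR m * L))%C = (0, 0 + 2 * PI * IZR (- (k * m))).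
  by apply: C_ext => /=; rewrite ?opp_IZR ?mult_IZR; [ring | field; lra].
rewrite e; apply: C_ext; rewrite /Cexp /= exp_0.
  by rewrite cos_shift_Z cos_0; ring.
by rewrite sin_shift_Z sin_0; ring.
Qed.

(** Integration is over the period from [la] to [la + L]: there exp v runs from [al] to [b * al],
    which is where [prof_eq] identifies the profile with [prof0]. *)
Let la := ln al.
Let q := Cexp (- chi * RtoC la)%C.

Let al_pos : 0 < al. Proof. lra. Qed.
Let exp_la : exp la = al. Proof. exact: exp_ln. Qed.

Definition gker (v : R) : C := lap_integrand (fun v : R => saw al (exp v)) (chi + 1)%C v.

Lemma cts_saw_exp : forall v, continuous (fun v : R => saw al (exp v)) v.
Proof. by rewrite /saw; have h := cts_bump_exp al; cts. Qed.

Lemma cts_gker : forall v, continuous gker v.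
Proof. exact: lap_cts cts_saw_exp (chi + 1)%C. Qed.

Lemma Re_freq1 : Re (chi + 1)%C = 1.
Proof. by rewrite /= Rplus_0_l. Qed.

(** Because b to the power [chi] is 1, a translation by m periods contributes only the factor
    b^(-m), and the m-th term of the Takagi series appears. *)
Lemma gker_shift (m : nat) v :
  gker (v + INR m * L) = (RtoC (/ b ^ m * saw al (b ^ m * exp v))%R * Cexp (- (chi + 1) * RtoC v))%C.
Proof.
rewrite /gker /lap_integrand.
have hb : exp (INR m * L) = b ^ m by rewrite -ln_pow ?exp_ln //; [apply: pow_lt; lra | lra].
rewrite exp_plus hb (Rmult_comm (exp v)) RtoC_mult.
have -> : Cexp (- (chi + 1) * RtoC (v + INR m * L))%C = (RtoC (/ b ^ m) * Cexp (- (chi + 1) * RtoC v))%C.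
  have -> : (- (chi + 1) * RtoC (v + INR m * L))%C =
      (- chi * RtoC (IZR (Z.of_nat m) * L) + (RtoC (- (INR m * L)) + - (chi + 1) * RtoC v))%C.
    by rewrite -INR_IZR_INZ RtoC_plus RtoC_opp; ring.
  by rewrite !Cexp_plus Cexp_freq_period Cexp_R exp_Ropp hb; ring.
ring.
Qed.

Lemma CInt_gker_blocks M : CInt gker la (la + INR M * L) =
  CInt (fun v => RtoC (psum (fun m => / b ^ m * saw al (b ^ m * exp v)) M)%R * Cexp (- (chi + 1) * RtoC v))%C la (la + L).
Proof.
have hs m : forall v, continuous (fun v : R => saw al (b ^ m * exp v)) v.
  apply: (cts_comp (fun v => b ^ m * exp v) (saw al)); first by cts.
  by rewrite /saw; have h := cts_bump_shift al; cts.
elim: M => [|M IH].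
  rewrite Rmult_0_l Rplus_0_r CInt_point /=.
  rewrite (CInt_eq _ (fun _ => RtoC 0 * RtoC 0)%C); last by move=> v; ring.
  by rewrite (CInt_mult _ (fun _ => RtoC 0)); [ring | ctsC].
rewrite (CInt_Chasles gker la (la + INR M * L) (la + INR (S M) * L) cts_gker) IH.
have -> : CInt gker (la + INR M * L) (la + INR (S M) * L) =
    CInt (fun v => RtoC (/ b ^ M * saw al (b ^ M * exp v))%R * Cexp (- (chi + 1) * RtoC v))%C la (la + L).
  have h := CInt_lin gker 1 (INR M * L) la (la + L) cts_gker.
  rewrite (_ : la + INR M * L = 1 * la + INR M * L); last by ring.
  rewrite (_ : la + INR (S M) * L = 1 * (la + L) + INR M * L); last by rewrite S_INR; ring.
  rewrite -h; apply: CInt_eq => v; rewrite -gker_shift Cmult_1_l; congr gker; ring.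
rewrite -CInt_plus.
- by apply: CInt_eq => v; rewrite psumS RtoC_plus; ring.
- apply: ctsC_mult; last by ctsC.
  apply: ctsC_RtoC; apply: (cts_psum (fun m v => / b ^ m * saw al (b ^ m * exp v))) => m.
  by have h := hs m; cts.
- by have h := hs M; ctsC.
Qed.

Lemma cts_takagi : forall x, continuous (takagi b al) x.
Proof. by have [K [_ h]] := takagi_holder b al b_ge2; exact: (holder_cts _ K h). Qed.

Lemma gker_decays : decays gker 1 1.
Proof. by have := lap_decays _ 1 (fun v => saw_bound al (exp v)) (chi + 1)%C; rewrite Re_freq1. Qed.

(** Unfolding: the series integrated over one period is a single saw integrated from [la] to
    infinity. Since [CInf] starts at 0, the stretch from [la] to 0 is taken off. *)
Lemma CInf_gker : CInf gker =
  (CInt (fun v => RtoC (takagi b al (exp v)) * Cexp (- (chi + 1) * RtoC v)) la (la + L) - CInt gker la 0)%C.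
Proof.
apply: (CInf_unique gker 1 1 cts_gker Rlt_0_1 gker_decays (fun n => la + INR n * L)).
  apply/is_lim_seq_spec => M.
  have [n0 hn0] := INR_archimed L (M - la) L_pos; exists n0 => n hn.
  by have := Rmult_le_compat_r L _ _ (Rlt_le _ _ L_pos) (le_INR _ _ hn); lra.
move=> eps he.
have hc := cts_takagi.
have hcT : forall v, continuous (fun v : R => takagi b al (exp v)) v by apply: (cts_comp exp (takagi b al)) => //; exact: cts_exp.
have hd : 0 < 3 * L by lra.
have [n0 hn0] := weierstrass_tail R (fun m x => / b ^ m * saw al (b ^ m * x)) _
  (takagi_term_bound b al b_ge2) (ex_series_inv_pow b b_ge2) _ (Rdiv_lt_0_compat _ _ he hd).
exists n0 => n hn.
have -> : CInt gker 0 (la + INR n * L) = (CInt gker la (la + INR n * L) - CInt gker la 0)%C.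
  by apply: C_eq_sub; exact: CInt_Chasles cts_gker.
rewrite CInt_gker_blocks.
set A := CInt _ la (la + L); set B := CInt (fun v => RtoC (takagi _ _ _) * _)%C la (la + L).
rewrite (_ : (_ - _)%C = (A - B)%C); last by ring.
have hcP : forall v, continuous (fun v : R => psum (fun m => / b ^ m * saw al (b ^ m * exp v)) n) v.
  apply: (cts_psum (fun m v => / b ^ m * saw al (b ^ m * exp v))) => m.
  have h : forall v, continuous (fun v : R => saw al (b ^ m * exp v)) v.
    apply: (cts_comp (fun v => b ^ m * exp v) (saw al)); first by cts.
    by rewrite /saw; have h := cts_bump_shift al; cts.
  by cts.
rewrite /A /B -CInt_minus; [|by ctsC|by ctsC].
have -> : eps = RInt (fun _ => eps / L) la (la + L).
  by rewrite RInt_const /scal /= /mult /=; toR; field; lra.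
apply: CInt_bound; [lra | by ctsC | by cts |].
move=> v hv.
rewrite (_ : (_ - _)%C = (RtoC (psum (fun m => / b ^ m * saw al (b ^ m * exp v)) n - takagi b al (exp v))%R * Cexp (- (chi + 1) * RtoC v))%C);
  last by rewrite RtoC_minus; ring.
rewrite Cmod_mult Cmod_R Cmod_Cexp Rabs_minus_sym.
have h1 := hn0 n hn (exp v); rewrite -/(takagi b al (exp v)) in h1.
(* On this period exp v >= al >= 1/3; the tolerance eps / (3 L) was chosen accordingly. *)
have h2 : exp (Re (- (chi + 1) * RtoC v)%C) <= 3.
  have -> : Re (- (chi + 1) * RtoC v)%C = - v by rewrite /=; ring.
  rewrite exp_Ropp -(Rinv_inv 3); apply: Rinv_le_contravar; first lra.
  apply: Rle_trans (_ : exp la <= _); first by rewrite exp_la; lra.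
  by case: (Rle_lt_or_eq_dec _ _ (proj1 hv)) => [h|<-]; [left; exact: exp_increasing | right].
apply: Rle_trans (_ : eps / (3 * L) * 3 <= _); last by right; field; lra.
by apply: Rmult_le_compat => //; [exact: Rabs_pos | left; exact: exp_pos].
Qed.

Lemma freq_pow1 : Cexp (- (chi + 1) * RtoC la)%C = (q / RtoC al)%C.
Proof.
have -> : (- (chi + 1) * RtoC la)%C = (- chi * RtoC la + RtoC (- la))%C by rewrite RtoC_opp; ring.
by rewrite Cexp_plus Cexp_R exp_Ropp exp_la RtoC_inv; [|lra].
Qed.

Lemma freq_pow2 : Cexp ((1 - chi) * RtoC la)%C = (RtoC al * q)%C.
Proof.
have -> : ((1 - chi) * RtoC la)%C = (RtoC la + - chi * RtoC la)%C by ring.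
by rewrite Cexp_plus Cexp_R exp_la.
Qed.

Lemma CInt_quadratic_part :
  CInt (fun v => RtoC (exp v / (2 * (b - 1))) * Cexp (- chi * RtoC v))%C la (la + L) =
  (RtoC al * q / (RtoC 2 * (1 - chi)))%C.
Proof.
have h1 := freq_minus1_neq0.
have hb : RtoC (b - 1) <> RtoC 0 by move=> /RtoC_inj; lra.
have h2 : RtoC 2 <> RtoC 0 by move=> /RtoC_inj; lra.
apply: (CInt_derive_eq (fun v => RtoC 1 * (Cexp ((1 - chi) * RtoC v) * / (RtoC (2 * (b - 1)) * (1 - chi))))%C).
- have -> : Cexp ((1 - chi) * RtoC (la + L))%C = (RtoC b * (RtoC al * q))%C.
    have -> : ((1 - chi) * RtoC (la + L))%C = ((1 - chi) * RtoC la + (RtoC L + - chi * RtoC (IZR 1 * L)))%C.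
      by rewrite Rmult_1_l RtoC_plus; ring.
    rewrite !Cexp_plus Cexp_freq_period Cexp_R exp_ln ?freq_pow2; [ring | lra].
  rewrite freq_pow2 RtoC_mult.
  transitivity ((RtoC b - RtoC 1) / RtoC (b - 1) * (RtoC al * q / (RtoC 2 * (1 - chi))))%C; first by field.
  by rewrite -RtoC_minus; field.
- move=> v _; have := is_derive_RtoC_Cexp_mult (fun _ => 1) 0 (1 - chi)%C (/ (RtoC (2 * (b - 1)) * (1 - chi)))%C v (is_derive_const 1 v).
  move=> h; apply: (is_derive_eqC _ _ _ _ h).
  have -> : Cexp ((1 - chi) * RtoC v)%C = (RtoC (exp v) * Cexp (- chi * RtoC v))%C.
    by rewrite -Cexp_R -Cexp_plus; congr Cexp; ring.
  have hb2 : 2 * (b - 1) <> 0 by lra.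
  have hb3 : RtoC (2 * (b - 1)) <> RtoC 0 by move=> /RtoC_inj.
  by rewrite RtoC_div //; field.
- by rewrite /Rdiv; ctsC.
Qed.

Lemma CInt_linear_part c :
  CInt (fun v => RtoC (c * v / L) * Cexp (- chi * RtoC v))%C la (la + L) = (- (RtoC c * q / chi))%C.
Proof.
have h0 := freq_neq0.
have hL : RtoC L <> RtoC 0 by move=> /RtoC_inj; lra.
apply: (CInt_derive_eq (fun v => RtoC (c * v / L)%R * (Cexp (- chi * RtoC v) * - / chi)
   + RtoC 1 * (Cexp (- chi * RtoC v) * - (RtoC (c / L) / (chi * chi))))%C).
- have -> : Cexp (- chi * RtoC (la + L))%C = q.
    have -> : (- chi * RtoC (la + L))%C = (- chi * RtoC la + - chi * RtoC (IZR 1 * L))%C.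
      by rewrite Rmult_1_l RtoC_plus; ring.
    by rewrite Cexp_plus Cexp_freq_period Cmult_1_r.
  rewrite -/q.
  have -> : RtoC (c * (la + L) / L) = (RtoC (c * la / L) + RtoC c)%C.
    by rewrite -RtoC_plus; congr RtoC; field; lra.
  by field.
- move=> v _.
  have hd : is_derive (fun v => c * v / L) v (c / L) by auto_derive => //; rewrite /Rdiv; ring.
  have d1 := is_derive_RtoC_Cexp_mult (fun v => c * v / L) (c / L) (- chi)%C (- / chi)%C v hd.
  have d2 := is_derive_RtoC_Cexp_mult (fun _ => 1) 0 (- chi)%C (- (RtoC (c / L) / (chi * chi)))%C v (is_derive_const 1 v).
  apply: (is_derive_eqC _ _ _ _ (is_derive_Cplus _ _ _ _ _ d1 d2)).
  by field.
- by rewrite /Rdiv; ctsC.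
Qed.

(** The stretch from [la] to 0 stays inside the first parabola, so [zeta_prim] evaluates it, and the
    half-line beyond is given by [zetaE_bump]. The terms in [q] that remain are cancelled in
    [profile_coefficient] by the quadratic and linear parts of the profile. *)
Lemma gker_total : (chi * (chi + 1) * (CInt gker la 0 + CInf gker))%C =
  (zetaE al chi - RtoC (1 / 2) * q + RtoC al * q / (1 - chi) - chi * (RtoC (al * (1 - al) / 2) * (q / RtoC al)))%C.
Proof.
set lb := lap_integrand (fun v : R => bump (exp v - al)) (chi + 1)%C.
set lc := lap_integrand (fun _ : R => bump al) (chi + 1)%C.
have cb : forall v, continuous lb v by exact: lap_cts (cts_bump_exp al) (chi + 1)%C.
have cc : forall v, continuous lc v by exact: lap_cts (cts_const _) (chi + 1)%C.
have db := lap_decays _ 1 (fun v => Rabs_bump (exp v - al)) (chi + 1)%C.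
have dc := lap_decays (fun _ => bump al) 1 (fun _ => Rabs_bump al) (chi + 1)%C.
have hre : 0 < Re (chi + 1)%C by rewrite Re_freq1; lra.
have dc' : decays (fun v => RtoC (-1) * lc v)%C 1 (Re (chi + 1)%C).
  by move=> v hv; rewrite Cmod_mult Cmod_R Rabs_Ropp Rabs_R1 Rmult_1_l; exact: dc.
have cc' : forall v, continuous (fun v => RtoC (-1) * lc v)%C v by ctsC.
have hg v : gker v = (lb v + RtoC (-1) * lc v)%C.
  by rewrite /gker /lb /lc /lap_integrand /saw RtoC_minus; ring.
have e1 : CInf gker = (Lap (fun v => bump (exp v - al)) (chi + 1) - RtoC (bump al) / (chi + 1))%C.
  rewrite (CInf_ext _ _ hg) (CInf_plus _ _ _ _ _ cb cc' hre db dc') (CInf_mult _ _ _ _ cc hre dc).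
  have -> : CInf lc = (RtoC (bump al) / (chi + 1))%C by exact: Lap_const.
  by rewrite /Lap -/lb; ring.
have e2 : CInt lc la 0 = (RtoC (bump al) * (q / RtoC al - 1) / (chi + 1))%C.
  apply: (CInt_derive_eq (fun v => RtoC (bump al) * (Cexp (- (chi + 1) * RtoC v) * - / (chi + 1)))%C).
  - rewrite Cmult_0_r Cexp_0 freq_pow1; have := freq_plus1_neq0 => h; field; split => //.
    by move=> /RtoC_inj; lra.
  - move=> v _; have h := is_derive_RtoC_Cexp_mult (fun _ => bump al) 0 (- (chi + 1))%C (- / (chi + 1))%C v (is_derive_const (bump al) v).
    apply: (is_derive_eqC _ _ _ _ h); rewrite /lc /lap_integrand.
    by field; exact: freq_plus1_neq0.
  - by [].
have e3 : CInt gker la 0 = (CInt lb la 0 - CInt lc la 0)%C.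
  by rewrite -CInt_minus //; apply: CInt_eq => v; rewrite hg; ring.
have hla : la <= 0 by rewrite /la -ln_1; apply: ln_le; lra.
have e4 := zeta_prim_segment al chi freq_neq1 0 la 0 hla.
rewrite Rplus_0_r exp_la exp_0 -/lb in e4.
have {}e4 := e4 ltac:(lra) ltac:(lra).
have e5 := zetaE_bump al chi ltac:(rewrite /=; lra).
have e6 := zeta_prim_0 al chi freq_neq1.
have e7 : zeta_prim chi al la = (- (RtoC (1 / 2) * q) - RtoC al * q / (1 - chi))%C.
  rewrite /la zeta_prim_left //.
  rewrite /zeta_bd -/la -/q freq_pow2.
  have eh : (RtoC (1 / 2) + RtoC (1 / 2))%C = RtoC 1 by rewrite -RtoC_plus; congr RtoC; field.
  move: (RtoC (1 / 2)) eh => h eh.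
  rewrite (_ : (h * q - RtoC al * q / (1 - chi) - q)%C = (h * q - RtoC al * q / (1 - chi) - RtoC 1 * q)%C); last by ring.
  by rewrite -eh; ring.
rewrite e1 e3 e2.
have hb : bump al = al * (1 - al) / 2 by rewrite bump_unit; lra.
rewrite hb.
set J := Lap _ _ in e5 *.
have -> : (chi * (chi + 1) * (CInt lb la 0 - RtoC (al * (1 - al) / 2) * (q / RtoC al - 1) / (chi + 1)
    + (J - RtoC (al * (1 - al) / 2) / (chi + 1))))%C =
  (chi * (chi + 1) * CInt lb la 0 + chi * (chi + 1) * J - chi * (RtoC (al * (1 - al) / 2) * (q / RtoC al)))%C.
  by field; split; [move=> /RtoC_inj; lra | exact: freq_plus1_neq0].
rewrite e4 e7 e6 e5.
rewrite (_ : (- RtoC (ln al) * chi)%C = (- chi * RtoC la)%C); last by rewrite /la; ring.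
rewrite -/q.
have eh : (RtoC (1 / 2) + RtoC (1 / 2))%C = RtoC 1 by rewrite -RtoC_plus; congr RtoC; field.
move: (RtoC (1 / 2)) eh => h eh.
have hX X : X = (X + (h + h - RtoC 1) * q)%C by rewrite eh; ring.
by rewrite [RHS]hX; ring.
Qed.

Lemma CInt_profile :
  (RtoC L * CInt (fun u => RtoC (prof b al u) * Cexp (- chi * RtoC (L * u))) 0 1)%C =
  (CInt (fun v => RtoC (takagi b al (exp v)) * Cexp (- (chi + 1) * RtoC v)) la (la + L)
   - CInt (fun v => RtoC (exp v / (2 * (b - 1))) * Cexp (- chi * RtoC v)) la (la + L)
   - CInt (fun v => RtoC ((1 / 2 - al) * v / L) * Cexp (- chi * RtoC v)) la (la + L))%C.
Proof.
have [K [_ hK]] := prof_holder b al b_ge2 al_range.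
have hc := holder_cts _ K hK.
set h := fun v => (RtoC (prof b al (v / L)) * Cexp (- chi * RtoC v))%C.
have hcL : forall v, continuous (fun v : R => prof b al (v / L)) v.
  by apply: (cts_comp (fun v => v / L) (prof b al)) => //; rewrite /Rdiv; cts.
have hh : forall v, continuous h v by rewrite /h; ctsC.
have hg : forall u, continuous (fun u : R => RtoC (prof b al u) * Cexp (- chi * RtoC (L * u)))%C u by ctsC.
have hper u : (RtoC (prof b al (u + 1)) * Cexp (- chi * RtoC (L * (u + 1))))%C = (RtoC (prof b al u) * Cexp (- chi * RtoC (L * u)))%C.
  rewrite prof_periodic; congr (_ * _)%C.
  have -> : (- chi * RtoC (L * (u + 1)))%C = (- chi * RtoC (L * u) + - chi * RtoC (IZR 1 * L))%C.
    by rewrite (_ : L * (u + 1) = L * u + 1 * L) ?RtoC_plus; ring.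
  by rewrite Cexp_plus Cexp_freq_period Cmult_1_r.
(* The period is moved to start at la / L before substituting v = L u, so that the explicit formula
   for the profile holds throughout. *)
rewrite -(RInt_periodic C_R_CompleteNormedModule _ (la / L) hg hper) -CInt_mult //.
have -> : CInt (fun u => RtoC L * (RtoC (prof b al u) * Cexp (- chi * RtoC (L * u))))%C (la / L) (la / L + 1) = CInt h la (la + L).
  have e := CInt_lin h L 0 (la / L) (la / L + 1) hh.
  rewrite (_ : L * (la / L) + 0 = la) in e; last by field; lra.
  rewrite (_ : L * (la / L + 1) + 0 = la + L) in e; last by field; lra.
  rewrite -e; apply: CInt_eq => u; rewrite /h Rplus_0_r.
  by congr (_ * (RtoC (prof _ _ _) * _))%C; field; lra.
have hcT : forall v, continuous (fun v : R => takagi b al (exp v)) v.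
  by apply: (cts_comp exp (takagi b al)) => //; [exact: cts_exp | exact: cts_takagi].
have cA : forall v, continuous (fun v : R => RtoC (takagi b al (exp v)) * Cexp (- (chi + 1) * RtoC v))%C v by ctsC.
have cB : forall v, continuous (fun v : R => RtoC (exp v / (2 * (b - 1))) * Cexp (- chi * RtoC v))%C v by rewrite /Rdiv; ctsC.
have cD : forall v, continuous (fun v : R => RtoC ((1 / 2 - al) * v / L) * Cexp (- chi * RtoC v))%C v by rewrite /Rdiv; ctsC.
rewrite -!CInt_minus //; last by apply: ctsC_minus.
apply: (@RInt_ext C_R_CompleteNormedModule) => v; rewrite Rmin_left ?Rmax_right; try lra.
move=> hv; rewrite /h.
have ev : ln b * (v / L) = v by rewrite /L; field; move: L_pos; rewrite /L; lra.
rewrite prof_eq //; last first.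
  rewrite ev -(exp_ln b) -?exp_la -?exp_plus; try lra.
  left; rewrite -/L; apply: exp_increasing; lra.
rewrite /prof0 ev.
have e1 : Cexp (- (chi + 1) * RtoC v)%C = (RtoC (/ exp v) * Cexp (- chi * RtoC v))%C.
  by rewrite -exp_Ropp -Cexp_R -Cexp_plus RtoC_opp; congr Cexp; ring.
rewrite e1 (_ : (1 / 2 - al) * (v / L) = (1 / 2 - al) * v / L); last by rewrite /Rdiv; ring.
apply: C_eqI; rewrite !RtoC_minus /Rdiv (RtoC_mult (takagi _ _ _)).
by ring.
Qed.

Lemma profile_coefficient :
  CInt (fun u => RtoC (prof b al u) * Cexp (- chi * RtoC (L * u)))%C 0 1 =
  (zetaE al chi / (chi * (chi + 1) * RtoC L))%C.
Proof.
have hL : RtoC L <> RtoC 0 by move=> /RtoC_inj; lra.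
have h0 := freq_neq0; have h1 := freq_plus1_neq0; have h2 := freq_minus1_neq0.
have hal : RtoC al <> RtoC 0 by move=> /RtoC_inj; lra.
have h20 : RtoC 2 <> RtoC 0 by move=> /RtoC_inj; lra.
have e1 := CInt_profile.
rewrite CInt_quadratic_part CInt_linear_part in e1.
have e2 := CInf_gker; have e3 := gker_total.
set X := CInt _ 0 1 in e1 *; set A := CInt _ la (la + L) in e1 e2.
have e4 : (chi * (chi + 1) * A)%C = (chi * (chi + 1) * (CInt gker la 0 + CInf gker))%C by rewrite e2; ring.
have e5 : (chi * (chi + 1) * (RtoC L * X))%C = zetaE al chi.
  rewrite e1; transitivity (chi * (chi + 1) * A - chi * (chi + 1) * (RtoC al * q / (RtoC 2 * (1 - chi)))
     - chi * (chi + 1) * - (RtoC (1 / 2 - al) * q / chi))%C; first by ring.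
  rewrite e4 e3 RtoC_minus !RtoC_div ?RtoC_mult ?RtoC_minus; try lra.
  by field; repeat split.
by rewrite -e5; apply: C_solve.
Qed.

End ProfileCoefficients.

(** * The valuation as a sum of floors *)

Definition floor_sum (q M : nat) : nat := (\sum_(i < M) i %/ q)%N.

(** The integer nearest to q/3; it and [q - third_up q] are the integral counterparts of the shifts
    by 1/3 and 2/3. *)
Definition third_up (q : nat) : nat := ((q + 1) %/ 3)%N.

Lemma divn_lt2 (q x : nat) : (0 < q)%N -> (x < 2 * q)%N -> (x %/ q)%N = (q <= x)%N :> nat.
Proof.
move=> hq hx; case: (leqP q x) => h /=; last exact: divn_small.
by rewrite -(subnK h) addnC -{1}(mul1n q) divnMDl // divn_small ?addn0 //; lia.
Qed.

Lemma divn_lt3 (q x : nat) : (0 < q)%N -> (x < 3 * q)%N -> (x %/ q)%N = ((q <= x) + (2 * q <= x))%N :> nat.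
Proof.
move=> hq hx; case: (leqP (2 * q) x) => h.
  have h' : (q <= x)%N by lia.
  by rewrite h' -(subnK h) addnC divnMDl // divn_small ?addn0 //; lia.
by rewrite addn0; apply: divn_lt2.
Qed.

(* Hermite's identity for the floor of three times a number. *)
Lemma divn_triple (q N : nat) : (0 < q)%N ->
  ((3 * N + 1) %/ q = N %/ q + (N + third_up q) %/ q + (N + (q - third_up q)) %/ q)%N.
Proof.
move=> hq; rewrite (divn_eq N q); set u := (N %/ q)%N; set r := (N %% q)%N.
have hr : (r < q)%N by exact: ltn_pmod.
have -> : (3 * (u * q + r) + 1 = (3 * u) * q + (3 * r + 1))%N by lia.
have -> : (u * q + r + third_up q = u * q + (r + third_up q))%N by lia.
have -> : (u * q + r + (q - third_up q) = u * q + (r + (q - third_up q)))%N by lia.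
rewrite !divnMDl // (divn_small hr).
rewrite (divn_lt3 q (3 * r + 1)) ?(divn_lt2 q (r + third_up q)) ?(divn_lt2 q (r + (q - third_up q))) //; rewrite /third_up; lia.
Qed.

Lemma floor_sumS q M : floor_sum q M.+1 = (floor_sum q M + M %/ q)%N.
Proof. by rewrite /floor_sum big_ord_recr. Qed.

Lemma floor_sum_add q e N : (\sum_(j < N) (j + e) %/ q + floor_sum q e = floor_sum q (e + N))%N.
Proof.
elim: N => [|N IH]; first by rewrite big_ord0 addn0.
by rewrite big_ord_recr /= addnS floor_sumS -IH (addnC N e) addnAC.
Qed.

Lemma floor_sum_small q e : (e <= q)%N -> floor_sum q e = 0%N.
Proof.
by move=> he; apply: big1 => i _; apply: divn_small; have := ltn_ord i; lia.
Qed.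

(** Doubling and moving [q * u] to the left keep the quadratic count free of divisions and
    truncation. The range of r reaches [2 * q] because shifted remainders may overflow into the next
    block; the truncated [r - q] counts that overflow. *)
Lemma floor_sum_block q u r : (0 < q)%N -> (r <= 2 * q)%N ->
  (2 * floor_sum q (u * q + r) + q * u = q * u * u + 2 * u * r + 2 * (r - q))%N.
Proof.
move=> hq.
have hstep v : (2 * floor_sum q (v * q) + q * v = q * v * v)%N -> forall r, (r <= 2 * q)%N ->
    (2 * floor_sum q (v * q + r) + q * v = q * v * v + 2 * v * r + 2 * (r - q))%N.
  move=> h0; elim=> [|s IH] hs; first by rewrite addn0; lia.
  rewrite addnS floor_sumS divnMDl // (divn_lt2 q s) //.
  have {}IH := IH (ltnW hs).
  by case: (leqP q s) => h /=; lia.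
apply: (hstep u); elim: u => [|u IH]; first by rewrite mul0n floor_sum_small; lia.
(* A full block, r = q, is the same as increasing u by one. *)
by have := hstep u IH q ltac:(lia); rewrite (mulSn u q) (addnC q); nia.
Qed.

(** Behind the integrality of the quotient in [T]. In block form the quadratic and linear parts
    cancel, and what is left is [h5], an inequality between overflows. *)
Lemma floor_sum_double q N : (0 < q)%N ->
  (floor_sum q (2 * N) <= 2 * floor_sum q N + floor_sum q (N + third_up q) + floor_sum q (N + (q - third_up q)))%N.
Proof.
move=> hq; rewrite (divn_eq N q); set u := (N %/ q)%N; set r := (N %% q)%N.
have hr : (r < q)%N by exact: ltn_pmod.
have he : (third_up q <= q)%N by rewrite /third_up; lia.
set e := third_up q in he *.
have h1 := floor_sum_block q u r hq ltac:(lia).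
have h2 := floor_sum_block q u (r + e) hq ltac:(lia).
have h3 := floor_sum_block q u (r + (q - e)) hq ltac:(lia).
have h4 := floor_sum_block q (2 * u) (2 * r) hq ltac:(lia).
rewrite !addnA in h2 h3.
have e4 : (2 * (u * q + r) = 2 * u * q + 2 * r)%N by lia.
rewrite e4.
have h5 : (2 * r - q <= (r + e - q) + (r + (q - e) - q))%N by lia.
have h6 : (r - q = 0)%N by lia.
have h7 : (u * (q - e) + u * e = u * q)%N by rewrite -mulnDr subnK.
rewrite h6 in h1; move: h5 h7 h1 h2 h3 h4.
move: (q - e)%N (floor_sum q _) (floor_sum q _) (floor_sum q _) (floor_sum q _) => d F4 F1 F2 F3.
move: (2 * r - q)%N (r + e - q)%N (r + d - q)%N => a1 a2 a3 h5 h7 h1 h2 h3 h4.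
lia.
Qed.

Definition asm_num (q N : nat) : nat := (\sum_(j < N) (3 * j + 1) %/ q)%N.
Definition asm_den (q N : nat) : nat := (\sum_(j < N) (N + j) %/ q)%N.

Lemma asm_numE q N : (0 < q)%N ->
  asm_num q N = (floor_sum q N + floor_sum q (N + third_up q) + floor_sum q (N + (q - third_up q)))%N.
Proof.
move=> hq; rewrite /asm_num.
rewrite (eq_bigr (fun j : 'I_N => (j %/ q + (j + third_up q) %/ q + (j + (q - third_up q)) %/ q)%N)); last first.
  by move=> j _; exact: divn_triple.
rewrite !big_split /= -/(floor_sum q N).
have he : (third_up q <= q)%N by rewrite /third_up; lia.
have := floor_sum_add q (third_up q) N; rewrite floor_sum_small // addn0 (addnC _ N) => ->.
have := floor_sum_add q (q - third_up q) N; rewrite (floor_sum_small q (q - third_up q)) ?leq_subr //.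
by rewrite addn0 (addnC _ N) => ->.
Qed.

Lemma asm_denE q N : (asm_den q N + floor_sum q N = floor_sum q (2 * N))%N.
Proof.
rewrite /asm_den mul2n -addnn -floor_sum_add; congr (_ + _)%N.
by apply: eq_bigr => j _; rewrite addnC.
Qed.

Lemma asm_den_le_num q N : (0 < q)%N -> (asm_den q N <= asm_num q N)%N.
Proof.
move=> hq; rewrite asm_numE //; have := asm_denE q N; have := floor_sum_double q N hq; lia.
Qed.

(** Legendre's formula with a cutoff common to all factorials, so that the sums over factors and
    over powers can be exchanged. *)
Lemma logn_fact_bound p n M : prime p -> (n < M)%N -> logn p n`! = (\sum_(1 <= k < M) n %/ p ^ k)%N.
Proof.
move=> hp hn; rewrite logn_fact // (@big_cat_nat _ _ _ n.+1 1 M) //=.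
rewrite [X in (_ + X)%N]big1_seq ?addn0 // => k; rewrite mem_index_iota => /andP [_ /andP [hk _]].
apply: divn_small; apply: leq_trans (ltn_expl k (prime_gt1 hp)); exact: ltnW.
Qed.

Lemma logn_prod_fact p (f : nat -> nat) N M : prime p -> (forall j, (j < N)%N -> (f j < M)%N) ->
  logn p (\prod_(j < N) (f j)`!) = (\sum_(1 <= k < M) \sum_(j < N) f j %/ p ^ k)%N.
Proof.
move=> hp; elim: N => [|N IH] hM.
  by rewrite big_ord0 logn1 big1 // => k _; rewrite big_ord0.
rewrite big_ord_recr /= lognM ?fact_gt0 //; last by apply: prodn_gt0 => j; exact: fact_gt0.
rewrite IH => [|j hj]; last by apply: hM; lia.
rewrite (logn_fact_bound p (f N) M hp (hM N (ltnSn N))) -big_split /=.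
by apply: eq_bigr => k _; rewrite big_ord_recr.
Qed.

Lemma logn_asm_num p N M : prime p -> (3 * N < M)%N ->
  logn p (\prod_(j < N) (3 * j + 1)`!) = (\sum_(1 <= k < M) asm_num (p ^ k) N)%N.
Proof. by move=> hp hM; apply: (logn_prod_fact p (fun j => 3 * j + 1)%N) => // j hj; lia. Qed.

Lemma logn_asm_den p N M : prime p -> (3 * N < M)%N ->
  logn p (\prod_(j < N) (N + j)`!) = (\sum_(1 <= k < M) asm_den (p ^ k) N)%N.
Proof. by move=> hp hM; apply: (logn_prod_fact p (fun j => N + j)%N) => // j hj; lia. Qed.

Lemma prod_fact_gt0 (f : nat -> nat) N : (0 < \prod_(j < N) (f j)`!)%N.
Proof. by apply: prodn_gt0 => j; exact: fact_gt0. Qed.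

(** Divisibility is tested prime by prime, and there power by power with [asm_den_le_num], which
    holds for every positive q. *)
Lemma asm_dvd N : (\prod_(j < N) (N + j)`! %| \prod_(j < N) (3 * j + 1)`!)%N.
Proof.
apply/dvdn_partP; first exact: (prod_fact_gt0 (fun j => N + j)%N).
move=> p hp; have hpr : prime p by move: hp; rewrite mem_primes => /andP [].
rewrite p_part pfactor_dvdn //; last exact: (prod_fact_gt0 (fun j => 3 * j + 1)%N).
rewrite (logn_asm_den p N (3 * N).+1 hpr) // (logn_asm_num p N (3 * N).+1 hpr) //.
apply: leq_sum => k _; apply: asm_den_le_num.
by rewrite expn_gt0 prime_gt0.
Qed.

Lemma logn_T p N M : prime p -> (3 * N < M)%N ->
  (logn p (T N) + \sum_(1 <= k < M) asm_den (p ^ k) N = \sum_(1 <= k < M) asm_num (p ^ k) N)%N.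
Proof.
move=> hp hM; rewrite /T logn_div ?asm_dvd // -logn_asm_den // -logn_asm_num //.
by apply: subnK; apply: dvdn_leq_log; [exact: (prod_fact_gt0 (fun j => 3 * j + 1)%N) | exact: asm_dvd].
Qed.

(** * Floor sums as values of ramps *)

Lemma INR_addn m n : INR (m + n)%N = INR m + INR n.
Proof. exact: plus_INR. Qed.

Lemma INR_muln m n : INR (m * n)%N = INR m * INR n.
Proof. exact: mult_INR. Qed.

(** The squares in the quadratic part and in [saw] cancel: between consecutive points congruent to
    [al] the ramp is affine with integer slope. *)
Lemma ramp_linear al (n : Z) y : IZR n <= y - al <= IZR n + 1 ->
  ramp al y = (IZR n + 1) * y - (IZR n + 1) * al - IZR n * (IZR n + 1) / 2 + al * (1 - al) / 2 - bump al.
Proof. by move=> h; rewrite /ramp /saw (bump_shift_unit n) //; field. Qed.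

Lemma ramp_zero al y : 0 < al <= 1 -> al - 1 <= y <= al -> ramp al y = 0.
Proof.
move=> hal hy; rewrite (ramp_linear al (-1)); last lra.
by rewrite bump_unit; [field | lra].
Qed.

Lemma INR_divn_bounds (q w : nat) : (0 < q)%N ->
  INR (w %/ q) <= INR w / INR q /\ (INR w + 1) / INR q <= INR (w %/ q) + 1.
Proof.
move=> hq; have hq0 : 0 < INR q by apply: lt_0_INR; apply/ltP.
have h1 : INR (w %/ q) * INR q <= INR w.
  by rewrite -INR_muln; apply: le_INR; apply/leP; exact: leq_divM.
have h2 : INR w + 1 <= (INR (w %/ q) + 1) * INR q.
  rewrite -S_INR -S_INR -INR_muln; apply: le_INR; apply/leP.
  exact: ltn_ceil.
split; apply: (Rmult_le_reg_r (INR q)) => //; rewrite /Rdiv Rmult_assoc Rinv_l ?Rmult_1_r; lra.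
Qed.

(** Kinks correspond to multiples of q among the w, so a step of 1/q stays inside one affine piece,
    and the slope of that piece is the floor of w/q. *)
Lemma ramp_step (q w : nat) al y : (0 < q)%N -> y = INR w / INR q + al - 1 ->
  INR q * ramp al (y + / INR q) = INR q * ramp al y + INR (w %/ q).
Proof.
move=> hq hy; have hq0 : 0 < INR q by apply: lt_0_INR; apply/ltP.
have [h1 h2] := INR_divn_bounds q w hq.
have hi : 0 < / INR q by exact: Rinv_0_lt_compat.
have e : IZR (Z.of_nat (w %/ q) - 1) = INR (w %/ q) - 1 by rewrite minus_IZR -INR_IZR_INZ.
have h3 : (INR w + 1) / INR q = INR w / INR q + / INR q by field; lra.
rewrite (ramp_linear al (Z.of_nat (w %/ q) - 1) y); last by rewrite e; lra.
rewrite (ramp_linear al (Z.of_nat (w %/ q) - 1) (y + / INR q)); last by rewrite e; lra.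
by rewrite e; field; lra.
Qed.

Lemma floor_sum_ramp (q M : nat) : (0 < q)%N -> INR (floor_sum q M) = INR q * ramp 1 (INR M / INR q).
Proof.
move=> hq; have hq0 : 0 < INR q by apply: lt_0_INR; apply/ltP.
elim: M => [|M IH].
  by rewrite /floor_sum big_ord0 /= /Rdiv Rmult_0_l ramp_zero; lra.
rewrite floor_sumS INR_addn IH -(ramp_step q M 1) //; last by ring.
by rewrite S_INR; congr (_ * ramp _ _); field; lra.
Qed.

(** Raising N by one adds the three floors of [divn_triple], one for each ramp. For [ramp_step] the
    number N + 1/3 + q (1 - al) must be an integer, and the class of q modulo 3 decides which of 1/3
    and 2/3 achieves this. *)
Lemma asm_num_ramp (q N : nat) al : (0 < q)%N ->
  (al = 1 / 3 /\ (q = 1 %[mod 3])%N) \/ (al = 2 / 3 /\ (q = 2 %[mod 3])%N) ->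
  INR (asm_num q N) =
  INR q * (ramp 1 (INR N / INR q) + ramp al ((INR N + 1 / 3) / INR q) + ramp (1 - al) ((INR N - 1 / 3) / INR q)).
Proof.
move=> hq hal; have hq0 : 0 < INR q by apply: lt_0_INR; apply/ltP.
have hq1 : 1 <= INR q by apply: (le_INR 1); exact/leP.
have hiq : 0 < / INR q <= 1.
  by split; [exact: Rinv_0_lt_compat | rewrite -Rinv_1; apply: Rinv_le_contravar; lra].
have hal01 : 1 / 3 <= al <= 2 / 3 by case: hal => -[-> _]; lra.
elim: N => [|N IH].
  by rewrite /asm_num big_ord0 [INR 0]/= {2 3 4}/Rdiv !ramp_zero; lra.
have eN : INR N.+1 / INR q = INR N / INR q + / INR q by rewrite S_INR; field; lra.
have e1 : (INR N.+1 + 1 / 3) / INR q = (INR N + 1 / 3) / INR q + / INR q by rewrite S_INR; field; lra.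
have e2 : (INR N.+1 - 1 / 3) / INR q = (INR N - 1 / 3) / INR q + / INR q by rewrite S_INR; field; lra.
have -> : asm_num q N.+1 = (asm_num q N + (3 * N + 1) %/ q)%N by rewrite /asm_num big_ord_recr.
rewrite divn_triple // !INR_addn IH eN e1 e2.
have s0 := ramp_step q N 1 (INR N / INR q) hq ltac:(ring).
set e := third_up q; set f := (q - e)%N.
have hef : exists t : nat, (al = 1 / 3 /\ INR q = 3 * INR t + 1 /\ INR e = INR t /\ INR f = 2 * INR t + 1) \/
    (al = 2 / 3 /\ INR q = 3 * INR t + 2 /\ INR e = INR t + 1 /\ INR f = 2 * INR t + 1).
  exists (q %/ 3)%N; case: hal => -[ea hm]; [left | right]; split=> //.
  - have h1 : (q = 3 * (q %/ 3) + 1)%N by lia.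
    have h2 : (e = q %/ 3)%N by rewrite /e /third_up; lia.
    have h3 : (f = 2 * (q %/ 3) + 1)%N by rewrite /f h2; lia.
    have := f_equal INR h1; rewrite INR_addn (INR_muln 3) /= => a1.
    have := f_equal INR h2 => a2.
    have := f_equal INR h3; rewrite INR_addn (INR_muln 2) /= => a3.
    by split; [lra | split; lra].
  - have h1 : (q = 3 * (q %/ 3) + 2)%N by lia.
    have h2 : (e = q %/ 3 + 1)%N by rewrite /e /third_up; lia.
    have h3 : (f = 2 * (q %/ 3) + 1)%N by rewrite /f h2; lia.
    have := f_equal INR h1; rewrite INR_addn (INR_muln 3) /= => a1.
    have := f_equal INR h2; rewrite INR_addn /= => a2.
    have := f_equal INR h3; rewrite INR_addn (INR_muln 2) /= => a3.
    by split; [lra | split; lra].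
have [t ht] := hef.
case: ht => -[ea [eq [ee ef]]].
- have s1 := ramp_step q (N + f) al ((INR N + 1 / 3) / INR q) hq
    ltac:(rewrite INR_addn ef ea eq; field; rewrite -eq; lra).
  have s2 := ramp_step q (N + e) (1 - al) ((INR N - 1 / 3) / INR q) hq
    ltac:(rewrite INR_addn ee ea eq; field; rewrite -eq; lra).
  lra.
- have s1 := ramp_step q (N + e) al ((INR N + 1 / 3) / INR q) hq
    ltac:(rewrite INR_addn ee ea eq; field; rewrite -eq; lra).
  have s2 := ramp_step q (N + f) (1 - al) ((INR N - 1 / 3) / INR q) hq
    ltac:(rewrite INR_addn ef ea eq; field; rewrite -eq; lra).
  lra.
Qed.

Lemma asm_den_ramp (q N : nat) : (0 < q)%N ->
  INR (asm_den q N) = INR q * (ramp 1 (2 * INR N / INR q) - ramp 1 (INR N / INR q)).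
Proof.
move=> hq; have := asm_denE q N => /(f_equal INR); rewrite INR_addn !floor_sum_ramp // (_ : INR (2 * N) = 2 * INR N); [lra | by rewrite INR_muln].
Qed.

Lemma sum_nat_psum (F : nat -> nat) M : INR (\sum_(1 <= k < M.+1) F k)%N = psum (fun i => INR (F (S i))) M.
Proof.
elim: M => [|M IH]; first by rewrite big_nil.
by rewrite big_nat_recr //= INR_addn IH.
Qed.

Lemma psum_pairs u n : psum u (2 * n)%N = psum (fun i => u (2 * i)%N + u (2 * i).+1) n.
Proof.
elim: n => [|n IH]; first by rewrite muln0.
have -> : (2 * n.+1 = (2 * n).+2)%N by lia.
by rewrite /= IH; ring.
Qed.

(** * The series for Phi and the psi_j *)

Definition nz_sums (a : Z -> C) (s : C) : Prop :=
  [/\ abs_summable_nz a, is_series (fun n => Re (nzpair Cplus a n)) (Re s) &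
      is_series (fun n => Im (nzpair Cplus a n)) (Im s)].

Lemma nz_sums_sum a s : nz_sums a s -> sum_nz a = s.
Proof.
move=> [_ h1 h2]; rewrite /sum_nz (is_series_unique _ _ h1) (is_series_unique _ _ h2).
by case: s {h1 h2}.
Qed.

Lemma nzpair_ext (V : Type) (add : V -> V -> V) (a b : Z -> V) n :
  (forall k, k <> 0%Z -> a k = b k) -> nzpair add a n = nzpair add b n.
Proof. by move=> h; rewrite /nzpair !h //; lia. Qed.

Lemma nz_sums_ext a b s : (forall k, k <> 0%Z -> a k = b k) -> nz_sums a s -> nz_sums b s.
Proof.
move=> h [h1 h2 h3]; split.
- apply: (ex_series_ext (K := R_AbsRing) (V := R_NormedModule)) h1 => n.
  by apply: nzpair_ext => k hk; rewrite h.
- by apply: is_series_ext h2 => n; rewrite (nzpair_ext _ _ a b).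
- by apply: is_series_ext h3 => n; rewrite (nzpair_ext _ _ a b).
Qed.

Lemma abs_summable_le a (e : nat -> R) :
  (forall n, Cmod (a (Z.of_nat (S n))) + Cmod (a (- Z.of_nat (S n))%Z) <= e n) -> ex_series e -> abs_summable_nz a.
Proof.
move=> h he; apply: (ex_series_le (K := R_AbsRing) (V := R_CompleteNormedModule) _ e) => // n.
rewrite /norm /= /abs /= /nzpair Rabs_pos_eq; first exact: h.
by apply: Rplus_le_le_0_compat; exact: Cmod_ge_0.
Qed.

Lemma nz_sums_plus a b s t : nz_sums a s -> nz_sums b t -> nz_sums (fun k => a k + b k)%C (s + t)%C.
Proof.
move=> [a1 a2 a3] [b1 b2 b3]; split.
- apply: (abs_summable_le _ (fun n => nzpair Rplus (fun k => Cmod (a k)) n + nzpair Rplus (fun k => Cmod (b k)) n)).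
    move=> n; rewrite /nzpair.
    have := Cmod_triangle (a (Z.of_nat (S n))) (b (Z.of_nat (S n))).
    by have := Cmod_triangle (a (- Z.of_nat (S n))%Z) (b (- Z.of_nat (S n))%Z); lra.
  exact: (ex_series_plus (K := R_AbsRing) (V := R_NormedModule)).
- have := is_series_plus _ _ _ _ a2 b2; apply: is_series_ext => n.
  by rewrite /nzpair /plus /Re /=; ring.
- have := is_series_plus _ _ _ _ a3 b3; apply: is_series_ext => n.
  by rewrite /nzpair /plus /Im /=; ring.
Qed.

Lemma nz_sums_scal c a s : nz_sums a s -> nz_sums (fun k => c * a k)%C (c * s)%C.
Proof.
move=> [a1 a2 a3]; split.
- apply: (abs_summable_le _ (fun n => Cmod c * nzpair Rplus (fun k => Cmod (a k)) n)).
    by move=> n; rewrite !Cmod_mult /nzpair; right; ring.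
  exact: (ex_series_scal_l (Cmod c) _ a1).
- have := is_series_minus _ _ _ _ (is_series_scal_l (fst c) _ _ a2) (is_series_scal_l (snd c) _ _ a3).
  apply: is_series_ext => n; rewrite /nzpair /minus /plus /opp /scal /= /mult /Re /Im /=; ring.
- have := is_series_plus _ _ _ _ (is_series_scal_l (fst c) _ _ a3) (is_series_scal_l (snd c) _ _ a2).
  apply: is_series_ext => n; rewrite /nzpair /plus /scal /= /mult /Re /Im /=; ring.
Qed.

(** * Fourier series of a profile *)

Definition pcoef (b al : R) (k : Z) : C := (zetaE al (freq b k) / (freq b k * (freq b k + 1) * RtoC (ln b)))%C.

Lemma tcos_opp k x : tcos (- k) x = tcos k x.
Proof. by rewrite /tcos opp_IZR -cos_neg; congr cos; ring. Qed.

Lemma tsin_opp k x : tsin (- k) x = - tsin k x.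
Proof. by rewrite /tsin opp_IZR -sin_neg; congr sin; ring. Qed.

Definition wave (k : Z) (x : R) : C := Cexp (RtoC (2 * IZR k * PI * x) * Defs.Ci)%C.

Lemma waveE k x : wave k x = (tcos k x, tsin k x).
Proof.
have e : (RtoC (2 * IZR k * PI * x) * Defs.Ci)%C = (0, 2 * PI * IZR k * x).
  by apply: C_ext; rewrite /Defs.Ci /=; ring.
by rewrite /wave e; apply: C_ext; rewrite /Cexp /tcos /tsin /= exp_0; ring.
Qed.

Lemma waveD k x y : wave k (x + y) = (wave k x * wave k y)%C.
Proof. by rewrite /wave -Cexp_plus Rmult_plus_distr_l RtoC_plus; congr Cexp; ring. Qed.

Lemma wave_freq b k x : 2 <= b -> Cexp (- freq b k * RtoC (ln b * x))%C = (tcos k x, - tsin k x).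
Proof.
move=> hb; have hl := ln_b_pos b hb.
have e : (- freq b k * RtoC (ln b * x))%C = (0, - (2 * PI * IZR k * x)).
  by apply: C_ext => /=; [ring | field; lra].
by rewrite e; apply: C_ext; rewrite /Cexp /tcos /tsin /= exp_0 ?cos_neg ?sin_neg; ring.
Qed.

Section ProfileSeries.

Variables b al : R.
Hypothesis b_ge2 : 2 <= b.
Hypothesis al_range : 1 / 3 <= al <= 1.

Let f := prof b al.

Lemma cts_prof : forall x, continuous f x.
Proof. by have [K [_ hK]] := prof_holder b al b_ge2 al_range; exact: (holder_cts _ K hK). Qed.

Lemma pcoef_parts k : k <> 0%Z -> pcoef b al k = (fcos f k, - fsin f k).
Proof.
move=> hk; rewrite /pcoef -(profile_coefficient b al b_ge2 al_range k hk).
have hc := cts_prof.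
have hg : forall u, continuous (fun u : R => RtoC (prof b al u) * Cexp (- freq b k * RtoC (ln b * u)))%C u.
  apply: ctsC_mult; first exact: ctsC_RtoC.
  apply: ctsC_Cexp; apply: ctsC_mult; first exact: ctsC_const.
  by apply: ctsC_RtoC; cts.
apply: C_ext.
  rewrite CInt_fst //; apply: RInt_eq => u; rewrite wave_freq //=.
  by rewrite /f; ring.
rewrite CInt_snd //; transitivity (-1 * fsin f k); last by rewrite /=; ring.
rewrite /fsin -RIntZ.
  by apply: RInt_eq => u; rewrite wave_freq //= /f; ring.
by have h := cts_tsin k; cts.
Qed.

(** The terms k and - k are conjugate, so each pair is the real harmonic of [fourier_inversion];
    leaving out k = 0 removes the mean. *)
Lemma prof_sums x : nz_sums (fun k => pcoef b al k * wave k x)%C (RtoC (prof b al x - fcos f 0)).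
Proof.
have [K [_ hK]] := prof_holder b al b_ge2 al_range.
have hper u : f (u + 1) = f u by exact: prof_periodic.
apply: (nz_sums_ext (fun k => (fcos f k, (- fsin f k)%R) * wave k x)%C); first by move=> k hk; rewrite pcoef_parts.
have hs : forall n : nat, (Z.of_nat (S n)) = zk n by [].
split.
- apply: (abs_summable_le _ (fun n => 2 * (Rabs (fcos f (zk n)) + Rabs (fsin f (zk n))))).
    move=> n; rewrite !Cmod_mult /wave !Cmod_Cexp !hs.
    have h0 k : Re (RtoC (2 * IZR k * PI * x) * Defs.Ci)%C = 0 by rewrite /Re /=; ring.
    rewrite !h0 exp_0 !Rmult_1_r fcos_opp fsin_opp; last exact: cts_prof.
    have := Cmod_le_parts (fcos f (zk n), - fsin f (zk n)).
    have := Cmod_le_parts (fcos f (zk n), - - fsin f (zk n)); rewrite /= !Rabs_Ropp; lra.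
  exact: (ex_series_scal_l 2 _ (fourier_summable f K hper hK)).
- apply: is_series_ext (fourier_inversion f K hper hK x) => n.
  rewrite /nzpair !waveE !hs fcos_opp fsin_opp; last exact: cts_prof.
  by rewrite tcos_opp tsin_opp /Re /=; ring.
- apply: (is_series_ext (fun _ => 0)); last first.
    by apply/is_series_psum; apply: (is_lim_seq_ext (fun _ => 0)); [elim => [|n IH] //=; lra | exact: is_lim_seq_const].
  move=> n; rewrite /nzpair !waveE !hs fcos_opp fsin_opp; last exact: cts_prof.
  by rewrite tcos_opp tsin_opp /Im /=; ring.
Qed.

End ProfileSeries.

(** * The coefficients and sums of the theorem in terms of profiles *)

Lemma hurwitz_zeta_eq a al (n : Z) s : Im s <> 0 -> IZR n + a = al -> 0 < al <= 1 -> hurwitz_zeta s a = zetaE al s.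
Proof.
move=> hs ha hal; rewrite hurwitz_zetaE // -(tech_up (- a) n) ?ha //; lra.
Qed.

Lemma Im_freq_neq0 b k : 2 <= b -> k <> 0%Z -> Im (freq b k) <> 0.
Proof.
move=> hb hk; have hl := ln_b_pos b hb; rewrite /Im /freq /=.
apply: Rmult_integral_contrapositive_currified; first exact: two_pi_k_neq0.
by apply: Rinv_neq_0_compat; lra.
Qed.

Lemma Rcpow_freq b k x : 2 <= b -> Rcpow x (freq b k) = wave k (ln x / ln b).
Proof.
move=> hb; have hl := ln_b_pos b hb; rewrite /Rcpow /wave; congr Cexp.
by apply: C_ext; rewrite /Defs.Ci /freq /=; [ring | field; lra].
Qed.

Lemma wave_half k : wave k (1 / 2) = sgnpow k.
Proof.
rewrite waveE /tcos /tsin /sgnpow.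
have -> : 2 * PI * IZR k * (1 / 2) = PI * IZR k by field.
case he : (Z.even k).
  have /Z.even_spec [m ->] := he.
  have -> : PI * IZR (2 * m) = 0 + 2 * PI * IZR m by rewrite mult_IZR; ring.
  by rewrite cos_shift_Z sin_shift_Z cos_0 sin_0.
have /Z.odd_spec [m ->] : Z.odd k by rewrite -Z.negb_even he.
have -> : PI * IZR (2 * m + 1) = PI + 2 * PI * IZR m by rewrite plus_IZR mult_IZR; ring.
by rewrite cos_shift_Z sin_shift_Z cos_PI sin_PI.
Qed.

Section Assembly.

Variable p : nat.
Hypothesis p_ge2 : (2 <= p)%N.

Local Notation P := (INR p).
Local Notation B := (INR p * INR p).

Let P_ge2 : 2 <= P.
Proof. by apply: (le_INR 2); exact/leP. Qed.

Let B_ge2 : 2 <= B.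
Proof. by have := P_ge2; nra. Qed.

Let lnP_pos : 0 < ln P.
Proof. exact: ln_b_pos. Qed.

Let lnB : ln B = 2 * ln P.
Proof. by rewrite ln_mult; have := P_ge2; lra. Qed.

Let third : 1 / 3 <= 1 / 3 <= 1. Proof. lra. Qed.
Let two_thirds : 1 / 3 <= 2 / 3 <= 1. Proof. lra. Qed.
Let one_range : 1 / 3 <= 1 <= 1. Proof. lra. Qed.

Lemma chi_freq k : chi p k = freq P k.
Proof.
by apply: C_ext; rewrite /chi /freq /Defs.Ci /=; [ring | field; have := lnP_pos; lra].
Qed.

Lemma chi_half_freq k : chi_half p k = freq B k.
Proof.
have h := lnP_pos; apply: C_ext; rewrite /chi_half /freq /Defs.Ci lnB /=; [ring | field; lra].
Qed.

Lemma riemann_zeta_freq k : k <> 0%Z -> riemann_zeta (freq P k) = zetaE 1 (freq P k).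
Proof.
move=> hk; apply: (hurwitz_zeta_eq 1 1 0); try lra.
exact: Im_freq_neq0.
Qed.

Lemma RtoC_lnP_neq0 : RtoC (ln P) <> RtoC 0.
Proof. by move=> /RtoC_inj; have := lnP_pos; lra. Qed.

(** The powers of 2 and 3 at [chi] are values of [wave k], so multiplying a coefficient by them
    translates the profile by log_p 2 and log_p 3. *)
Lemma c_coef_eq k : k <> 0%Z ->
  c_coef p k = (pcoef P 1 k + RtoC (-2) * (pcoef P 1 k * wave k (ln 2 / ln P)) + pcoef P 1 k * wave k (ln 3 / ln P))%C.
Proof.
move=> hk; rewrite /c_coef chi_freq riemann_zeta_freq // Rcpow_freq //.
have -> : Rcpow 2 (1 + freq P k) = (RtoC 2 * wave k (ln 2 / ln P))%C.
  rewrite -Rcpow_freq // /Rcpow Cmult_plus_distr_r Cmult_1_l Cexp_plus Cexp_R exp_ln //; lra.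
have h0 := freq_neq0 P P_ge2 k hk; have h1 := freq_plus1_neq0 P k; have h2 := RtoC_lnP_neq0.
have -> : RtoC (-2) = (- RtoC 2)%C by apply: C_ext => /=; ring.
rewrite /pcoef; field; repeat split => //.
Qed.

Lemma Phi_sums x : nz_sums (Phi_term p x)
  (RtoC (prof P 1 x - 2 * prof P 1 (x + ln 2 / ln P) + prof P 1 (x + ln 3 / ln P))).
Proof.
have h1 := prof_sums P 1 P_ge2 one_range x.
have h2 := prof_sums P 1 P_ge2 one_range (x + ln 2 / ln P).
have h3 := prof_sums P 1 P_ge2 one_range (x + ln 3 / ln P).
have := nz_sums_plus _ _ _ _ (nz_sums_plus _ _ _ _ h1 (nz_sums_scal (RtoC (-2)) _ _ h2)) h3.
set s := (_ + _)%C => h.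
have -> : RtoC (prof P 1 x - 2 * prof P 1 (x + ln 2 / ln P) + prof P 1 (x + ln 3 / ln P)) = s.
  by rewrite /s -RtoC_mult -!RtoC_plus; congr RtoC; ring.
apply: nz_sums_ext h => k hk.
rewrite /Phi_term c_coef_eq // !waveD -/(wave k x); ring.
Qed.

Definition dev (al x : R) : R := prof B al x - fcos (prof B al) 0.

(** The sign (-1)^k of the second zeta value is [wave k (1 / 2)], that is, a translation by half a
    period of the profile in base p^2. *)
Definition psiR (al x : R) : R := dev al (x / 2) + dev (1 - al) (x / 2 + 1 / 2).

Lemma d_coef_pm_eq k (j : Z) al : k <> 0%Z ->
  (j = 1%Z /\ al = 1 / 3) \/ (j = (-1)%Z /\ al = 2 / 3) ->
  d_coef_pm p k j = (pcoef B al k + sgnpow k * pcoef B (1 - al) k)%C.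
Proof.
move=> hk hj; rewrite /d_coef_pm chi_half_freq.
have hi := Im_freq_neq0 B k B_ge2 hk.
have h0 := freq_neq0 B B_ge2 k hk; have h1 := freq_plus1_neq0 B k; have h2 := RtoC_lnP_neq0.
have h20 : RtoC 2 <> RtoC 0 by move=> /RtoC_inj; lra.
have e1 : hurwitz_zeta (freq B k) (IZR j / 3) = zetaE al (freq B k).
  by case: hj => -[-> ->]; [apply: (hurwitz_zeta_eq _ _ 0) | apply: (hurwitz_zeta_eq _ _ 1)] => //; lra.
have e2 : hurwitz_zeta (freq B k) (- IZR j / 3) = zetaE (1 - al) (freq B k).
  by case: hj => -[-> ->]; [apply: (hurwitz_zeta_eq _ _ 1) | apply: (hurwitz_zeta_eq _ _ 0)] => //; lra.
rewrite e1 e2 /pcoef lnB RtoC_mult; field; repeat split => //.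
Qed.

Lemma psi_sums_pm j al x : (j = 1%Z /\ al = 1 / 3) \/ (j = (-1)%Z /\ al = 2 / 3) ->
  nz_sums (psi_term p j x) (RtoC (psiR al x)).
Proof.
move=> hj.
have a1 : 1 / 3 <= al <= 1 by case: hj => -[_ ->]; lra.
have a2 : 1 / 3 <= 1 - al <= 1 by case: hj => -[_ ->]; lra.
have h1 := prof_sums B al B_ge2 a1 (x / 2).
have h2 := prof_sums B (1 - al) B_ge2 a2 (x / 2 + 1 / 2).
have := nz_sums_plus _ _ _ _ h1 h2; rewrite -RtoC_plus -/(dev al _) -/(dev (1 - al) _) -/(psiR al x).
apply: nz_sums_ext => k hk.
have -> : psi_term p j x k = (d_coef_pm p k j * wave k (x / 2))%C.
  rewrite /psi_term /d_coef; case: Z.eqb_spec => [e|_]; first by case: hj => -[e' _]; lia.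
  by rewrite /wave; congr (_ * Cexp (RtoC _ * _))%C; field.
by rewrite (d_coef_pm_eq k j al) // waveD wave_half; ring.
Qed.

Lemma psi_sums_0 x : nz_sums (psi_term p 0 x) (RtoC (psiR (1 / 3) x + psiR (2 / 3) x)).
Proof.
have h1 := psi_sums_pm 1 (1 / 3) x (or_introl (conj erefl erefl)).
have h2 := psi_sums_pm (-1) (2 / 3) x (or_intror (conj erefl erefl)).
have := nz_sums_plus _ _ _ _ h1 h2; rewrite -RtoC_plus; apply: nz_sums_ext => k hk.
by rewrite /psi_term /d_coef /=; ring.
Qed.

Definition psi_val (j : Z) (x : R) : R :=
  if Z.eqb j 0 then psiR (1 / 3) x + psiR (2 / 3) x else if Z.eqb j 1 then psiR (1 / 3) x else psiR (2 / 3) x.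

Lemma psi_sums j x : (-1 <= j <= 1)%Z -> nz_sums (psi_term p j x) (RtoC (psi_val j x)).
Proof.
move=> hj; rewrite /psi_val; have [->|[->|->]] : j = 0%Z \/ j = 1%Z \/ j = (-1)%Z by lia.
- exact: psi_sums_0.
- by apply: psi_sums_pm; left.
- by apply: psi_sums_pm; right.
Qed.

Lemma PhiE x : Phi p x = RtoC (prof P 1 x - 2 * prof P 1 (x + ln 2 / ln P) + prof P 1 (x + ln 3 / ln P)).
Proof. exact: nz_sums_sum (Phi_sums x). Qed.

Lemma psiE j x : (-1 <= j <= 1)%Z -> psi p j x = RtoC (psi_val j x).
Proof. by move=> hj; exact: nz_sums_sum (psi_sums j x hj). Qed.

Lemma psiR_periodic al x : psiR al (x + 2) = psiR al x.
Proof.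
rewrite /psiR /dev (_ : (x + 2) / 2 = x / 2 + 1); last by field.
rewrite (_ : x / 2 + 1 + 1 / 2 = x / 2 + 1 / 2 + 1); last by field.
by rewrite !prof_periodic.
Qed.

Lemma psi_val_periodic j x : psi_val j (x + 2) = psi_val j x.
Proof. by rewrite /psi_val !psiR_periodic. Qed.

Lemma psiR_holder al : 1 / 3 <= al <= 2 / 3 ->
  exists K, 0 <= K /\ forall x y, Rabs (psiR al x - psiR al y) <= K * pow34 (Rabs (x - y)).
Proof.
move=> hal.
have [K [hK h]] := prof_holder B al B_ge2 ltac:(lra).
have [K' [hK' h']] := prof_holder B (1 - al) B_ge2 ltac:(lra).
exists (K + K'); split=> [|x y]; first lra.
rewrite /psiR /dev.
have -> : prof B al (x / 2) - fcos (prof B al) 0 + (prof B (1 - al) (x / 2 + 1 / 2) - fcos (prof B (1 - al)) 0)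
  - (prof B al (y / 2) - fcos (prof B al) 0 + (prof B (1 - al) (y / 2 + 1 / 2) - fcos (prof B (1 - al)) 0))
  = (prof B al (x / 2) - prof B al (y / 2)) + (prof B (1 - al) (x / 2 + 1 / 2) - prof B (1 - al) (y / 2 + 1 / 2)) by ring.
apply: Rle_trans (Rabs_triang _ _) _; rewrite Rmult_plus_distr_r.
have hle : pow34 (Rabs (x - y) / 2) <= pow34 (Rabs (x - y)).
  by apply: pow34_le; have := Rabs_pos (x - y); lra.
have e1 : Rabs (x / 2 - y / 2) = Rabs (x - y) / 2.
  by rewrite (_ : x / 2 - y / 2 = (x - y) * / 2) ?Rabs_mult ?(Rabs_pos_eq (/ 2)); [| lra | field].
have h1 := h (x / 2) (y / 2); have h2 := h' (x / 2 + 1 / 2) (y / 2 + 1 / 2).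
rewrite (_ : x / 2 + 1 / 2 - (y / 2 + 1 / 2) = x / 2 - y / 2) in h2; last by ring.
rewrite e1 in h1 h2.
have := Rmult_le_compat_l _ _ _ hK hle; have := Rmult_le_compat_l _ _ _ hK' hle; lra.
Qed.

Lemma cts_psiR al : 1 / 3 <= al <= 2 / 3 -> forall x, continuous (psiR al) x.
Proof. by move=> h; have [K [_ hK]] := psiR_holder al h; exact: (holder_cts _ K hK). Qed.

Lemma cts_psi_val j : forall x, continuous (psi_val j) x.
Proof.
have h1 := cts_psiR (1 / 3) ltac:(lra); have h2 := cts_psiR (2 / 3) ltac:(lra).
rewrite /psi_val; case: Z.eqb; first by cts.
by case: Z.eqb.
Qed.

(** At these frequencies this is the formula zeta(s, 1/3) + zeta(s, 2/3) + zeta(s) = 3^s zeta(s). It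
    is read off from [prof_triple] by taking Fourier coefficients, where the constant is invisible
    for nonzero k. *)
Lemma pcoef_triple k : k <> 0%Z ->
  (pcoef P (1 / 3) k + pcoef P (2 / 3) k + pcoef P 1 k)%C = (wave k (ln 3 / ln P) * pcoef P 1 k)%C.
Proof.
move=> hk; rewrite !pcoef_parts // waveE.
set f1 := prof P (1 / 3); set f2 := prof P (2 / 3); set f3 := prof P 1; set h := ln 3 / ln P.
have c1 := cts_prof P (1 / 3) P_ge2 third; have c2 := cts_prof P (2 / 3) P_ge2 two_thirds.
have c3 := cts_prof P 1 P_ge2 one_range.
have hper u : f3 (u + 1) = f3 u by exact: prof_periodic.
have hsh u : f1 u + f2 u + f3 u = f3 (u + h) - h / 2 by exact: prof_triple.
have cs := cts_shift f3 c3 h.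
have ct := cts_tcos k; have cu := cts_tsin k.
have e1 : fcos f1 k + fcos f2 k + fcos f3 k = tcos k h * fcos f3 k + tsin k h * fsin f3 k.
  rewrite -(fcos_shift f3 c3 hper) /fcos -!RIntD; try by cts.
  rewrite (RInt_eq _ (fun u => f3 (u + h) * tcos k u - h / 2 * tcos k u)); last first.
    by move=> u; rewrite -!Rmult_plus_distr_r hsh; ring.
  by rewrite RIntB ?RIntZ ?RInt_tcos //; [toR; ring | cts | cts].
have e2 : fsin f1 k + fsin f2 k + fsin f3 k = tcos k h * fsin f3 k - tsin k h * fcos f3 k.
  rewrite -(fsin_shift f3 c3 hper) /fsin -!RIntD; try by cts.
  rewrite (RInt_eq _ (fun u => f3 (u + h) * tsin k u - h / 2 * tsin k u)); last first.
    by move=> u; rewrite -!Rmult_plus_distr_r hsh; ring.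
  by rewrite RIntB ?RIntZ ?RInt_tsin //; [toR; ring | cts | cts].
by apply: C_ext => /=; lra.
Qed.

(** Exchanging 1/3 and 2/3 makes the two coefficients opposite for odd k and equal for even k. In
    the even case k = 2 m the frequency is also one of base p, and [pcoef_triple] applies. *)
Lemma d_coef_0_eq k : k <> 0%Z ->
  d_coef p k 0 =
    if Z.even k then
      ((Rcpow 3 (chi_half p k) - 1) * riemann_zeta (chi_half p k)
       / (chi_half p k * (1 + chi_half p k) * RtoC (ln P)))%C
    else RtoC 0.
Proof.
move=> hk; rewrite /d_coef /=.
rewrite (d_coef_pm_eq k 1 (1 / 3)) ?(d_coef_pm_eq k (-1) (2 / 3)) //; try by [left | right].
rewrite (_ : 1 - 1 / 3 = 2 / 3); last by field.
rewrite (_ : 1 - 2 / 3 = 1 / 3); last by field.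
case he : (Z.even k); rewrite /sgnpow he; last first.
  by have -> : RtoC (-1) = (- RtoC 1)%C by [apply: C_ext => /=; ring]; ring.
have /Z.even_spec [m hm] := he.
have hm0 : m <> 0%Z by lia.
have ef : freq B k = freq P m.
  apply: C_ext => //=; rewrite lnB hm mult_IZR; field; have := lnP_pos; lra.
have ep al : pcoef B al k = (RtoC (1 / 2) * pcoef P al m)%C.
  have h0 := freq_neq0 P P_ge2 m hm0; have h1 := freq_plus1_neq0 P m; have h2 := RtoC_lnP_neq0.
  have h20 : RtoC 2 <> RtoC 0 by move=> /RtoC_inj; lra.
  rewrite /pcoef ef lnB RtoC_mult RtoC_div; last lra.
  by field; repeat split.
rewrite chi_half_freq ef Rcpow_freq // riemann_zeta_freq // !ep.
have ht := pcoef_triple m hm0.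
have eh : (RtoC (1 / 2) + RtoC (1 / 2))%C = RtoC 1 by rewrite -RtoC_plus; congr RtoC; field.
move: (RtoC (1 / 2)) eh => hf eh.
transitivity ((hf + hf) * (pcoef P (1 / 3) m + pcoef P (2 / 3) m + pcoef P 1 m - pcoef P 1 m))%C; first by ring.
rewrite eh ht /pcoef; have h0 := freq_neq0 P P_ge2 m hm0; have h1 := freq_plus1_neq0 P m; have h2 := RtoC_lnP_neq0.
by field; repeat split => //; rewrite Cplus_comm.
Qed.

(** The mean in [prof_triple]: the profile for [al = 1] drops out since translation keeps its mean.
    This value is the source of the sqrt 3 in the linear term of the formula. *)
Lemma mean_thirds : fcos (prof B (1 / 3)) 0 + fcos (prof B (2 / 3)) 0 = - (ln 3 / ln P) / 4.
Proof.
set f1 := prof B (1 / 3); set f2 := prof B (2 / 3); set f3 := prof B 1; set h := ln 3 / ln B.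
have c1 := cts_prof B (1 / 3) B_ge2 third; have c2 := cts_prof B (2 / 3) B_ge2 two_thirds.
have c3 := cts_prof B 1 B_ge2 one_range.
have hper u : f3 (u + 1) = f3 u by exact: prof_periodic.
have hsh u : f1 u + f2 u + f3 u = f3 (u + h) - h / 2 by exact: prof_triple.
have cs := cts_shift f3 c3 h; have ct := cts_tcos 0.
have e1 : fcos f1 0 + fcos f2 0 + fcos f3 0 = fcos f3 0 - h / 2.
  transitivity (fcos (fun u => f3 (u + h)) 0 - h / 2).
    rewrite /fcos -!RIntD; try by cts.
    rewrite (RInt_eq _ (fun u => f3 (u + h) * tcos 0 u - h / 2 * tcos 0 u)); last first.
      by move=> u; rewrite -!Rmult_plus_distr_r hsh; ring.
    by rewrite RIntB ?RIntZ ?RInt_tcos0 //; [toR; ring | cts | cts].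
  rewrite (fcos_shift f3 c3 hper) /tcos /tsin Rmult_0_r Rmult_0_l cos_0 sin_0; ring.
have eh : h = ln 3 / ln P / 2 by rewrite /h lnB; field; have := lnP_pos; lra.
lra.
Qed.

(** [prof_square] recombines the half-period translates into profiles of base p, with corrections
    that cancel between 1/3 and 2/3; the constant of [prof_triple] cancels against the means. *)
Lemma psi_val_0 x : psi_val 0 x = prof P 1 (x + ln 3 / ln P) - prof P 1 x.
Proof.
rewrite /psi_val /= /psiR /dev (_ : 1 - 1 / 3 = 2 / 3); last by field.
rewrite (_ : 1 - 2 / 3 = 1 / 3); last by field.
have h1 := prof_square P (1 / 3) x P_ge2 third; have h2 := prof_square P (2 / 3) x P_ge2 two_thirds.
have h3 := prof_triple P x P_ge2; have h4 := mean_thirds; lra.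
Qed.

End Assembly.

(** * The exact formula *)

Section Valuation.

Variable p : nat.
Hypothesis p_prime : prime p.
Hypothesis p_mod3 : (p = 2 %[mod 3])%N.

Local Notation P := (INR p).
Local Notation B := (INR p * INR p).

Let p_ge2 : (2 <= p)%N. Proof. exact: prime_gt1. Qed.
Let P_ge2 : 2 <= P. Proof. by apply: (le_INR 2); exact/leP. Qed.
Let B_ge2 : 2 <= B. Proof. by have := P_ge2; nra. Qed.

Lemma INR_expn m n : INR (m ^ n)%N = INR m ^ n.
Proof. by elim: n => [|n IH] //; rewrite expnS INR_muln IH. Qed.

Lemma pow_mod3_even i : (p ^ (2 * i) = 1 %[mod 3])%N.
Proof. by rewrite expnM -modnXm -(modnXm 2 3 p) p_mod3 /= exp1n. Qed.

Lemma pow_mod3_odd i : (p ^ (2 * i).+1 = 2 %[mod 3])%N.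
Proof. by rewrite expnS -modnMm pow_mod3_even p_mod3. Qed.

(** Every sampling point is an integer, and there [saw 1] is 0. *)
Lemma takagi_integer (m n : nat) : takagi (INR m) 1 (INR n) = 0.
Proof.
rewrite /takagi (Series_ext _ (fun _ => 0)); first by apply: is_series_unique; apply/is_series_psum;
  apply: (is_lim_seq_ext (fun _ => 0)); [elim => [|k IH] //=; lra | exact: is_lim_seq_const].
move=> k; rewrite -INR_expn -INR_muln /saw.
rewrite (_ : INR (m ^ k * n) - 1 = 0 + IZR (Z.of_nat (m ^ k * n) - 1)); last by rewrite minus_IZR -INR_IZR_INZ; ring.
by rewrite bumpD_Z bump_1 bump_unit; [rewrite /Rdiv; ring | lra].
Qed.

(* Points congruent to [al] modulo 1 stay so under multiplication by powers of [p * p]. *)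
Lemma takagi_third al (z : Z) : (al = 1 / 3 \/ al = 2 / 3) -> takagi B al (al + IZR z) = - (1 / 9) * (B / (B - 1)).
Proof.
move=> hal.
have hs m : saw al (B ^ m * (al + IZR z)) = - (1 / 9).
  have [w hw] : exists w : Z, B ^ m = 3 * IZR w + 1.
    exists (Z.of_nat (p ^ (2 * m) %/ 3)); rewrite -INR_IZR_INZ.
    have h : (p ^ (2 * m) = 3 * (p ^ (2 * m) %/ 3) + 1)%N.
      by have := divn_eq (p ^ (2 * m)) 3; rewrite pow_mod3_even; lia.
    have := f_equal INR h; rewrite INR_addn (INR_muln 3) INR_expn pow_mult /= Rmult_1_r => ->; ring.
  have [w' hw'] : exists w' : Z, (B ^ m - 1) * al = IZR w'.
    case: hal => ->; [exists w | exists (2 * w)%Z]; rewrite ?mult_IZR hw; field.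
  have [v hv] : exists v : Z, B ^ m * IZR z = IZR v.
    by exists ((3 * w + 1) * z)%Z; rewrite !mult_IZR plus_IZR mult_IZR hw.
  rewrite /saw (_ : B ^ m * (al + IZR z) - al = 0 + IZR (w' + v)); last by rewrite plus_IZR -hw' -hv; ring.
  rewrite bumpD_Z bump_unit; last lra.
  by case: hal => ->; rewrite ?bump_third ?bump_two_thirds; field.
rewrite /takagi (Series_ext _ (fun m => - (1 / 9) * (/ B) ^ m)); last by move=> m; rewrite hs pow_inv; ring.
have hB := B_ge2.
have hi : 0 < / B <= 1 / 2.
  by split; [apply: Rinv_0_lt_compat; lra | rewrite /Rdiv Rmult_1_l; apply: Rinv_le_contravar; lra].
rewrite Series_scal_l Series_geom; last by rewrite Rabs_pos_eq; lra.
by move: hB {hs hi}; move: (INR p * INR p) => b hb; field; repeat split; lra.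
Qed.

(** An even number of levels is taken in order to pair them. On odd levels p^(2i+1) = B^(i+1) / P,
    which multiplies the point by P and divides the sum by P, so that both parities run over powers
    of B. *)
Lemma INR_logn_T (N n : nat) : (3 * N < (2 * n).+1)%N ->
  INR (logn p (T N)) =
    psum (fun i => P ^ S i * (2 * ramp 1 (INR N / P ^ S i) - ramp 1 (2 * INR N / P ^ S i))) (2 * n)%N
    + psum (fun i => B ^ S i * ramp (1 / 3) ((INR N + 1 / 3) / B ^ S i)) n
    + / P * psum (fun i => B ^ S i * ramp (2 / 3) (P * (INR N + 1 / 3) / B ^ S i)) n
    + psum (fun i => B ^ S i * ramp (2 / 3) ((INR N - 1 / 3) / B ^ S i)) n
    + / P * psum (fun i => B ^ S i * ramp (1 / 3) (P * (INR N - 1 / 3) / B ^ S i)) n.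
Proof.
move=> hn; have hP := P_ge2; have := logn_T p N _ p_prime hn.
move/(f_equal INR); rewrite INR_addn !sum_nat_psum => h.
have hq k : (0 < p ^ k)%N by rewrite expn_gt0 prime_gt0.
set u := fun i => P ^ S i * (2 * ramp 1 (INR N / P ^ S i) - ramp 1 (2 * INR N / P ^ S i)).
(* The index i stands for level i + 1, so odd i means that the power of p is 1 modulo 3. *)
set v := fun i => P ^ S i * (ramp (if odd i then 1 / 3 else 2 / 3) ((INR N + 1 / 3) / P ^ S i)
   + ramp (if odd i then 2 / 3 else 1 / 3) ((INR N - 1 / 3) / P ^ S i)).
have -> : INR (logn p (T N)) = psum u (2 * n)%N + psum v (2 * n)%N.
  have -> : INR (logn p (T N)) = psum (fun i => INR (asm_num (p ^ S i) N)) (2 * n)%N - psum (fun i => INR (asm_den (p ^ S i) N)) (2 * n)%N by lra.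
  elim: (2 * n)%N => [|m IH] /=; first by ring.
  have -> : psum (fun i => INR (asm_num (p ^ S i) N)) m + INR (asm_num (p ^ S m) N)
     - (psum (fun i => INR (asm_den (p ^ S i) N)) m + INR (asm_den (p ^ S m) N))
     = (psum (fun i => INR (asm_num (p ^ S i) N)) m - psum (fun i => INR (asm_den (p ^ S i) N)) m)
       + (INR (asm_num (p ^ S m) N) - INR (asm_den (p ^ S m) N)) by ring.
  rewrite IH asm_den_ramp // INR_expn.
  have -> : INR (asm_num (p ^ S m) N) = P ^ S m * (ramp 1 (INR N / P ^ S m)
     + ramp (if odd m then 1 / 3 else 2 / 3) ((INR N + 1 / 3) / P ^ S m)
     + ramp (if odd m then 2 / 3 else 1 / 3) ((INR N - 1 / 3) / P ^ S m)).
    have e := odd_double_half m; rewrite -mul2n in e.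
    case ho : (odd m) e => e.
    - rewrite (asm_num_ramp _ N (1 / 3)) //; last first.
        by left; split=> //; rewrite -e (_ : (true + 2 * m./2).+1 = 2 * (m./2).+1)%N; [exact: pow_mod3_even | lia].
      by rewrite INR_expn (_ : 1 - 1 / 3 = 2 / 3); last by field.
    - rewrite (asm_num_ramp _ N (2 / 3)) //; last first.
        by right; split=> //; rewrite -e add0n; exact: pow_mod3_odd.
      by rewrite INR_expn (_ : 1 - 2 / 3 = 1 / 3); last by field.
  by rewrite /u /v /=; ring.
have -> : psum v (2 * n)%N = psum (fun i => B ^ S i * ramp (1 / 3) ((INR N + 1 / 3) / B ^ S i)) n
    + / P * psum (fun i => B ^ S i * ramp (2 / 3) (P * (INR N + 1 / 3) / B ^ S i)) n
    + psum (fun i => B ^ S i * ramp (2 / 3) ((INR N - 1 / 3) / B ^ S i)) n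
    + / P * psum (fun i => B ^ S i * ramp (1 / 3) (P * (INR N - 1 / 3) / B ^ S i)) n.
  rewrite psum_pairs -!psum_scal; elim: (n) => [|m IH]; first by rewrite /=; ring.
  rewrite !psumS IH /v.
  have o1 : odd (2 * m) = false by rewrite mul2n odd_double.
  have o2 : odd (2 * m).+1 = true by rewrite /= o1.
  rewrite o1 o2.
  have hb : P ^ (2 * m).+2 = B ^ S m.
    by rewrite (_ : (2 * m).+2 = (2 * S m)%coq_nat) ?pow_mult /= ?Rmult_1_r //; rewrite -multE; lia.
  have hb1 : P ^ (2 * m).+1 = / P * B ^ S m by rewrite -hb /=; field; lra.
  have hBm : 0 < B ^ S m by apply: pow_lt; have := B_ge2; lra.
  rewrite hb hb1.
  have hd x : x / (/ P * B ^ S m) = P * x / B ^ S m by field; split; lra.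
  by rewrite !hd; ring.
ring.
Qed.

Lemma valuation_formula (N : nat) : (0 < N)%N ->
  INR (logn p (T N)) = INR N * logb p (2 / sqrt 3)
    + INR N * (prof P 1 (logb p (INR N)) - 2 * prof P 1 (logb p (INR N) + ln 2 / ln P)
               + prof P 1 (logb p (INR N) + ln 3 / ln P))
    + ((INR N + 1 / 3) * psi_val p 1 (logb p (INR N + 1 / 3))
       + (INR N - 1 / 3) * psi_val p (-1) (logb p (INR N - 1 / 3))
       - INR N * psi_val p 0 (logb p (INR N)))
    + (P + 1) / (6 * (P - 1)).
Proof.
move=> hN; have hP := P_ge2; have hB := B_ge2.
have hN1 : 1 <= INR N by apply: (le_INR 1); exact/leP.
have hlP : 0 < ln P by exact: ln_b_pos.
have elB : ln B = 2 * ln P by rewrite ln_mult; lra.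
(* The height has to satisfy 4 P N <= B^n and 3 N <= 2 n; since m < B^m this choice gives both. *)
set n := (4 * p * N)%N.
have hBn m : (m <= n)%N -> INR m <= B ^ n.
  move=> hm; have -> : B ^ n = INR ((p * p) ^ n)%N by rewrite INR_expn INR_muln.
  apply: le_INR; apply/leP; apply: leq_trans hm _; apply: ltnW; apply: ltn_expl; nia.
have hBig : 4 * P * INR N <= B ^ n by have := hBn n (leqnn n); rewrite /n !INR_muln /=; lra.
have hBn0 : 0 < B ^ n by apply: pow_lt; lra.
have hPn : P ^ (2 * n)%N = B ^ n.
  by rewrite (_ : (2 * n)%N = (2 * n)%coq_nat) ?pow_mult /= ?Rmult_1_r.
rewrite (INR_logn_T N n); last by rewrite /n; nia.
have hdiv x c : 0 < c -> x <= c * B ^ n -> x / B ^ n <= c.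
  by move=> hc hx; apply: (Rmult_le_reg_r (B ^ n)) => //; rewrite /Rdiv Rmult_assoc Rinv_l; lra.
have hPN : 2 * INR N <= P * INR N by apply: Rmult_le_compat_r; lra.
have c1 : INR N / P ^ (2 * n)%N <= P * 1 by rewrite hPn; apply: hdiv; nra.
have c2 : 2 * INR N / P ^ (2 * n)%N <= P * 1 by rewrite hPn; apply: hdiv; nra.
have hBt : 1 <= B * (1 / 3) by nra.
have hsmall x al : 1 / 3 <= al -> x <= B ^ n -> x / B ^ n <= B * al.
  move=> hal hx; have h : 1 <= B * al by nra.
  by apply: hdiv; [lra | have := Rmult_le_compat_r (B ^ n) _ _ (Rlt_le _ _ hBn0) h; lra].
have r1 : 1 / 3 <= 1 / 3 <= 1 by lra.
have r2 : 1 / 3 <= 2 / 3 <= 1 by lra.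
have r3 : 1 / 3 <= 1 <= 1 by lra.
have s1 := ramp_sum P 1 P_ge2 r3 (INR N) (2 * n)%N ltac:(lra) c1.
have s2 := ramp_sum P 1 P_ge2 r3 (2 * INR N) (2 * n)%N ltac:(lra) c2.
have s3 := ramp_sum B (1 / 3) B_ge2 r1 (INR N + 1 / 3) n ltac:(lra) ltac:(apply: hsmall; nra).
have s4 := ramp_sum B (2 / 3) B_ge2 r2 (P * (INR N + 1 / 3)) n ltac:(apply: Rmult_lt_0_compat; lra) ltac:(apply: hsmall; nra).
have s5 := ramp_sum B (2 / 3) B_ge2 r2 (INR N - 1 / 3) n ltac:(lra) ltac:(apply: hsmall; nra).
have s6 := ramp_sum B (1 / 3) B_ge2 r1 (P * (INR N - 1 / 3)) n ltac:(apply: Rmult_lt_0_compat; lra) ltac:(apply: hsmall; nra).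
have -> : psum (fun i => P ^ S i * (2 * ramp 1 (INR N / P ^ S i) - ramp 1 (2 * INR N / P ^ S i))) (2 * n)%N =
   2 * psum (fun i => P ^ S i * ramp 1 (INR N / P ^ S i)) (2 * n)%N - psum (fun i => P ^ S i * ramp 1 (2 * INR N / P ^ S i)) (2 * n)%N.
  by elim: (2 * n)%N => [|m IH]; [rewrite /=; ring | rewrite !psumS IH; ring].
rewrite s1 s2 s3 s4 s5 s6.
have t2 : takagi P 1 (2 * INR N) = 0 by rewrite -(takagi_integer p (2 * N)) INR_muln.
(* Because p is 2 modulo 3, P (N + 1/3) and P (N - 1/3) are congruent to 2/3 and 1/3 modulo 1, as
   [takagi_third] requires. *)
have [w hw] : exists w : Z, P = 3 * IZR w + 2.
  exists (Z.of_nat (p %/ 3)); rewrite -INR_IZR_INZ.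
  have h : (p = 3 * (p %/ 3) + 2)%N by have := divn_eq p 3; rewrite p_mod3; lia.
  by have := f_equal INR h; rewrite INR_addn (INR_muln 3) /=; lra.
have t3 : takagi B (1 / 3) (INR N + 1 / 3) = - (1 / 9) * (B / (B - 1)).
  by rewrite -(takagi_third (1 / 3) (Z.of_nat N)); [congr takagi; rewrite -INR_IZR_INZ; ring | left].
have t4 : takagi B (2 / 3) (P * (INR N + 1 / 3)) = - (1 / 9) * (B / (B - 1)).
  rewrite -(takagi_third (2 / 3) ((3 * w + 2) * Z.of_nat N + w)); last by right.
  by congr takagi; rewrite plus_IZR mult_IZR plus_IZR mult_IZR -INR_IZR_INZ hw; field.
have t5 : takagi B (2 / 3) (INR N - 1 / 3) = - (1 / 9) * (B / (B - 1)).
  rewrite -(takagi_third (2 / 3) (Z.of_nat N - 1)); last by right.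
  by congr takagi; rewrite minus_IZR -INR_IZR_INZ; field.
have t6 : takagi B (1 / 3) (P * (INR N - 1 / 3)) = - (1 / 9) * (B / (B - 1)).
  rewrite -(takagi_third (1 / 3) ((3 * w + 2) * Z.of_nat N - w - 1)); last by left.
  by congr takagi; rewrite !minus_IZR mult_IZR plus_IZR mult_IZR -INR_IZR_INZ hw; field.
rewrite (takagi_integer p N) t2 t3 t4 t5 t6 elB (ln_mult 2 (INR N)) ?(ln_mult P) /logb; try lra.
have -> : ln (2 / sqrt 3) = ln 2 - ln 3 / 2.
  rewrite ln_div; try lra; last by apply: sqrt_lt_R0; lra.
  have hs : sqrt 3 * sqrt 3 = 3 by apply: sqrt_sqrt; lra.
  have := f_equal ln hs; rewrite ln_mult; try (apply: sqrt_lt_R0; lra); lra.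
rewrite psi_val_0 // /psi_val /= /psiR /dev.
have e1 : 1 - 1 / 3 = 2 / 3 by field.
have e2 : 1 - 2 / 3 = 1 / 3 by field.
rewrite e1 e2.
have d1 x : x / (2 * ln P) = x / ln P / 2 by field; lra.
have d2 x : (ln P + x) / ln P = 1 + x / ln P by field; lra.
have d3 x y : (x + y) / ln P = y / ln P + x / ln P by field; lra.
have d4 x : (1 + x) / 2 = x / 2 + 1 / 2 by field.
have d5 : (ln 2 - ln 3 / 2) / ln P = ln 2 / ln P - ln 3 / ln P / 2 by field; lra.
rewrite !d1 !d2 (d3 (ln 2)) !d4 d5.
(* The functions psi have their means removed. Putting the means back, with total weight (N + 1/3) +
   (N - 1/3) = 2 N, yields the term - N log_p 3 / 2. *)
have hm := mean_thirds p p_ge2.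
have hB1 : B - 1 = (P - 1) * (P + 1) by ring.
rewrite hB1.
move: (prof P 1) (prof B (1 / 3)) (prof B (2 / 3)) (fcos (prof B (1 / 3)) 0) (fcos (prof B (2 / 3)) 0) hm => f g h k1 k2 hm.
have -> : k1 = - (ln 3 / ln P) / 4 - k2 by lra.
move: (ln 2 / ln P) (ln 3 / ln P) (ln (INR N) / ln P) (ln (INR N + 1 / 3) / ln P) (ln (INR N - 1 / 3) / ln P) => l2 l3 v v1 v2.
move: (f v) (f (v + l2)) (f (v + l3)) (g (v1 / 2)) (g (v2 / 2 + 1 / 2)) (h (v2 / 2)) (h (v1 / 2 + 1 / 2)) => f1 f2 f3 g1 g2 h1 h2.
move: P (INR N) hP => q n0 hq; clear -hq.
(* The squares of N cancel, and so does the profile translated by log_p 3 between Phi and psi_0. The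
   constant is 2 P / (9 (P - 1)) from the Takagi values, plus 1 / (9 (P - 1)) from the squares of N
   + 1/3 and N - 1/3, minus 1/18 from the terms linear in the logarithm. *)
field; split; lra.
Qed.

End Valuation.

(** * Size of Psi *)

Lemma ln_le_sub1 x : 0 < x -> ln x <= x - 1.
Proof.
by move=> hx; have := exp_ineq1_le (ln x); rewrite exp_ln //; lra.
Qed.

Section Remainder.

Variable p : nat.
Hypothesis p_ge2 : (2 <= p)%N.

Local Notation P := (INR p).
Let P_ge2 : 2 <= P. Proof. by apply: (le_INR 2); exact/leP. Qed.

Lemma logb_near n x : 2 <= n -> Rabs (x - n) <= 1 / 3 -> Rabs (logb p x - logb p n) <= / ln P / n.
Proof.
move=> hn hx; have hl := ln_b_pos P P_ge2.
have [h1 h2] : - (1 / 3) <= x - n <= 1 / 3 by move: hx => /Rabs_le_between.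
rewrite /logb (_ : ln x / ln P - ln n / ln P = (ln x - ln n) * / ln P); last by field; lra.
rewrite Rabs_mult (Rabs_pos_eq (/ _)); last by apply/Rlt_le/Rinv_0_lt_compat.
rewrite /Rdiv [X in _ <= X]Rmult_comm; apply: Rmult_le_compat_r; first by apply/Rlt_le/Rinv_0_lt_compat.
have u1 := ln_le_sub1 (x / n) ltac:(apply: Rdiv_lt_0_compat; lra).
have u2 := ln_le_sub1 (n / x) ltac:(apply: Rdiv_lt_0_compat; lra).
rewrite ln_div in u1; try lra; rewrite ln_div in u2; try lra.
have v1 : x / n - 1 <= / n.
  rewrite (_ : x / n - 1 = (x - n) * / n); last by field; lra.
  have := Rmult_le_compat_r (/ n) (x - n) 1 (Rlt_le _ _ (Rinv_0_lt_compat n ltac:(lra))) ltac:(lra); lra.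
have v2 : n / x - 1 <= / n.
  rewrite (_ : n / x - 1 = (n - x) / x); last by field; lra.
  apply: (Rmult_le_reg_r (n * x)); first by nra.
  rewrite (_ : (n - x) / x * (n * x) = (n - x) * n); last by field; lra.
  rewrite (_ : / n * (n * x) = x); last by field; lra.
  nra.
by apply/Rabs_le_between; lra.
Qed.

Lemma psiR_bounded al : 1 / 3 <= al <= 2 / 3 -> exists M, 0 <= M /\ forall x, Rabs (psiR p al x) <= M.
Proof.
move=> hal; have hB : 2 <= P * P by have := P_ge2; nra.
have [M [hM h]] := prof_bounded (P * P) al hB ltac:(lra).
have [M' [hM' h']] := prof_bounded (P * P) (1 - al) hB ltac:(lra).
set c := fcos (prof (P * P) al) 0; set c' := fcos (prof (P * P) (1 - al)) 0.
exists (M + Rabs c + (M' + Rabs c')); split=> [|x]; first by have := Rabs_pos c; have := Rabs_pos c'; lra.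
rewrite /psiR /dev -/c -/c'.
apply: Rle_trans (Rabs_triang _ _) _; apply: Rplus_le_compat.
  by apply: Rle_trans (Rabs_triang _ _) _; rewrite Rabs_Ropp; have := h (x / 2); lra.
by apply: Rle_trans (Rabs_triang _ _) _; rewrite Rabs_Ropp; have := h' (x / 2 + 1 / 2); lra.
Qed.

(* By the Hoelder bound a shift of [n] by 1/3 changes [n * psiR] by [n * O(n ^ (- 3 / 4))]. *)
Lemma psiR_shift al : 1 / 3 <= al <= 2 / 3 -> exists K, 0 <= K /\ forall n x, 2 <= n -> / ln P <= n ->
  Rabs (x - n) <= 1 / 3 -> n * Rabs (psiR p al (logb p x) - psiR p al (logb p n)) <= K * sqrt n.
Proof.
move=> hal; have hl := ln_b_pos P P_ge2; have [K [hK h]] := psiR_holder p p_ge2 al hal.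
have hi := Rinv_0_lt_compat _ hl.
exists (K * sqrt (/ ln P)); split; first by apply: Rmult_le_pos => //; exact: sqrt_pos.
move=> n x hn hn' hx; have hd := logb_near n x hn hx.
have hd1 : 0 <= / ln P / n <= 1.
  split; first by apply: Rdiv_le_0_compat; lra.
  by apply: (Rmult_le_reg_r n); [lra | rewrite /Rdiv Rmult_assoc Rinv_l; lra].
have h1 := pow34_le _ _ (Rabs_pos _) hd; have h2 := pow34_le_sqrt _ hd1.
have h3 := h (logb p x) (logb p n).
have h4 : Rabs (psiR p al (logb p x) - psiR p al (logb p n)) <= K * sqrt (/ ln P / n).
  by apply: Rle_trans h3 _; apply: Rmult_le_compat_l => //; lra.
apply: Rle_trans (Rmult_le_compat_l n _ _ ltac:(lra) h4) _.
rewrite sqrt_div; try lra.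
have hs : sqrt n * sqrt n = n by apply: sqrt_sqrt; lra.
have hs0 : 0 < sqrt n by apply: sqrt_lt_R0; lra.
have -> : n * (K * (sqrt (/ ln P) / sqrt n)) = K * sqrt (/ ln P) * (n / sqrt n) by field; lra.
by rewrite -{1}hs (_ : sqrt n * sqrt n / sqrt n = sqrt n); [exact: Rle_refl | field; lra].
Qed.

Lemma PsiE N : Psi p N = RtoC ((INR N + 1 / 3) * psi_val p 1 (logb p (INR N + 1 / 3))
  + (INR N - 1 / 3) * psi_val p (-1) (logb p (INR N - 1 / 3)) - INR N * psi_val p 0 (logb p (INR N))).
Proof. by rewrite /Psi !(psiE p p_ge2) // -!RtoC_mult -RtoC_plus -RtoC_minus. Qed.

(** As psi_0 is the sum of psi_1 and psi_(-1), the main parts cancel up to a shift of the argument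
    by 1/3, which [psiR_shift] controls; the weights +1/3 and -1/3 contribute only a bounded
    amount. *)
Lemma Psi_bound : exists K, eventually (fun N => Cmod (Psi p N) <= K * (Rpower (INR N) (1 / 2) * ln (INR N))).
Proof.
have r1 : 1 / 3 <= 1 / 3 <= 2 / 3 by lra.
have r2 : 1 / 3 <= 2 / 3 <= 2 / 3 by lra.
have [K1 [hK1 k1]] := psiR_shift _ r1; have [K2 [hK2 k2]] := psiR_shift _ r2.
have [M1 [hM1 m1]] := psiR_bounded _ r1; have [M2 [hM2 m2]] := psiR_bounded _ r2.
have [N0 hN0] : exists N0 : nat, / ln P <= INR N0.
  have [m hm] := nfloor_ex (/ ln P) ltac:(apply/Rlt_le/Rinv_0_lt_compat; exact: ln_b_pos).
  by exists (S m); rewrite S_INR; lra.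
(* From 3 on, which exceeds e, the logarithm is at least 1 and can be inserted as a factor; [N0]
   serves the hypothesis of [psiR_shift] that n is at least 1 / ln P. *)
exists (K1 + K2 + M1 + M2), (N0 + 3)%N => N /leP hN; rewrite PsiE Cmod_R.
have hn3 : 3 <= INR N by have := le_INR 3 N ltac:(apply/leP; lia); rewrite /=; lra.
have hnN0 : / ln P <= INR N by apply: Rle_trans hN0 _; apply: le_INR; apply/leP; lia.
move: (INR N) hn3 hnN0 => n hn3 hn.
have hl : 1 <= ln n.
  by rewrite -(ln_exp 1); apply: ln_le; [exact: exp_pos | have := exp_le_3; lra].
have -> : Rpower n (1 / 2) = sqrt n by rewrite /Rdiv Rmult_1_l Rpower_sqrt //; lra.
have hs : 1 <= sqrt n by rewrite -sqrt_1; apply: sqrt_le_1; lra.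
rewrite /psi_val /=.
have a1 := k1 n (n + 1 / 3) ltac:(lra) hn ltac:(rewrite (_ : n + 1 / 3 - n = 1 / 3); [rewrite Rabs_pos_eq; lra | ring]).
have a2 := k2 n (n - 1 / 3) ltac:(lra) hn ltac:(rewrite (_ : n - 1 / 3 - n = - (1 / 3)); [rewrite Rabs_Ropp Rabs_pos_eq; lra | ring]).
have b1 := m1 (logb p (n + 1 / 3)); have b2 := m2 (logb p (n - 1 / 3)).
move: (psiR p (1 / 3) (logb p (n + 1 / 3))) (psiR p (1 / 3) (logb p n)) (psiR p (2 / 3) (logb p (n - 1 / 3)))
  (psiR p (2 / 3) (logb p n)) a1 a2 b1 b2 => u u0 v v0 a1 a2 b1 b2.
have -> : (n + 1 / 3) * u + (n - 1 / 3) * v - n * (u0 + v0) = n * (u - u0) + n * (v - v0) + (u * (1 / 3) + v * (- (1 / 3))) by ring.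
have t : Rabs (n * (u - u0) + n * (v - v0) + (u * (1 / 3) + v * (- (1 / 3)))) <= K1 * sqrt n + K2 * sqrt n + (M1 + M2).
  apply: Rle_trans (Rabs_triang _ _) _; apply: Rplus_le_compat.
    apply: Rle_trans (Rabs_triang _ _) _.
    by rewrite !Rabs_mult (Rabs_pos_eq n); lra.
  apply: Rle_trans (Rabs_triang _ _) _.
  by have := Rabs_pos u; have := Rabs_pos v; rewrite (Rabs_mult u) (Rabs_mult v) Rabs_Ropp (Rabs_pos_eq (1 / 3)); lra.
apply: Rle_trans t _.
apply: (Rle_trans _ ((K1 + K2 + M1 + M2) * sqrt n)); first by nra.
rewrite -Rmult_assoc -[X in X <= _]Rmult_1_r; apply: Rmult_le_compat_l => //.
by apply: Rmult_le_pos; lra.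
Qed.

End Remainder.

Theorem theorem2 (p : nat) (p_prime : prime p)
    (p_mod3 : (p = 2 %[mod 3])%N) :
  (forall k : Z, k <> 0%Z ->
     d_coef p k 0 =
       if Z.even k then
         ((Rcpow 3 (chi_half p k) - 1) * riemann_zeta (chi_half p k)
          / (chi_half p k * (1 + chi_half p k) * RtoC (ln (INR p))))%C
       else RtoC 0) /\
  (forall N : nat, (0 < N)%N ->
     RtoC (INR (logn p (T N))) =
       (RtoC (INR N * logb p (2 / sqrt 3))
        + RtoC (INR N) * Phi p (logb p (INR N))
        + Psi p N
        + RtoC ((INR p + 1) / (6 * (INR p - 1))))%C) /\
  ((forall x : R, abs_summable_nz (Phi_term p x)) /\
   (forall x : R, Phi p (x + 1) = Phi p x) /\
   (forall x : R, continuous (Phi p) x)) /\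
  (forall j : Z, (-1 <= j <= 1)%Z ->
     (forall x : R, abs_summable_nz (psi_term p j x)) /\
     (forall x : R, psi p j (x + 2) = psi p j x) /\
     (forall x : R, continuous (psi p j) x)) /\
  (exists K : R,
     eventually (fun N : nat =>
       Cmod (Psi p N) <= K * (Rpower (INR N) (1 / 2) * ln (INR N)))).
Proof.
have p_ge2 : (2 <= p)%N by exact: prime_gt1.
have P_ge2 : 2 <= INR p by apply: (le_INR 2); exact/leP.
split; first by move=> k; exact: d_coef_0_eq.
split.
  move=> N hN; rewrite (valuation_formula p p_prime p_mod3 N hN) PhiE // PsiE //.
  by rewrite -!RtoC_mult -!RtoC_plus.
split; last split.
- split; first by move=> x; have [] := Phi_sums p p_ge2 x.
  split=> x.
    rewrite !PhiE //; congr RtoC.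
    rewrite -(prof_periodic (INR p) 1 x) -(prof_periodic (INR p) 1 (x + ln 2 / ln (INR p))) -(prof_periodic (INR p) 1 (x + ln 3 / ln (INR p))).
    by rewrite !(Rplus_assoc x) !(Rplus_comm 1).
  apply: (continuous_ext _ _ _ (fun y => esym (PhiE p p_ge2 y))); apply: ctsC_RtoC.
  have c := cts_prof (INR p) 1 P_ge2 ltac:(lra).
  have c2 := cts_shift _ c (ln 2 / ln (INR p)); have c3 := cts_shift _ c (ln 3 / ln (INR p)).
  by cts.
- move=> j hj; split; first by move=> x; have [] := psi_sums p p_ge2 j x hj.
  split=> x; first by rewrite !psiE // psi_val_periodic.
  apply: (continuous_ext _ _ _ (fun y => esym (psiE p p_ge2 j y hj))); apply: ctsC_RtoC.
  exact: cts_psi_val.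
- exact: Psi_bound.
Qed.
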